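(* Let $F\in Y^*$, let $(\mathbf u,\mathbf s)\in X$ denote the solution to $b(\mathbf u,\mathbf s;\mathbf w,\xi)=F(\mathbf w,\xi)$ for all $(\mathbf w,\xi)\in Y$, and let $(\mathbf u_h,\mathbf s_h)\in X_h$ be the solution to the practical DPG scheme $$(\mathbf u_h,\mathbf s_h)=\mathop{\mathrm{arg\,min}}_{(\mathbf v_h,\mathbf t_h)\in X_h}\lVert b(\mathbf v_h,\mathbf t_h;\cdot)-F\rVert_{Y_h^*}.$$ Then $$\lVert(\mathbf u,\mathbf s)-(\mathbf u_h,\mathbf s_h)\rVert_X\le\lVert b\rVert\,\lVert\Pi\rVert\,\beta^{-1}\min_{(\mathbf v_h,\mathbf t_h)\in X_h}\lVert(\mathbf u,\mathbf s)-(\mathbf v_h,\mathbf t_h)\rVert_X.$$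
   Context: Setting. $\Omega\subset\mathbb R^d$ is a bounded polyhedral Lipschitz domain, $\mathcal I=(0,T_{\mathrm{end}})$ with $0<T_{\mathrm{end}}<\infty$, and $Q=\mathcal I\times\Omega$ with coordinates $(t,x)$. $\nabla_x$ and $\mathrm{div}_x$ are the (weak) gradient and divergence in $x$, and $\mathrm{div}(v,\tau)=\partial_t v+\mathrm{div}_x\tau$ for scalar $v$ and $\mathbb R^d$-valued $\tau$. $L^2$ inner products of pairs $\mathbf v=(v,\tau)$ are taken componentwise and summed. Let $U=\{(v,\tau)\in L^2(Q)\times L^2(Q;\mathbb R^d):\nabla_x v\in L^2(Q;\mathbb R^d),\ \mathrm{div}(v,\tau)\in L^2(Q)\}$. Let $U_0$ be the set of $(v,\tau)\in U$ with $\langle\nabla_x v,\chi\rangle_{L^2(Q)}=-\langle v,\mathrm{div}_x\chi\rangle_{L^2(Q)}$ for all $\chi\in C^\infty(\overline Q;\mathbb R^d)$ (equivalently $v\in L^2(\mathcal I;H^1_0(\Omega))$). Every $(v,\tau)\in U_0$ satisfies $v\in L^2(\mathcal I;H_0^1(\Omega))\cap H^1(\mathcal I;H^{-1}(\Omega))\hookrightarrow C(\overline{\mathcal I};L^2(\Omega))$, so $\gamma_0(v,\tau)=v(0,\cdot)\in L^2(\Omega)$ is well defined. Set $A(v,\tau)=(\mathrm{div}(v,\tau),\ \nabla_x v+\tau)$ and $A^*(v,\tau)=(-\mathrm{div}(v,\tau),\ -\nabla_x v+\tau)$. Partition. $\mathcal T$ is a finite partition $\overline Q=\bigcup\mathcal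 T$ into non-overlapping cells of positive measure $K=K_t\times K_x$ with a time interval $K_t\subset\overline{\mathcal I}$ and a $d$-simplex $K_x\subset\overline\Omega$, shape regular in spatial direction (the ratio of $\mathrm{diam}(K_x)$ and the maximal radius of a ball inscribed in $K_x$ is uniformly bounded). $\mathcal F$ is the set of all facets of cells. Hanging nodes are allowed, but facets match: for all overlapping $f,g\in\mathcal F$, $f\subseteq g$ or $g\subseteq f$. Coarse facets: $\mathcal F_c=\{f\in\mathcal F: f\subseteq g\text{ for some }g\in\mathcal F\text{ implies }f=g\}$; $\mathcal F_c^x$ is the set of coarse facets parallel to the time axis. $\mathcal T_0$ is the set of facets on $\{0\}\times\overline\Omega$, a regular triangulation of $\overline\Omega$ into $d$-simplices. Broken formulation. $H(A^*,K)=\{(w,\chi)\in L^2(K)\times L^2(K;\mathbb R^d):\mathrm{div}(w,\chi)\in L^2(K),\ \nabla_xw\in L^2(K;\mathbb R^d)\}$, $H(A^*,\mathcal T)=\{\mathbf w\in L^2(Q)\times L^2(Q;\mathbb R^d):\mathbf w|_K\in H(A^*,K)\ \forall K\in\mathcal T\}$, and $A^*_h$ is the element-wise application of $A^*$. $Y=H(A^*,\mathcal T)\times L^2(\Omega)$ is a Hilbert space with inner product $\langle(\mathbf w,\xi),(\tilde{\mathbf w},\tilde\xi)\rangle_Y=\langle\mathbf w,\tilde{\mathbf w}\rangle_{L^2(Q)}+\langle A_h^*\mathbf w,A_h^*\tilde{\mathbf w}\rangle_{L^2(Q)}+\langle\xi,\tilde\xi\rangle_{L^2(\Omega)}$ and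 induced norm. The trace operator $\gamma_A:U_0\to Y^*$ is $\langle\gamma_A\mathbf v,(\mathbf w,\xi)\rangle_{\partial\mathcal T}=\langle A\mathbf v,\mathbf w\rangle_{L^2(Q)}-\langle\mathbf v,A_h^*\mathbf w\rangle_{L^2(Q)}+\langle\gamma_0\mathbf v,\xi\rangle_{L^2(\Omega)}$. Set $\Gamma(\partial\mathcal T)=\gamma_AU_0\subset Y^*$ and $\langle\mathbf t,(\mathbf w,\xi)\rangle_{\partial\mathcal T}=\mathbf t(\mathbf w,\xi)$ for $\mathbf t\in\Gamma(\partial\mathcal T)$. Set $X=(L^2(Q)\times L^2(Q;\mathbb R^d))\times\Gamma(\partial\mathcal T)$ and $b(\mathbf v,\mathbf t;\mathbf w,\xi)=\langle\mathbf v,A_h^*\mathbf w\rangle_{L^2(Q)}+\langle\mathbf t,(\mathbf w,\xi)\rangle_{\partial\mathcal T}$. Norm on $X$. Let $T=(T_1,T_2):X\to Y$ be defined by $\langle T(\mathbf v,\mathbf t),(\mathbf w,\xi)\rangle_Y=b(\mathbf v,\mathbf t;\mathbf w,\xi)$ for all $(\mathbf w,\xi)\in Y$, and set $\mathcal E(\mathbf v,\mathbf t)=\mathbf v-A_h^*T_1(\mathbf v,\mathbf t)$, which belongs to $U_0$. Then $\lVert(\mathbf v,\mathbf t)\rVert_X^2=\lVert\mathbf v\rVert_{L^2(Q)}^2+\lVert\mathcal E(\mathbf v,\mathbf t)\rVert_{L^2(Q)}^2+\lVert A\mathcal E(\mathbf v,\mathbf t)\rVert_{L^2(Q)}^2+\lVert\gamma_0\mathcal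 E(\mathbf v,\mathbf t)\rVert_{L^2(\Omega)}^2$. Constants. $c_{\mathbf L}>0$ is a constant with $c_{\mathbf L}\lVert\mathbf v\rVert_{L^2(Q)}^2\le\lVert A\mathbf v\rVert_{L^2(Q)}^2+\lVert\gamma_0\mathbf v\rVert_{L^2(\Omega)}^2$ for all $\mathbf v\in U_0$ (such a constant exists); $\beta=\frac{1+2c_{\mathbf L}-\sqrt{(1+2c_{\mathbf L})^2-4c_{\mathbf L}^2}}{2c_{\mathbf L}}$ and $\lVert b\rVert=\frac{1+2c_{\mathbf L}+\sqrt{(1+2c_{\mathbf L})^2-4c_{\mathbf L}^2}}{2c_{\mathbf L}}$. Discrete spaces. $\mathbb P_k(R)$: polynomials of total degree at most $k$ on $R$; $\mathbb T_k(K)=\mathbb P_k(K_t)\otimes\mathbb P_k(K_x)$; $\mathbb T_k(\mathcal T)$ and $\mathbb P_k(\mathcal L)$ are the corresponding piecewise (discontinuous) spaces. $Y_h=(\mathbb T_m(\mathcal T)\times\mathbb T_1(\mathcal T;\mathbb R^d))\times\mathbb P_1(\mathcal T_0)$ with $m=3$ if $d=1$ and $m=2$ if $d\ge2$; $Y_h^*$ carries the dual norm with respect to $\lVert\cdot\rVert_Y$. $H^1_D(Q)=L^2(\mathcal I;H_0^1(\Omega))\cap H^1(Q)$, $H(\mathrm{div}_x,Q)=L^2(\mathcal I;H(\mathrm{div},\Omega))$, $V_h=\mathbb T_1(\mathcal T)\cap H_D^1(Q)$. $\Gamma_h(\partial\mathcal T)=\gamma_A(V_h\times\{0\})+\{\gamma_A(0,\tau):\tau\in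 H(\mathrm{div}_x,Q),\ \tau|_f\cdot\nu_x\in\mathbb P_0(f)\ \forall f\in\mathcal F_c^x\}$. $X_h=(\mathbb T_0(\mathcal T)\times\mathbb T_0(\mathcal T;\mathbb R^d))\times\Gamma_h(\partial\mathcal T)\subset X$. Fortin operator. $\Pi:Y\to Y_h$ is a bounded linear operator with $b(\mathbf v_h,\mathbf t_h;(\mathbf w,\xi)-\Pi(\mathbf w,\xi))=0$ for all $(\mathbf v_h,\mathbf t_h)\in X_h$, $(\mathbf w,\xi)\in Y$ (such an operator exists), and $\lVert\Pi\rVert$ is its operator norm with respect to $\lVert\cdot\rVert_Y$. *)

(* Defs.v *)
From HB Require Import structures.
From mathcomp Require Import all_boot all_order all_algebra.
From mathcomp Require Import all_classical all_reals all_analysis.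
Set Implicit Arguments. Unset Strict Implicit. Unset Printing Implicit Defensive.
Import Order.TTheory GRing.Theory Num.Theory.
Import numFieldNormedType.Exports.
Local Open Scope classical_set_scope.
Local Open Scope ring_scope.

(* MathComp-Analysis has no Lebesgue measure on R^n: row vectors get the Borel
   sigma-algebra generated by the coordinates, and [lebesgue_rv n] is the n-fold
   product of the one-dimensional Lebesgue measure. *)
Section rv_measurable.
Context (R : realType) (n : nat).
Let coor (i : 'I_n) (x : 'rV[R]_n) : R := x ord0 i.
Let rv_set0 : g_sigma_preimage coor set0.
Proof. exact: sigma_algebra0. Qed.
Let rv_setC A : g_sigma_preimage coor A -> g_sigma_preimage coor (~` A).
Proof. exact: sigma_algebraC. Qed.
Let rv_bigcup (F : (set 'rV[R]_n)^nat) : (forall i, g_sigma_preimage coor (F i)) ->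
  g_sigma_preimage coor (\bigcup_i (F i)).
Proof. exact: sigma_algebra_bigcup. Qed.
HB.instance Definition _ := @isMeasurable.Build default_measure_display
  'rV[R]_n (g_sigma_preimage coor) rv_set0 rv_setC rv_bigcup.
End rv_measurable.


Lemma measurable_rv_coord (R : realType) n (i : 'I_n) :
  measurable_fun [set: 'rV[R]_n] (fun x : 'rV[R]_n => x ord0 i).
Proof.
move=> _ Y mY; rewrite setTI; apply: sub_sigma_algebra => /=.
rewrite -bigcup_seq/=; exists i => /=; first by rewrite mem_index_enum.
by exists Y => //; rewrite setTI.
Qed.

Lemma measurable_fun_rv (R : realType) d (T : measurableType d) n (f : T -> 'rV[R]_n) :
  (forall i, measurable_fun [set: T] (fun x => f x ord0 i)) ->
  measurable_fun [set: T] f.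
Proof.
move=> mf _ A mA; rewrite setTI.
suff : g_sigma_preimage (fun (i : 'I_n) (x : 'rV[R]_n) => x ord0 i) `<=`
    [set B | measurable (f @^-1` B)] by apply.
apply: smallest_sub => [|B].
  split=> [|B mB|F mF] /=.
  - by rewrite preimage_set0.
  - by rewrite setTD preimage_setC; apply: measurableC; exact: mB.
  - by rewrite preimage_bigcup; apply: bigcup_measurable => k _; exact: mF.
rewrite -bigcup_seq => -[i _ [C mC <-]] /=.
by rewrite setTI -comp_preimage -[X in measurable X]setTI; exact: mf.
Qed.

Lemma sigma_finite_product d1 d2 (T1 : measurableType d1)
    (T2 : measurableType d2) (R : realType)
    (m1 : {sigma_finite_measure set T1 -> \bar R})
    (m2 : {sigma_finite_measure set T2 -> \bar R}) :
  sigma_finite setT (m1 \x m2)%E.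
Proof.
have /sigma_finiteP[F [TF ndF Foo]] := sigma_finiteT m1.
have /sigma_finiteP[G [TG ndG Goo]] := sigma_finiteT m2.
exists (fun n => F n `*` G n).
  rewrite -setXTT TF TG predeqE => -[x y]; split.
    move=> [/= [n _ Fnx] [k _ Gky]]; exists (maxn n k) => //; split.
    - by move: x Fnx; exact/subsetPset/ndF/leq_maxl.
    - by move: y Gky; exact/subsetPset/ndG/leq_maxr.
  by move=> [n _ []/= ? ?]; split; exists n.
move=> k; have [? ?] := Foo k; have [? ?] := Goo k.
split; first exact: measurableX.
by rewrite product_measure1E// lte_mul_pinfty// ge0_fin_numE.
Qed.

Section lebesgue_rv.
Context (R : realType).
Local Open Scope ereal_scope.

Definition rvcons n (p : R * 'rV[R]_n) : 'rV[R]_n.+1 :=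
  \row_i oapp (p.2 ord0) p.1 (unlift ord0 i).

Lemma measurable_rvcons n : measurable_fun setT (@rvcons n).
Proof.
apply: measurable_fun_rv => i; case: (unliftP ord0 i) => [j ->|->].
  rewrite (_ : (fun _ => _) = (fun x : 'rV[R]_n => x ord0 j) \o snd).
    by apply: measurableT_comp => //; exact: measurable_rv_coord.
  by apply/funext => p; rewrite /rvcons mxE liftK.
by rewrite (_ : (fun _ => _) = fst)//; apply/funext => p; rewrite /rvcons mxE unlift_none.
Qed.

Section step.
Context (n : nat) (mu : {sigma_finite_measure set 'rV[R]_n -> \bar R}).

Definition lebesgue_rvS : set 'rV[R]_n.+1 -> \bar R :=
  pushforward ((@lebesgue_measure R) \x mu) (@rvcons n).

HB.instance Definition _ := Measure.copy lebesgue_rvS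
  (measure_function_pushforward__canonical__measure_function_Measure
     ((@lebesgue_measure R) \x mu) (@measurable_rvcons n)).

Lemma lebesgue_rvS_sigma_finite : sigma_finite setT lebesgue_rvS.
Proof.
pose g (y : 'rV[R]_n.+1) := (y ord0 ord0, (\row_j y ord0 (lift ord0 j)) : 'rV[R]_n).
have mg : measurable_fun setT g.
  apply/measurable_fun_pairP; split; first exact: measurable_rv_coord.
  apply: measurable_fun_rv => i.
  rewrite (_ : (fun _ => _) = (fun x : 'rV[R]_n.+1 => x ord0 (lift ord0 i))).
    exact: measurable_rv_coord.
  by apply/funext => p; rewrite /= mxE.
have gK : cancel (@rvcons n) g.
  move=> [t x]; rewrite /g /rvcons mxE unlift_none/=; congr pair.
  by apply/rowP => j; rewrite !mxE liftK.
have [F FT Foo] : sigma_finite setT ((@lebesgue_measure R) \x mu).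
  exact: sigma_finite_product.
exists (fun k => g @^-1` F k); first by rewrite -preimage_bigcup -FT preimage_setT.
move=> k; have [mF Fk] := Foo k; split.
  by rewrite -[X in measurable X]setTI; exact: mg.
rewrite /lebesgue_rvS /pushforward -comp_preimage.
by rewrite (_ : g \o _ = id)//; apply/funext => x /=; rewrite gK.
Qed.

HB.instance Definition _ :=
  Measure_isSigmaFinite.Build _ _ _ lebesgue_rvS lebesgue_rvS_sigma_finite.
End step.

Fixpoint lebesgue_rv n : {sigma_finite_measure set 'rV[R]_n -> \bar R} :=
  if n is n'.+1 then lebesgue_rvS (lebesgue_rv n') else \d_(0%R : 'rV[R]_0).
End lebesgue_rv.

Section L2.
Context d (T : measurableType d) (R : realType) (mu : {measure set T -> \bar R}).
Implicit Types (D : set T) (f g : T -> R).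

(* Elements of L^2(D) are represented by functions; every notion below depends
   only on their classes modulo equality almost everywhere on D. *)
Definition inL2 D f : Prop := f \_ D \in Lfun mu 2%:E.
Definition ip D f g : R := \int[mu]_(x in D) (f x * g x).
Definition norm2 D f : R := Num.sqrt (ip D f f).
End L2.

Section vector_L2.
Context d (T : measurableType d) (R : realType) (mu : {measure set T -> \bar R}).
Context (n : nat).
Implicit Types (D : set T) (f g : T -> 'rV[R]_n).

Definition dotv (x y : 'rV[R]_n) : R := \sum_i x ord0 i * y ord0 i.
(* The library norm of row vectors is the maximum norm. *)
Definition enorm (x : 'rV[R]_n) : R := Num.sqrt (dotv x x).

Definition inL2v D f : Prop := forall i, inL2 mu D (fun x => f x ord0 i).
Definition ipv D f g : R := \int[mu]_(x in D) dotv (f x) (g x).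
Definition norm2v D f : R := Num.sqrt (ipv D f f).
End vector_L2.

Section smooth.
Context (R : realType) (V : normedModType R).

Fixpoint Ck (k : nat) (f : V -> R) : Prop :=
  continuous f /\
  if k is k'.+1 then
    (forall x v, derivable f x v) /\ forall v, Ck k' (fun x => 'D_v f x)
  else True.

Definition smooth (f : V -> R) : Prop := forall k, Ck k f.

Definition csupp (f : V -> R) : set V := closure [set x | f x != 0].

Definition test_fun (D : set V) (f : V -> R) : Prop :=
  [/\ smooth f, compact (csupp f) & csupp f `<=` D].
End smooth.

Section geometry.
Context (R : realType) (d : nat).
Implicit Types (S Omega : set 'rV[R]_d) (V : 'M[R]_(d.+1, d)).

Definition diam S : R :=
  sup [set r | exists x y : 'rV[R]_d, [/\ S x, S y & r = enorm (x - y)]].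

Definition inradius S : R :=
  sup [set r | 0 <= r /\ exists c : 'rV[R]_d, forall y, enorm (y - c) <= r -> S y].

(* The rows of V are the d+1 vertices. *)
Definition bary (l : 'rV[R]_d.+1) : Prop :=
  (forall i, 0 <= l ord0 i) /\ \sum_i l ord0 i = 1.
Definition simplex V : set 'rV[R]_d :=
  [set x | exists2 l, bary l & x = l *m V].
Definition simplex_facet V (j : 'I_d.+1) : set 'rV[R]_d :=
  [set x | exists2 l, bary l /\ l ord0 j = 0 & x = l *m V].
Definition affine_independent V : bool :=
  row_free (row_mx (const_mx 1 : 'cV[R]_d.+1) V).
(* The convex hull of the vertices of V that are also vertices of W. *)
Definition common_face V (W : 'M[R]_(d.+1, d)) : set 'rV[R]_d :=
  [set x | exists2 l, bary l /\
     (forall k, l ord0 k != 0 -> exists k', row k V = row k' W) & x = l *m V].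
Definition unit_normal V (j : 'I_d.+1) (nu : 'rV[R]_d) : Prop :=
  enorm nu = 1 /\
  forall k l, k != j -> l != j -> dotv nu (row k V - row l V) = 0.

(* Near every boundary point, Omega is the part above the graph of a Lipschitz
   function g in direction e; g is a function on the hyperplane orthogonal to e,
   extended constantly along e. *)
Definition lipschitz_boundary Omega : Prop :=
  forall x : 'rV[R]_d, closure Omega x -> ~ Omega x ->
  exists (e : 'rV[R]_d) (r L : R) (g : 'rV[R]_d -> R),
  [/\ 0 < r, enorm e = 1,
      forall (y : 'rV[R]_d) (s : R), g (y + s *: e) = g y,
      forall y z, `|g y - g z| <= L * enorm (y - z) &
      forall y : 'rV[R]_d, enorm (y - x) < r -> (Omega y <-> g y < dotv y e)].

Definition polyhedral Omega : Prop :=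
  exists s : seq 'M[R]_(d.+1, d),
    all affine_independent s /\
    closure Omega = \bigcup_(V in [set` s]) simplex V.

Definition polyhedral_lipschitz_domain Omega : Prop :=
  [/\ open Omega, connected Omega, Omega !=set0 & bounded_set Omega] /\
  lipschitz_boundary Omega /\ polyhedral Omega.
End geometry.

Record cell (R : realType) (d : nat) := Cell {
  t_lo : R; t_hi : R; vtx : 'M[R]_(d.+1, d) }.

Section cells.
Context (R : realType) (d : nat).
Implicit Types (K : cell R d) (f g : set (R * 'rV[R]_d)).

Definition cell_t K : set R := `[t_lo K, t_hi K]%classic.
Definition cell_x K : set 'rV[R]_d := simplex (vtx K).
Definition cell_set K : set (R * 'rV[R]_d) := cell_t K `*` cell_x K.
Definition nondegenerate K : Prop :=
  t_lo K < t_hi K /\ affine_independent (vtx K).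

Definition lateral_facet K (j : 'I_d.+1) : set (R * 'rV[R]_d) :=
  cell_t K `*` simplex_facet (vtx K) j.
Definition is_facet K f : Prop :=
  [\/ f = [set t_lo K] `*` cell_x K, f = [set t_hi K] `*` cell_x K |
      exists j, f = lateral_facet K j].

(* f and g overlap if f `&` g has nonempty interior relative to f, that is (for
   facets) if f `&` g has positive d-dimensional measure. *)
Definition overlap f g : Prop :=
  exists (p : R * 'rV[R]_d) (eps : R), [/\ 0 < eps, f p & f `&` ball p eps `<=` g].
End cells.

Section mesh.
Context (R : realType) (d : nat) (Omega : set 'rV[R]_d) (Tend : R).
Context (N : nat) (K : 'I_N -> cell R d).

Definition Qdom : set (R * 'rV[R]_d) := `]0, Tend[%classic `*` Omega.

Definition facets : set (set (R * 'rV[R]_d)) :=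
  [set f | exists i, is_facet (K i) f].
Definition coarse_facets : set (set (R * 'rV[R]_d)) :=
  [set f | facets f /\ forall g, facets g -> f `<=` g -> f = g].

Record space_time_partition (kappa : R) : Prop := {
  mesh_nondegenerate : forall i, nondegenerate (K i);
  mesh_cover : closure Qdom = \bigcup_i cell_set (K i);
  mesh_nonoverlapping : forall i j, i != j ->
    interior (cell_set (K i)) `&` interior (cell_set (K j)) = set0;
  mesh_shape_regular : forall i,
    diam (cell_x (K i)) <= kappa * inradius (cell_x (K i));
  mesh_facets_match : forall f g, facets f -> facets g -> overlap f g ->
    f `<=` g \/ g `<=` f;
  (* the facets on {0} x closure Omega form a regular triangulation *)
  mesh_initial_cover :
    closure Omega = \bigcup_(i in [set i | t_lo (K i) = 0]) cell_x (K i);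
  mesh_initial_regular : forall i j, t_lo (K i) = 0 -> t_lo (K j) = 0 ->
    cell_x (K i) `&` cell_x (K j) = common_face (vtx (K i)) (vtx (K j)) }.
End mesh.

Section operators.
Context (R : realType) (d : nat).
Notation pt := (R * 'rV[R]_d)%type.

Definition mu_tx : {measure set (measurableTypeR R * 'rV[R]_d)%type -> \bar R} :=
  ((@lebesgue_measure R) \x lebesgue_rv R d)%E.
Definition mu_x : {measure set 'rV[R]_d -> \bar R} := lebesgue_rv R d.

(* A pair (v, tau) of a scalar and an R^d-valued function. *)
Definition fld : Type := ((pt -> R) * (pt -> 'rV[R]_d))%type.
HB.instance Definition _ := GRing.Lmodule.on fld.

Definition e_x (i : 'I_d) : 'rV[R]_d := delta_mx ord0 i.
Definition d_t (f : pt -> R) (z : pt) : R := 'D_((1, 0) : pt) f z.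
Definition grad_x (f : pt -> R) (z : pt) : 'rV[R]_d :=
  \row_i 'D_((0, e_x i) : pt) f z.
Definition div_x (chi : pt -> 'rV[R]_d) (z : pt) : R :=
  \sum_i 'D_((0, e_x i) : pt) (fun y => chi y ord0 i) z.
Definition grad (f : 'rV[R]_d -> R) (x : 'rV[R]_d) : 'rV[R]_d :=
  \row_i 'D_(e_x i) f x.

Definition ipf (D : set pt) (u w : fld) : R :=
  ip mu_tx D u.1 w.1 + ipv mu_tx D u.2 w.2.
Definition inL2f (D : set pt) (u : fld) : Prop :=
  inL2 mu_tx D u.1 /\ inL2v mu_tx D u.2.

(* g is the weak gradient of v in x, and h the weak space-time divergence of u,
   on the open set D, both in L^2(D). *)
Definition is_wgrad (D : set pt) (v : pt -> R) (g : pt -> 'rV[R]_d) : Prop :=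
  inL2v mu_tx D g /\
  forall i phi, test_fun D phi ->
    ip mu_tx D v (fun z => grad_x phi z ord0 i) =
    - ip mu_tx D (fun z => g z ord0 i) phi.
Definition is_wdiv (D : set pt) (u : fld) (h : pt -> R) : Prop :=
  inL2 mu_tx D h /\
  forall phi, test_fun D phi ->
    ip mu_tx D u.1 (d_t phi) + ipv mu_tx D u.2 (grad_x phi) = - ip mu_tx D h phi.

Definition wgrad (D : set pt) (v : pt -> R) : pt -> 'rV[R]_d :=
  xget (fun=> 0) [set g | is_wgrad D v g].
Definition wdiv (D : set pt) (u : fld) : pt -> R :=
  xget (fun=> 0) [set h | is_wdiv D u h].

Definition H_A (D : set pt) : set fld :=
  [set u | [/\ inL2f D u, exists g, is_wgrad D u.1 g & exists h, is_wdiv D u h]].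

Definition opA (D : set pt) (u : fld) : fld :=
  (wdiv D u, wgrad D u.1 + u.2).
Definition opAadj (D : set pt) (u : fld) : fld :=
  (- wdiv D u, - wgrad D u.1 + u.2).
End operators.

Section spaces.
Context (R : realType) (d : nat) (Omega : set 'rV[R]_d) (Tend : R).
Context (N : nat) (K : 'I_N -> cell R d).
Notation pt := (R * 'rV[R]_d)%type.
Notation fld := (fld R d).
Notation Q := (Qdom Omega Tend).
Notation mu_tx := (mu_tx R d).
Notation mu_x := (mu_x R d).

Definition space_U : set fld := H_A Q.

(* C^infty of the closure of Q: restrictions of smooth functions on R^(1+d). *)
Definition space_U0 : set fld :=
  [set u | space_U u /\
    forall chi : pt -> 'rV[R]_d, (forall i, smooth (fun z => chi z ord0 i)) ->
      ipv mu_tx Q (wgrad Q u.1) chi = - ip mu_tx Q u.1 (div_x chi)].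

(* g = v(0, .), where v is identified with its representative vt in
   C([0, Tend]; L^2(Omega)). *)
Definition initial_value (v : pt -> R) (g : 'rV[R]_d -> R) : Prop :=
  exists vt : R -> 'rV[R]_d -> R,
  [/\ forall t : R, 0 <= t <= Tend -> inL2 mu_x Omega (vt t),
      forall t : R, 0 <= t <= Tend -> forall eps : R, 0 < eps ->
        exists2 delta : R, 0 < delta &
        forall s : R, 0 <= s <= Tend -> `|s - t| < delta ->
          norm2 mu_x Omega (fun x => vt s x - vt t x) < eps,
      {ae (@lebesgue_measure R), forall t : R, 0 < t < Tend ->
        {ae mu_x, forall x, Omega x -> v (t, x) = vt t x}} &
      vt 0 = g].
Definition is_gamma0 (gamma0 : fld -> 'rV[R]_d -> R) : Prop :=
  forall u, space_U0 u -> initial_value u.1 (gamma0 u).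

Definition Kint (i : 'I_N) : set pt := interior (cell_set (K i)).

Definition H_Aadj_T : set fld :=
  [set w | inL2f Q w /\ forall i, H_A (Kint i) w].
Definition opAadj_h (w : fld) : fld :=
  (fun z => \sum_(i | z \in Kint i) (opAadj (Kint i) w).1 z,
   fun z => \sum_(i | z \in Kint i) (opAadj (Kint i) w).2 z).

Definition ysp : Type := (fld * ('rV[R]_d -> R))%type.
HB.instance Definition _ := GRing.Lmodule.on ysp.

Definition space_Y : set ysp :=
  [set y | H_Aadj_T y.1 /\ inL2 mu_x Omega y.2].
Definition ipY (y z : ysp) : R :=
  ipf Q y.1 z.1 + ipf Q (opAadj_h y.1) (opAadj_h z.1) + ip mu_x Omega y.2 z.2.
Definition normY (y : ysp) : R := Num.sqrt (ipY y y).

(* Functionals are compared on Y only. *)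
Definition bounded_functional (F : ysp -> R) : Prop :=
  (forall a y z, space_Y y -> space_Y z -> F (a *: y + z) = a * F y + F z) /\
  exists C, forall y, space_Y y -> `|F y| <= C * normY y.

Definition dual_norm (S : set ysp) (G : ysp -> R) : R :=
  sup [set `|G y| | y in [set y | S y /\ normY y <= 1]].
Definition operator_norm (P : ysp -> ysp) : R :=
  sup [set normY (P y) | y in [set y | space_Y y /\ normY y <= 1]].

Section traces.
Context (gamma0 : fld -> 'rV[R]_d -> R).

Definition gammaA (u : fld) (y : ysp) : R :=
  ipf Q (opA Q u) y.1 - ipf Q u (opAadj_h y.1) + ip mu_x Omega (gamma0 u) y.2.

Definition Gamma : set (ysp -> R) :=
  [set t | exists2 u, space_U0 u & forall y, space_Y y -> t y = gammaA u y].

Definition xsp : Type := (fld * (ysp -> R))%type.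
HB.instance Definition _ := GRing.Lmodule.on xsp.

Definition space_X : set xsp := [set x | inL2f Q x.1 /\ Gamma x.2].
Definition bform (x : xsp) (y : ysp) : R := ipf Q x.1 (opAadj_h y.1) + x.2 y.

Definition trial_to_test (T : xsp -> ysp) : Prop :=
  forall x, space_X x ->
    space_Y (T x) /\ forall y, space_Y y -> ipY (T x) y = bform x y.

Definition opE (T : xsp -> ysp) (x : xsp) : fld := x.1 - opAadj_h (T x).1.
Definition normX (T : xsp -> ysp) (x : xsp) : R :=
  Num.sqrt (ipf Q x.1 x.1 + ipf Q (opE T x) (opE T x)
    + ipf Q (opA Q (opE T x)) (opA Q (opE T x))
    + ip mu_x Omega (gamma0 (opE T x)) (gamma0 (opE T x))).

Definition stability_constant (cL : R) : Prop :=
  0 < cL /\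
  forall u, space_U0 u ->
    cL * ipf Q u u <=
    ipf Q (opA Q u) (opA Q u) + ip mu_x Omega (gamma0 u) (gamma0 u).

Definition is_poly (k : nat) (p : 'rV[R]_d -> R) : Prop :=
  exists c : {ffun 'I_d -> 'I_k.+1} -> R, forall x,
    p x = \sum_(a : {ffun 'I_d -> 'I_k.+1} | (\sum_i a i <= k)%N)
            c a * \prod_i x ord0 i ^+ a i.
(* P_k in t tensor P_k in x *)
Definition is_tensor_poly (k : nat) (p : pt -> R) : Prop :=
  exists2 q : 'I_k.+1 -> 'rV[R]_d -> R, (forall j, is_poly k (q j)) &
    forall z, p z = \sum_(j < k.+1) z.1 ^+ j * q j z.2.

Definition broken_T (k : nat) : set (pt -> R) :=
  [set v | inL2 mu_tx Q v /\ forall i, exists2 p, is_tensor_poly k p &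
    {ae mu_tx, forall z, cell_set (K i) z -> v z = p z}].
Definition broken_Tv (k : nat) : set (pt -> 'rV[R]_d) :=
  [set tau | forall i, broken_T k (fun z => tau z ord0 i)].
Definition initial_P (k : nat) : set ('rV[R]_d -> R) :=
  [set xi | inL2 mu_x Omega xi /\
    forall i, t_lo (K i) = 0 -> exists2 p, is_poly k p &
      {ae mu_x, forall x, cell_x (K i) x -> xi x = p x}].

Definition mdeg : nat := if d == 1%N then 3 else 2.
Definition space_Yh : set ysp :=
  [set y | [/\ broken_T mdeg y.1.1, broken_Tv 1 y.1.2 & initial_P 1 y.2]].

(* v belongs to H^1_0(Omega), the closure of C_c^infty(Omega) in H^1(Omega), and
   g is its gradient. *)
Definition H10_with_grad (v : 'rV[R]_d -> R) (g : 'rV[R]_d -> 'rV[R]_d) : Prop :=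
  [/\ inL2 mu_x Omega v, inL2v mu_x Omega g &
   exists phi : nat -> 'rV[R]_d -> R, [/\ forall n, test_fun Omega (phi n),
     (fun n => norm2 mu_x Omega (fun x => phi n x - v x)) @ \oo --> (0 : R) &
     (fun n => norm2v mu_x Omega (fun x => grad (phi n) x - g x)) @ \oo --> (0 : R)]].
Definition L2_H10 : set (pt -> R) :=
  [set v | inL2 mu_tx Q v /\ exists2 g, inL2v mu_tx Q g &
    {ae (@lebesgue_measure R), forall t : R, 0 < t < Tend ->
      H10_with_grad (fun x => v (t, x)) (fun x => g (t, x))}].
Definition H1_Q : set (pt -> R) :=
  [set v | [/\ inL2 mu_tx Q v, exists g, is_wgrad Q v g &
               exists h, is_wdiv Q (v, fun=> 0) h]].
Definition space_Vh : set (pt -> R) := broken_T 1 `&` (L2_H10 `&` H1_Q).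

(* tau belongs to L^2(I; H(div, Omega)), with divergence h in x. *)
Definition is_divx (tau : pt -> 'rV[R]_d) (h : pt -> R) : Prop :=
  [/\ inL2v mu_tx Q tau, inL2 mu_tx Q h &
   {ae (@lebesgue_measure R), forall t : R, 0 < t < Tend ->
     [/\ inL2v mu_x Omega (fun x => tau (t, x)),
         inL2 mu_x Omega (fun x => h (t, x)) &
         forall phi, test_fun Omega phi ->
           ipv mu_x Omega (fun x => tau (t, x)) (grad phi) =
           - ip mu_x Omega (fun x => h (t, x)) phi]}].

(* The integral of (tau . nu_x) w over the lateral boundary of the cell, where nu_x
   is the outer unit normal, in the weak sense of Green's formula: h is the
   divergence of tau in x. *)
Definition lateral_flux (i : 'I_N) (tau : pt -> 'rV[R]_d) (h w : pt -> R) : R :=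
  ip mu_tx (cell_set (K i)) h w + ipv mu_tx (cell_set (K i)) tau (grad_x w).

(* The normal trace of tau on the j-th lateral facet f of the i-th cell is constant.
   It is tested with smooth w vanishing near the other lateral facets; for such w,
   the integral of w over f is, up to the sign of nu, the flux of the constant
   field nu. *)
Definition constant_normal_trace (tau : pt -> 'rV[R]_d) (h : pt -> R)
    (i : 'I_N) (j : 'I_d.+1) : Prop :=
  forall nu, unit_normal (vtx (K i)) j nu ->
  exists c : R, forall w, smooth w ->
    (forall j', j' != j -> csupp w `&` lateral_facet (K i) j' = set0) ->
    lateral_flux i tau h w = c * lateral_flux i (fun=> nu) (fun=> 0) w.

Definition space_Wh : set (pt -> 'rV[R]_d) :=
  [set tau | exists2 h, is_divx tau h &
    forall i j, coarse_facets K (lateral_facet (K i) j) ->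
      constant_normal_trace tau h i j].

Definition Gamma_h : set (ysp -> R) :=
  [set t | exists v tau, [/\ space_Vh v, space_Wh tau &
    forall y, space_Y y ->
      t y = gammaA (v, fun=> 0) y + gammaA (fun=> 0, tau) y]].

Definition space_Xh : set xsp :=
  [set x | [/\ broken_T 0 x.1.1, broken_Tv 0 x.1.2 & Gamma_h x.2]].

(* Linearity is required up to equality in Y, that is almost everywhere. *)
Definition fortin_operator (P : ysp -> ysp) : Prop :=
  [/\ forall y, space_Y y -> space_Yh (P y),
      forall a y z, space_Y y -> space_Y z ->
        normY (P (a *: y + z) - (a *: P y + P z)) = 0,
      exists C, forall y, space_Y y -> normY (P y) <= C * normY y &
      forall x y, space_Xh x -> space_Y y -> bform x (y - P y) = 0].

Definition dpg_solution (F : ysp -> R) (x : xsp) : Prop :=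
  space_Xh x /\
  forall x', space_Xh x' ->
    dual_norm space_Yh (fun y => bform x y - F y) <=
    dual_norm space_Yh (fun y => bform x' y - F y).
End traces.
End spaces.

Section constants.
Context (R : realType) (cL : R).
Definition beta : R :=
  (1 + 2 * cL - Num.sqrt ((1 + 2 * cL) ^+ 2 - 4 * cL ^+ 2)) / (2 * cL).
Definition norm_b : R :=
  (1 + 2 * cL + Num.sqrt ((1 + 2 * cL) ^+ 2 - 4 * cL ^+ 2)) / (2 * cL).
End constants.

Definition is_minimum (R : realType) (A : set R) (m : R) : Prop :=
  A m /\ forall r, A r -> m <= r.

(* Main.v *)
From HB Require Import structures.
Require Import Defs.
From mathcomp Require Import all_boot all_order all_algebra.
From mathcomp Require Import all_classical all_reals all_analysis.
From mathcomp Require Import measurable_realfun ring lra.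
Set Implicit Arguments. Unset Strict Implicit. Unset Printing Implicit Defensive.
Import Order.TTheory GRing.Theory Num.Theory.
Import numFieldNormedType.Exports.
Local Open Scope classical_set_scope.
Local Open Scope ring_scope.

(** Measure a trial vector x by its energy norm, the Y-norm of [T x]; it equals the norm of b(x; .)
    in the dual of Y. The estimate combines quasi-optimality in the energy norm with the equivalence
    of the energy norm and the X-norm.

    Quasi-optimality ([dpg_quasi_optimal]). Let q x be the representer of b(x; .) in Y_h. By
    [sup_dual_norm] the discrete residual of x is the length of q (us - x), so the discrete solution
    is a best approximation in the seminorm given by q, and the error us - us_h is orthogonal to X_h
    for it ([sip_minimizer]). This seminorm is at most the energy norm on X; on X_h the Fortin
    property bounds the energy norm by the norm of Pi times the seminorm. Hence the projection onto
    X_h along the error has energy norm at most that of Pi. Kato's identity ([kato_projection])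
    passes the same bound to the complementary projection, which maps us - v to the error; a
    triangle inequality would add 1 to the constant.

    Norm equivalence ([energy_norm_equiv]). For x = (v, t) put e = E(x). The definition of E says
    that the cell-wise adjoint maps the first component of [T x] to v - e, and [trial_to_test_graph]
    says that e lies in U_0 and that [T x] is (A e, gamma0 e). So the squared energy norm is |A e|^2
    + |gamma0 e|^2 + |v - e|^2, while the squared X-norm has |v|^2 + |e|^2 in place of |v - e|^2.
    Cauchy-Schwarz and the stability constant give the equivalence constants 1 - 1/s and 1 + 1/s
    with s = sqrt (1 + cL) ([graph_norm_equiv]), and their ratio is at most the square of
    [norm_b cL / beta cL] ([constant_ratio]).

    The graph of T. Write t as the trace of some u in U_0, and let D = e - u and W = T_1 x - A u.
    Testing the definition of T with smooth fields p gives that D against the adjoint of A applied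
    to p equals W against p. Compactly supported p yield A D = W, p free on the lateral boundary
    yield the boundary condition of U_0, and p concentrated near t = 0 yield gamma0 D = 0. Testing
    with (0, xi) identifies T_2 x with gamma0 u. Since [gamma0] is only a choice of initial values,
    it is handled through the limits in [initial_value_limit].

    Finite dimension. Functions represent classes, so all forms are semi-inner products and all
    spaces are treated modulo null vectors. Representers in Y_h and the minimum over X_h come from
    [sip_projection], which asks for a bound on orthonormal families. Y_h has one because finitely
    many polynomial coefficients determine its elements up to null vectors; X_h inherits it because
    x to Pi (T x) is injective modulo null vectors ([trial_space_finite]). *)

(** * Semi-inner products: Cauchy-Schwarz, best approximation, oblique projections *)

Section semi_inner_product.
Context (R : realType) (V : lmodType R).
Implicit Types (S W : set V) (s : V -> V -> R).

Definition linear_subspace S := S 0 /\ forall a u v, S u -> S v -> S (a *: u + v).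

(** The rules are demanded on [S] only, because integrals of products are linear just on
    square-integrable functions. Definiteness is left out: a function stands for its class, so a
    vector of length 0 may be nonzero. *)
Definition semi_ip S s := [/\ linear_subspace S,
  forall a u v w, S u -> S v -> S w -> s (a *: u + v) w = a * s u w + s v w,
  forall u v, S u -> S v -> s u v = s v u &
  forall u, S u -> 0 <= s u u].

Lemma subspaceZ S a u : linear_subspace S -> S u -> S (a *: u).
Proof. by move=> [S0 Sl] Su; rewrite -[a *: u]addr0; exact: Sl. Qed.

Lemma subspaceD S u v : linear_subspace S -> S u -> S v -> S (u + v).
Proof. by move=> [S0 Sl] Su Sv; rewrite -[u]scale1r; exact: Sl. Qed.

Lemma subspaceN S u : linear_subspace S -> S u -> S (- u).
Proof. by move=> sS Su; rewrite -scaleN1r; exact: subspaceZ. Qed.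

Lemma subspaceB S u v : linear_subspace S -> S u -> S v -> S (u - v).
Proof. by move=> sS Su Sv; apply: subspaceD => //; exact: subspaceN. Qed.

Lemma subspace_sum S (I : Type) (r : seq I) (a : I -> R) (u : I -> V) :
  linear_subspace S -> (forall i, S (u i)) -> S (\sum_(i <- r) a i *: u i).
Proof.
move=> [S0 Sl] Su; elim/big_rec: _ => // i x _ Sx; exact: Sl.
Qed.

Section lemmas.
Context S s (sip : semi_ip S s).
Let Ssub : linear_subspace S := let: And4 h _ _ _ := sip in h.

Lemma sip_sym u v : S u -> S v -> s u v = s v u.
Proof. by case: sip => _ _ + _; apply. Qed.

Lemma sip_ge0 u : S u -> 0 <= s u u.
Proof. by case: sip => _ _ _; apply. Qed.

Lemma sip_lin a u v w : S u -> S v -> S w -> s (a *: u + v) w = a * s u w + s v w.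
Proof. by case: sip => _ + _ _; apply. Qed.

Lemma sip_Dl u v w : S u -> S v -> S w -> s (u + v) w = s u w + s v w.
Proof. by move=> *; rewrite -[u in LHS]scale1r sip_lin// mul1r. Qed.

Lemma sip_0l w : S w -> s 0 w = 0.
Proof.
move=> Sw; have S0 := Ssub.1.
by have := sip_Dl S0 S0 Sw; rewrite addr0 => /esym/eqP; rewrite -subr_eq0 addrK => /eqP.
Qed.

Lemma sip_Zl a u w : S u -> S w -> s (a *: u) w = a * s u w.
Proof.
by move=> Su Sw; rewrite -[a *: u]addr0 sip_lin ?sip_0l ?addr0//; exact: Ssub.1.
Qed.

Lemma sip_Bl u v w : S u -> S v -> S w -> s (u - v) w = s u w - s v w.
Proof.
move=> Su Sv Sw; rewrite sip_Dl//; last exact: subspaceN.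
by rewrite -scaleN1r sip_Zl// mulN1r.
Qed.

Lemma sip_Dr u v w : S u -> S v -> S w -> s w (u + v) = s w u + s w v.
Proof.
move=> *; rewrite sip_sym// ?sip_Dl//; last exact: subspaceD.
by congr (_ + _); exact: sip_sym.
Qed.

Lemma sip_Zr a u w : S u -> S w -> s w (a *: u) = a * s w u.
Proof.
move=> Su Sw; rewrite sip_sym//; last exact: subspaceZ.
by rewrite sip_Zl// sip_sym.
Qed.

Lemma sip_Br u v w : S u -> S v -> S w -> s w (u - v) = s w u - s w v.
Proof.
move=> *; rewrite sip_sym// ?sip_Bl//; last exact: subspaceB.
by congr (_ - _); exact: sip_sym.
Qed.

Lemma sip_suml (I : Type) (r : seq I) (a : I -> R) (u : I -> V) w :
  (forall i, S (u i)) -> S w ->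
  s (\sum_(i <- r) a i *: u i) w = \sum_(i <- r) a i * s (u i) w.
Proof.
move=> Su Sw; elim: r => [|i r IH]; first by rewrite !big_nil sip_0l.
by rewrite !big_cons sip_lin// ?IH//; exact: subspace_sum.
Qed.

Lemma sip_sqrD a b u v : S u -> S v ->
  s (a *: u + b *: v) (a *: u + b *: v) =
  a ^+ 2 * s u u + 2 * a * b * s u v + b ^+ 2 * s v v.
Proof.
move=> Su Sv; have [? ?] : S (a *: u) /\ S (b *: v) by split; exact: subspaceZ.
rewrite sip_Dl// ?sip_Dr//; last exact: subspaceD.
rewrite !sip_Zl// !sip_Zr// (sip_sym Sv Su); ring.
Qed.

Lemma sip_CS u v : S u -> S v -> s u v ^+ 2 <= s u u * s v v.
Proof.
move=> Su Sv; have [uu0|uu0] := eqVneq (s u u) 0.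
  have H t : 0 <= 2 * t * s u v + s v v.
    have := sip_sqrD t 1 Su Sv; rewrite uu0 mulr0 add0r mulr1 expr1n mul1r => <-.
    by apply: sip_ge0; apply: subspaceD => //; exact: subspaceZ.
  rewrite uu0 mul0r; have [->|uv0] := eqVneq (s u v) 0; first by rewrite expr0n.
  (* This value of [t] brings the affine function in [H] down to [-1]. *)
  have := H (- (s v v + 1) / (2 * s u v)).
  rewrite (_ : 2 * _ * _ = - (s v v + 1)); first by rewrite opprD addrAC addNr add0r oppr_ge0 ler10.
  by field.
have u0 : 0 < s u u by rewrite lt_neqAle eq_sym uu0 sip_ge0.
have : 0 <= s (- s u v *: u + s u u *: v) (- s u v *: u + s u u *: v).
  by apply: sip_ge0; apply: subspaceD => //; exact: subspaceZ.
rewrite sip_sqrD// (_ : _ + _ = s u u * (s u u * s v v - s u v ^+ 2)); last by ring.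
by rewrite pmulr_rge0// subr_ge0.
Qed.

Lemma sip_null u v : S u -> S v -> s u u = 0 -> s u v = 0.
Proof.
move=> Su Sv u0; apply/eqP; rewrite -sqrf_eq0 eq_le sqr_ge0 andbT.
by apply: (le_trans (sip_CS Su Sv)); rewrite u0 mul0r.
Qed.

Lemma sip_CS_sqrt u v : S u -> S v ->
  `|s u v| <= Num.sqrt (s u u) * Num.sqrt (s v v).
Proof.
move=> Su Sv; rewrite -sqrtrM ?sip_ge0// -sqrtr_sqr ler_sqrt ?sip_CS//.
by rewrite mulr_ge0// sip_ge0.
Qed.

Lemma sip_minimizer W x p : linear_subspace W -> W `<=` S -> S x -> W p ->
  (forall w, W w -> s (x - p) (x - p) <= s (x - w) (x - w)) ->
  forall w, W w -> s (x - p) w = 0.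
Proof.
move=> sW WS Sx Wp H w Ww; have Sw := WS _ Ww; have Sp := WS _ Wp.
have Sxp : S (x - p) by exact: subspaceB.
have K t : 0 <= - (2 * t * s (x - p) w) + t ^+ 2 * s w w.
  have := H _ (sW.2 t _ _ Ww Wp).
  rewrite (_ : x - (t *: w + p) = 1 *: (x - p) + (- t) *: w); last first.
    by rewrite scale1r scaleNr opprD addrA addrAC.
  by rewrite [leRHS]sip_sqrD//; lra.
set c := s (x - p) w in K *; set n := s w w in K.
have n0 : 0 <= n by exact: sip_ge0.
(* The optimal [t] would be [c / n]; the denominator [n + 1] also covers null [w], and the result is
   still a negative multiple of [c ^+ 2]. *)
have := K (c / (n + 1)).
have n1 : n + 1 != 0 by rewrite gt_eqF// ltr_wpDl.
rewrite (_ : _ + _ = - (c ^+ 2 * ((n + 2) / (n + 1) ^+ 2))); last by field.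
rewrite oppr_ge0 pmulr_lle0; last by rewrite divr_gt0 ?exprn_gt0 ?ltr_wpDl.
by move=> c0; apply/eqP; rewrite -sqrf_eq0 eq_le c0 sqr_ge0.
Qed.

Lemma sip_orth_minimizer W x p : linear_subspace W -> W `<=` S -> S x -> W p ->
  (forall w, W w -> s (x - p) w = 0) ->
  forall w, W w -> s (x - p) (x - p) <= s (x - w) (x - w).
Proof.
move=> sW WS Sx Wp H w Ww; have Sw := WS _ Ww; have Sp := WS _ Wp.
have Wpw : W (p - w) by exact: subspaceB.
have Sxp : S (x - p) by exact: subspaceB.
have -> : x - w = 1 *: (x - p) + 1 *: (p - w) by rewrite !scale1r addrA subrK.
have Spw := WS _ Wpw.
rewrite [leRHS]sip_sqrD// (H _ Wpw) mulr0 addr0 !expr1n !mul1r.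
by rewrite lerDl sip_ge0.
Qed.

Definition orthonormal_family k (e : 'I_k -> V) :=
  forall i j, s (e i) (e j) = (i == j)%:R.

(** The bound [M] on orthonormal families stands for finite dimension modulo null vectors. Expansion
    along a family of maximal length leaves only null remainders inside [W], and null vectors are
    orthogonal to everything. *)
Lemma sip_projection W M x : linear_subspace W -> W `<=` S ->
  (forall k (e : 'I_k -> V), (forall i, W (e i)) -> orthonormal_family e -> (k <= M)%N) ->
  S x -> exists2 p, W p & forall w, W w -> s (x - p) w = 0.
Proof.
move=> sW WS Mmax Sx.
pose P k := `[< exists e : 'I_k -> V, (forall i, W (e i)) /\ orthonormal_family e >].
have P0 : exists k, P k.
  by exists 0%N; apply/asboolP; exists (fun=> 0); split=> [[]|[]].
have PM k : P k -> (k <= M)%N by move=> /asboolP[e [We oe]]; exact: Mmax We oe.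
case: (ex_maxnP P0 PM) => k /asboolP[e [We oe]] kmax.
have Se i : S (e i) by exact: WS.
pose pr y := \sum_i s y (e i) *: e i.
have Wpr y : W (pr y) by exact: subspace_sum.
have Spr y : S (pr y) by exact: WS.
have pr_e y i : S y -> s (y - pr y) (e i) = 0.
  move=> Sy; rewrite sip_Bl// /pr sip_suml//; apply/eqP; rewrite subr_eq0; apply/eqP.
  rewrite (bigD1 i)//= oe eqxx mulr1 big1 ?addr0// => j ji.
  by rewrite oe (negbTE ji) mulr0.
(* A remainder of positive length could be normalized and added to the family, against its
   maximality. *)
have resid0 w : W w -> s (w - pr w) (w - pr w) = 0.
  move=> Ww; set r := w - pr w; apply/eqP; apply: contraT => r0.
  have Sw := WS _ Ww; have Wr : W r by exact: subspaceB.
  have Sr := WS _ Wr.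
  have rgt0 : 0 < s r r by rewrite lt_neqAle eq_sym r0 sip_ge0.
  suff /kmax : P k.+1 by rewrite ltnn.
  pose q := (Num.sqrt (s r r))^-1.
  apply/asboolP; exists (fun i : 'I_k.+1 => oapp e (q *: r) (unlift ord0 i)).
  have Wq : W (q *: r) by exact: subspaceZ.
  split=> [i|i j]; first by case: unliftP => [?|] _ /=.
  case: (unliftP ord0 i) => [i' ->|->]; case: (unliftP ord0 j) => [j' ->|->] /=.
  - by rewrite oe (inj_eq lift_inj).
  - rewrite sip_sym//; last exact: WS.
    by rewrite sip_Zl// pr_e// mulr0.
  - by rewrite sip_Zl// pr_e// mulr0.
  - have Sq := WS _ Wq; rewrite sip_Zl// sip_Zr// mulrA -expr2 /q exprVn sqr_sqrtr ?sip_ge0//.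
    by rewrite mulVf.
exists (pr x) => // w Ww; have Sw := WS _ Ww.
have Sxp : S (x - pr x) by exact: subspaceB.
have pw0 : s (pr w) (x - pr x) = 0.
  have -> : s (pr w) (x - pr x) = \sum_i s w (e i) * s (e i) (x - pr x).
    exact: sip_suml.
  by rewrite big1// => i _; rewrite (sip_sym (Se i))// pr_e// mulr0.
have Swr : S (w - pr w) by exact: subspaceB.
rewrite -[w](subrK (pr w)) sip_Dr// [X in _ + X]sip_sym// pw0 addr0.
by rewrite sip_sym// sip_null// resid0.
Qed.

(* Kato's identity |I - P| = |P| for an oblique projection P, on the plane spanned
   by g in its range and z in its kernel. The test vector
   (|z| / |g|) g + (|g| / |z|) z has the same norm as g + z. *)
Lemma kato_projection (C : R) g z : S g -> S z -> 1 <= C ->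
  (forall a b, s (a *: g) (a *: g) <= C * s (a *: g + b *: z) (a *: g + b *: z)) ->
  s z z <= C * s (g + z) (g + z).
Proof.
move=> Sg Sz C1 H.
have E : s (g + z) (g + z) = s g g + 2 * s g z + s z z.
  by have := sip_sqrD 1 1 Sg Sz; rewrite !scale1r => ->; ring.
have [g0|g0] := eqVneq (s g g) 0.
  by rewrite E g0 (sip_null Sg Sz g0) mulr0 !add0r ler_peMl// sip_ge0.
have gp : 0 < s g g by rewrite lt_neqAle eq_sym g0 sip_ge0.
have [z0|z0] := eqVneq (s z z) 0.
  rewrite z0 mulr_ge0//; first by rewrite (le_trans _ C1).
  by apply: sip_ge0; exact: subspaceD.
have zp : 0 < s z z by rewrite lt_neqAle eq_sym z0 sip_ge0.
pose a := Num.sqrt (s z z / s g g).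
have a2 : a ^+ 2 = s z z / s g g by rewrite sqr_sqrtr// ltW// divr_gt0.
have a0 : a != 0 by rewrite -sqrf_eq0 a2 mulf_neq0// invr_eq0.
have := H a a^-1; rewrite sip_sqrD// sip_Zl// ?sip_Zr//; last exact: subspaceZ.
rewrite mulrA -expr2 exprVn a2 invf_div !divfK// -[2 * a * _]mulrA divff// E.
by rewrite mulr1 [s z z + _]addrC [_ + s z z + _]addrAC [2 * _ + _]addrC.
Qed.

End lemmas.
End semi_inner_product.

Lemma linear_dependence (F : fieldType) k M (c : 'I_k -> 'rV[F]_M) : (M < k)%N ->
  exists2 a : 'rV[F]_k, a != 0 & \sum_i a ord0 i *: c i = 0.
Proof.
move=> Mk; pose C := (\matrix_i c i).
have : kermx C != 0.
  by rewrite -mxrank_eq0 mxrank_ker -lt0n subn_gt0 (leq_ltn_trans (rank_leq_col C)).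
case/rowV0Pn => a /sub_kermxP aC a0; exists a => //; rewrite -[RHS]aC mulmx_sum_row.
by apply: eq_bigr => i _; rewrite rowK.
Qed.

(** Cauchy-Schwarz bounds every value by the length of [q], and the normalized [q] attains it. This
    turns the minimization of a dual norm into a least squares problem for representers. *)
Lemma sup_dual_norm (R : realType) (V : lmodType R) (S W : set V) s (q : V) :
  semi_ip S s -> linear_subspace W -> W `<=` S -> W q ->
  sup [set `|s q y| | y in [set y | W y /\ Num.sqrt (s y y) <= 1]] = Num.sqrt (s q q).
Proof.
move=> sip sW WS Wq; have Sq := WS _ Wq.
set A := (X in sup X).
have ub : ubound A (Num.sqrt (s q q)).
  move=> _ [y [Wy y1] <-]; apply: (le_trans (sip_CS_sqrt sip Sq (WS _ Wy))).
  by rewrite ler_piMr// sqrtr_ge0.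
have A0 : A !=set0.
  exists `|s q 0|, 0 => //; split; first exact: sW.1.
  by rewrite (sip_0l sip)// ?sqrtr0 ?ler01//; exact: (WS _ sW.1).
apply/eqP; rewrite eq_le; apply/andP; split; first exact: ge_sup.
have [q0|q0] := eqVneq (s q q) 0.
  rewrite q0 sqrtr0; case: A0 => a Aa; apply: (@le_trans _ _ a).
    by case: Aa => y _ <-.
  by apply: ub_le_sup => //; exists (Num.sqrt (s q q)).
have qp : 0 < Num.sqrt (s q q) by rewrite sqrtr_gt0 lt_neqAle eq_sym q0 (sip_ge0 sip).
have qn := lt0r_neq0 qp.
have q2 : Num.sqrt (s q q) ^+ 2 = s q q by rewrite sqr_sqrtr// (sip_ge0 sip).
apply: ub_le_sup; first by exists (Num.sqrt (s q q)).
exists ((Num.sqrt (s q q))^-1 *: q).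
  split; first exact: subspaceZ.
  have Sq' : S ((Num.sqrt (s q q))^-1 *: q) by apply: WS; exact: subspaceZ.
  rewrite (sip_Zl sip)// (sip_Zr sip)//.
  by rewrite mulrA -expr2 exprVn q2 mulVf// sqrtr1.
rewrite (sip_Zr sip)// -[X in _ * X]q2 expr2 mulrA mulVf// mul1r ger0_norm // ltW.
Qed.

(** * Abstract quasi-optimality of residual minimization with a Fortin operator *)

Section practical_dpg.
Context (R : realType) (X Y : lmodType R).
Context (SX Xh : set X) (sX : X -> X -> R) (SY Yh : set Y) (sY : Y -> Y -> R).
Context (b : X -> Y -> R) (T : X -> Y) (P : Y -> Y).
Hypotheses (hX : semi_ip SX sX) (hY : semi_ip SY sY).
Hypothesis TY : forall x, SX x -> SY (T x).
Hypothesis bT : forall x y, SX x -> SY y -> b x y = sY (T x) y.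
Hypothesis b_lin : forall a x x' y, SX x -> SX x' -> SY y ->
  b (a *: x + x') y = a * b x y + b x' y.
Hypotheses (sXh : linear_subspace Xh) (XhS : Xh `<=` SX).
Hypotheses (sYh : linear_subspace Yh) (YhS : Yh `<=` SY).
Variable MY : nat.
Hypothesis Yh_fin : forall k (e : 'I_k -> Y), (forall i, Yh (e i)) ->
  orthonormal_family sY e -> (k <= MY)%N.
Hypothesis PYh : forall y, SY y -> Yh (P y).
Variable p : R.
Hypothesis p_ge0 : 0 <= p.
Hypothesis Pp : forall y, SY y -> sY (P y) (P y) <= p ^+ 2 * sY y y.
Hypothesis bP : forall x y, Xh x -> SY y -> b x (P y) = b x y.
Variables lam mu : R.
Hypothesis lam_gt0 : 0 < lam.
Hypothesis lam_le : forall x, SX x -> lam * sX x x <= sY (T x) (T x).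
Hypothesis mu_ge : forall x, SX x -> sY (T x) (T x) <= mu * sX x x.

Let sSX : linear_subspace SX := let: And4 h _ _ _ := hX in h.
Let sSY : linear_subspace SY := let: And4 h _ _ _ := hY in h.

(** On the diagonal this is the squared norm of [b x] as a functional on [SY], since [T x]
    represents it. *)
Definition energy x x' := sY (T x) (T x').

Lemma energy_semi_ip : semi_ip SX energy.
Proof.
split => // [a u v w Su Sv Sw|u v Su Sv|u Su]; rewrite /energy.
- have Suv := sSX.2 a _ _ Su Sv.
  by rewrite -!bT ?b_lin//; exact: TY.
- by apply: sip_sym hY _ _ _ _; exact: TY.
- by apply: (sip_ge0 hY); exact: TY.
Qed.

(* If the coefficient vectors of P (T x_i) are linearly dependent, the Fortin
   property turns the dependence into an energy-null combination of the x_i. *)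
Lemma trial_space_finite M (coef : Y -> 'rV[R]_M -> Prop) :
  (forall y, Yh y -> exists c, coef y c) ->
  (forall (I : finType) (a : I -> R) (y : I -> Y) (c : I -> 'rV[R]_M),
     (forall i, Yh (y i)) -> (forall i, coef (y i) (c i)) ->
     \sum_i a i *: c i = 0 -> sY (\sum_i a i *: y i) (\sum_i a i *: y i) = 0) ->
  (forall k (e : 'I_k -> Y), (forall i, Yh (e i)) -> orthonormal_family sY e -> (k <= M)%N) /\
  (forall k (e : 'I_k -> X), (forall i, Xh (e i)) -> orthonormal_family sX e -> (k <= M)%N).
Proof.
move=> cex c0; split=> k e We oe; rewrite leqNgt; apply/negP => Mk.
- have /choice[c cP] : forall i, exists c, coef (e i) c by move=> i; exact: cex.
  have [a a0 aC] := linear_dependence c Mk.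
  have Se i : SY (e i) by exact: YhS.
  have z0 := c0 _ (fun i => a ord0 i) e c We cP aC.
  move/eqP: a0; apply; apply/rowP => j; rewrite mxE.
  have := sip_null hY (subspace_sum _ (fun i => a ord0 i) sSY Se) (Se j) z0.
  rewrite (sip_suml hY)// (bigD1 j)//= oe eqxx mulr1 big1 ?addr0// => i ij.
  by rewrite oe (negbTE ij) mulr0.
- have Se i : SX (e i) by exact: XhS.
  have Ye i : Yh (P (T (e i))) by apply: PYh; exact: TY.
  have /choice[c cP] : forall i, exists c, coef (P (T (e i))) c by move=> i; exact: cex.
  have [a a0 aC] := linear_dependence c Mk.
  have z0 := c0 _ (fun i => a ord0 i) _ c Ye cP aC.
  set y := \sum_i _ in z0.
  pose x := \sum_i a ord0 i *: e i.
  have Sx : SX x by exact: subspace_sum.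
  have en0 j : energy (e j) x = 0.
    rewrite (sip_sym energy_semi_ip)// (sip_suml energy_semi_ip)//.
    have Sy i : SY (P (T (e i))) by exact: YhS.
    transitivity (sY y (T (e j))).
      rewrite (sip_suml hY)//; last exact: TY.
      apply: eq_bigr => i _; congr (_ * _).
      rewrite /energy (sip_sym hY) ?(sip_sym hY (Sy i))//; try exact: TY.
      by rewrite -!bT ?bP//; exact: TY.
    by apply: (sip_null hY) => //; [exact: subspace_sum|exact: TY].
  have exx : energy x x = 0.
    by rewrite {1}/x (sip_suml energy_semi_ip)// big1// => i _; rewrite en0 mulr0.
  have sx0 : sX x x = 0.
    apply/eqP; rewrite eq_le (sip_ge0 hX)// andbT.
    by rewrite -(pmulr_rle0 _ lam_gt0) -exx; exact: lam_le.
  move/eqP: a0; apply; apply/rowP => j; rewrite mxE.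
  have := sip_null hX Sx (Se j) sx0.
  rewrite (sip_suml hX)// (bigD1 j)//= oe eqxx mulr1 big1 ?addr0// => i ij.
  by rewrite oe (negbTE ij) mulr0.
Qed.

(** The functional [b x0] takes the same value at [T x0] and at [P (T x0)], so [P] cannot shorten
    [T x0]. A trial vector of positive length makes [T x0] non-null; Kato's identity relies on this
    bound. *)
Lemma fortin_norm_ge1 x0 : Xh x0 -> 0 < sX x0 x0 -> 1 <= p.
Proof.
move=> X0 x0p; have S0 := XhS X0; have ST0 := TY S0.
have Sp := YhS (PYh ST0).
have e0 : 0 < sY (T x0) (T x0).
  by apply: (lt_le_trans _ (lam_le S0)); rewrite mulr_gt0.
have := sip_CS hY ST0 Sp; rewrite -!bT// bP// bT// => H.
have : sY (T x0) (T x0) ^+ 2 <= sY (T x0) (T x0) ^+ 2 * p ^+ 2.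
  apply: (le_trans H); rewrite expr2 -mulrA ler_pM2l// mulrC.
  exact: Pp.
rewrite ler_pMr ?exprn_gt0// => p1.
by rewrite -(@ler_pXn2r _ 2) ?nnegrE ?ler01// expr1n.
Qed.

(** The discrete problem is an orthogonal projection for the seminorm of representers in [Yh]. Seen
    in the energy norm it is an oblique projection of norm at most [p], and Kato's identity bounds
    the complementary projection by the same [p]. *)
Theorem dpg_quasi_optimal (us uh : X) (F : Y -> R) :
  1 <= p ->
  SX us -> (forall y, SY y -> b us y = F y) -> Xh uh ->
  (forall x, Xh x ->
    sup [set `|b uh y - F y| | y in [set y | Yh y /\ Num.sqrt (sY y y) <= 1]] <=
    sup [set `|b x y - F y| | y in [set y | Yh y /\ Num.sqrt (sY y y) <= 1]]) ->
  forall v, Xh v -> lam * sX (us - uh) (us - uh) <=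
    p ^+ 2 * mu * sX (us - v) (us - v).
Proof.
move=> p1 Sus bus Xuh umin v Xv.
have hE := energy_semi_ip.
(* [q x] represents [b x] on [Yh] and is the projection of [T x]; off [SX] the choice takes the
   default 0. *)
have /choice[q qP] : forall x, exists y, SX x ->
    Yh y /\ forall w, Yh w -> sY y w = b x w.
  move=> x; have [Sx|nSx] := pselect (SX x); last by exists 0.
  have [y Yy yP] := sip_projection hY sYh YhS Yh_fin (TY Sx).
  exists y => _; split => // w Yw; have Sw := YhS Yw.
  rewrite bT//; apply/esym/eqP; rewrite -subr_eq0 -(sip_Bl hY) ?yP//; first exact: TY.
  exact: YhS.
have Yq x : SX x -> Yh (q x) by move=> /qP[].
have Sq x : SX x -> SY (q x) by move=> /Yq; exact: YhS.
have qb x w : SX x -> Yh w -> sY (q x) w = b x w by move=> /qP[_]; apply.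
pose s x x' := sY (q x) (q x').
have hs : semi_ip SX s.
  split => // [a x x' w Sx Sx' Sw|x x' Sx Sx'|x Sx]; rewrite /s.
  - have Sxx := sSX.2 a _ _ Sx Sx'.
    by rewrite !qb ?b_lin//; [apply: YhS|..]; exact: Yq.
  - by apply: (sip_sym hY); exact: Sq.
  - by apply: (sip_ge0 hY); exact: Sq.
(* As [b us] agrees with [F], the residual of [x] is minus [b (us - x)], whose dual norm over [Yh]
   is the length of [q (us - x)]. *)
have dualE x : SX x ->
    sup [set `|b x y - F y| | y in [set y | Yh y /\ Num.sqrt (sY y y) <= 1]] =
    Num.sqrt (s (us - x) (us - x)).
  move=> Sx; have Sx' : SX (us - x) by exact: subspaceB.
  rewrite -(sup_dual_norm hY sYh YhS (Yq _ Sx')); congr sup.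
  apply: eq_imagel => y [Yy _]; have Sy := YhS Yy.
  rewrite qb// -bus// distrC; congr (`|_|).
  by rewrite -[us - x]addrC -scaleN1r b_lin// mulN1r addrC.
have orth w : Xh w -> s (us - uh) w = 0.
  apply: (sip_minimizer hs sXh XhS) => // w' Xw'.
  have := umin _ Xw'; rewrite !dualE//; try exact: XhS.
  have S' : SX (us - w') by apply: subspaceB => //; exact: XhS.
  by rewrite ler_sqrt// (sip_ge0 hs).
(* In [b g (T g)] the Fortin property replaces [T g] by [P (T g)]. There [q g] represents [b g], and
   Cauchy-Schwarz costs only the factor [p]. *)
have energy_le g : Xh g -> energy g g <= p ^+ 2 * s g g.
  move=> Xg; have Sg := XhS Xg; have STg := TY Sg.
  have Sp := YhS (PYh STg).
  have e_b : energy g g = sY (q g) (P (T g)).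
    by rewrite qb ?bP ?bT//; exact: PYh.
  have [->|g0] := eqVneq (energy g g) 0.
    by rewrite mulr_ge0 ?sqr_ge0// (sip_ge0 hs).
  have gp : 0 < energy g g by rewrite lt_neqAle eq_sym g0 (sip_ge0 hE).
  rewrite -(ler_pM2l gp) -expr2 {1}e_b.
  apply: (le_trans (sip_CS hY (Sq _ Sg) Sp)).
  rewrite mulrC [_ * (_ * _)]mulrA; apply: ler_wpM2r; first exact: (sip_ge0 hs).
  by rewrite mulrC; exact: Pp.
(* [q x] is an orthogonal projection of [T x], hence not longer. *)
have s_le x : SX x -> s x x <= energy x x.
  move=> Sx; have [->|s0] := eqVneq (s x x) 0; first exact: (sip_ge0 hE).
  have sp : 0 < s x x by rewrite lt_neqAle eq_sym s0 (sip_ge0 hs).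
  have sE : s x x = sY (T x) (q x) by rewrite /s qb ?bT//; [exact: Sq|exact: Yq].
  rewrite -(ler_pM2l sp) -expr2 {1}sE.
  by rewrite mulrC; apply: (sip_CS hY); [exact: TY|exact: Sq].
have Suh := XhS Xuh; have Sv := XhS Xv.
pose g := uh - v; pose z := us - uh.
have Xg : Xh g by exact: subspaceB.
have Sg := XhS Xg; have Sz : SX z by exact: subspaceB.
(* On the plane of [g] and [z] the map to the [g]-part is bounded by [p] in energy: pass to [s] on
   [Xh], drop the [s]-orthogonal [z]-part, return by [s_le]. Kato's identity gives the bound for the
   [z]-part. *)
have K : energy z z <= p ^+ 2 * energy (g + z) (g + z).
  apply: (kato_projection hE) => //; first by rewrite expr_ge1.
  move=> a c; have Xag : Xh (a *: g) by exact: subspaceZ.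
  have Sag := XhS Xag; have Scz : SX (c *: z) by exact: subspaceZ.
  have Sagz : SX (a *: g + c *: z) by exact: subspaceD.
  apply: (le_trans (energy_le _ Xag)); apply: ler_wpM2l; first exact: sqr_ge0.
  apply: le_trans (s_le _ Sagz).
  rewrite (sip_sqrD hs)// (sip_sym hs Sg Sz) (orth _ Xg) mulr0 addr0.
  rewrite (sip_Zl hs)// (sip_Zr hs)// mulrA -expr2 lerDl mulr_ge0 ?sqr_ge0//.
  exact: (sip_ge0 hs).
have gz : g + z = us - v by rewrite /g /z addrC addrA subrK.
apply: (le_trans (lam_le Sz)); apply: (le_trans K); rewrite gz -mulrA.
apply: ler_wpM2l; first exact: sqr_ge0.
by apply: mu_ge; exact: subspaceB.
Qed.

End practical_dpg.

(** * Square-integrable functions, vector functions and fields *)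

Section L2_scalar.
Context d (T : measurableType d) (R : realType) (mu : {measure set T -> \bar R}).
Implicit Types (f g h : T -> R) (D : set T).

Lemma inL2_measurable D f : measurable D -> inL2 mu D f -> measurable_fun D f.
Proof.
move=> mD; rewrite /inL2 inE => /andP[+ _]; rewrite inE/= => mf.
exact/(measurable_restrictT _ mD).
Qed.

Lemma inL2_mul_integrable D f g : measurable D -> inL2 mu D f -> inL2 mu D g ->
  mu.-integrable D (fun x => (f x * g x)%:E).
Proof.
move=> mD Df Dg; apply/(integrable_mkcond _ mD).
have /Lfun1_integrable := Lfun2_mul_Lfun1 Df Dg.
by congr (mu.-integrable _ _); apply/funext => x /=; rewrite !patchE; case: ifP; rewrite ?mul0r.
Qed.

(** Integrability of the square passes to subsets, slices and almost everywhere equal functions more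
    easily than finiteness of the power norm of the restriction. *)
Lemma inL2P D f : measurable D ->
  inL2 mu D f <-> measurable_fun D f /\ mu.-integrable D (fun x => (f x * f x)%:E).
Proof.
move=> mD; split=> [Df|[mf iff]].
  by split; [exact: inL2_measurable|exact: inL2_mul_integrable].
have mfD : measurable_fun setT (f \_ D) by exact/(measurable_restrictT _ mD).
rewrite /inL2 inE; apply/andP; split; rewrite inE//=.
rewrite /finite_norm unlock /Lnorm poweR_lty//.
have /(integrable_mkcond _ mD)/integrableP[_] := iff.
apply: le_lt_trans; rewrite le_eqVlt; apply/orP; left; apply/eqP.
apply: eq_integral => x _.
rewrite (_ : (EFin \o f \_ D) x = ((f \_ D) x)%:E)// abse_EFin poweR_EFin (powR_mulrn 2)// !patchE; case: ifP => _ /=; congr (_%:E).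
  by rewrite normrM expr2.
by rewrite normr0 expr0n.
Qed.

Lemma inL2_lin D a f g : inL2 mu D f -> inL2 mu D g ->
  inL2 mu D (fun x => a * f x + g x).
Proof.
have [_ H] : submod_closed (Lfun mu (2%:E : \bar R)).
  by apply: Lfun_submod_closed; rewrite lee_fin ler1n.
move=> Df Dg; have := H a _ _ Df Dg; rewrite /inL2.
rewrite (_ : _ + _ = (fun x => a * f x + g x) \_ D)//.
apply/funext => x; transitivity (a * (f \_ D) x + (g \_ D) x) => //.
by rewrite !patchE; case: ifP => _ //; rewrite mulr0 addr0.
Qed.

Lemma inL2_0 D : inL2 mu D (fun=> 0).
Proof.
have [H0 _] : submod_closed (Lfun mu (2%:E : \bar R)).
  by apply: Lfun_submod_closed; rewrite lee_fin ler1n.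
by rewrite /inL2 (_ : _ \_ _ = 0)//; apply/funext => x; rewrite patchE; case: ifP.
Qed.

Lemma inL2_Z D a f : inL2 mu D f -> inL2 mu D (fun x => a * f x).
Proof.
move=> Df; have := inL2_lin a Df (inL2_0 D).
by rewrite (_ : (fun x => a * f x + 0) = (fun x => a * f x))//; apply/funext => x; rewrite addr0.
Qed.

Lemma inL2_D D f g : inL2 mu D f -> inL2 mu D g -> inL2 mu D (fun x => f x + g x).
Proof.
move=> Df Dg; have := inL2_lin 1 Df Dg.
by rewrite (_ : (fun x => 1 * f x + g x) = (fun x => f x + g x))//; apply/funext => x; rewrite mul1r.
Qed.

Lemma inL2_N D f : inL2 mu D f -> inL2 mu D (fun x => - f x).
Proof.
move=> Df; have := inL2_Z (-1) Df.
by rewrite (_ : (fun x => -1 * f x) = (fun x => - f x))//; apply/funext => x; rewrite mulN1r.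
Qed.

Lemma inL2_B D f g : inL2 mu D f -> inL2 mu D g -> inL2 mu D (fun x => f x - g x).
Proof. by move=> Df Dg; apply: inL2_D => //; exact: inL2_N. Qed.

Lemma inL2_sum D (I : Type) (r : seq I) (P : pred I) (F : I -> T -> R) :
  (forall i, P i -> inL2 mu D (F i)) -> inL2 mu D (fun x => \sum_(i <- r | P i) F i x).
Proof.
move=> DF; elim: r => [|i r IH].
  by rewrite (_ : (fun _ => _) = (fun=> 0)); [exact: inL2_0|apply/funext => x; rewrite big_nil].
have [Pi|Pi] := boolP (P i); last first.
  by under eq_fun do rewrite big_cons (negbTE Pi).
by under eq_fun do rewrite big_cons Pi; apply: inL2_D => //; exact: DF.
Qed.

Lemma inL2_subset D E f : measurable D -> measurable E -> E `<=` D ->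
  inL2 mu D f -> inL2 mu E f.
Proof.
move=> mD mE ED /(inL2P _ mD)[mf iff]; apply/(inL2P _ mE); split.
  exact: measurable_funS mf.
exact: integrableS iff.
Qed.

Lemma inL2_eq D f g : {in D, f =1 g} -> inL2 mu D f -> inL2 mu D g.
Proof.
move=> fg; rewrite /inL2 (_ : f \_ D = g \_ D)//.
by apply/funext => x; rewrite !patchE; case: ifP => // /fg.
Qed.

Lemma inL2_bounded D f (C : R) : measurable D -> (mu D < +oo)%E ->
  measurable_fun D f -> (forall x, D x -> `|f x| <= C) -> inL2 mu D f.
Proof.
move=> mD Doo mf fC; apply/(inL2P _ mD); split=> //.
apply: (@measurable_bounded_integrable _ _ _ _ (fun x => f x * f x)) => //.
  exact: measurable_funM.
exists (C * C); split; first exact: num_real.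
move=> M CM x /= Dx; rewrite normrM (le_trans _ (ltW CM))//.
by apply: ler_pM => //; exact: fC.
Qed.

(* A bounded multiplier. *)
Lemma inL2_bounded_mul D f g (C : R) : measurable D -> measurable_fun D g ->
  (forall x, D x -> `|g x| <= C) -> inL2 mu D f -> inL2 mu D (fun x => f x * g x).
Proof.
move=> mD mg gC /(inL2P _ mD)[mf iff]; apply/(inL2P _ mD); split.
  exact: measurable_funM.
have C0 x : D x -> 0 <= C by move=> /gC; exact: le_trans.
apply: (@le_integrable _ _ _ _ _ mD _ (fun x => ((C * C) * (f x * f x))%:E)).
- by apply/measurable_EFinP; apply: measurable_funM; exact: measurable_funM.
- move=> x Dx /=; rewrite lee_fin; have Cx := C0 _ Dx.
  have ff0 : 0 <= f x * f x by rewrite -expr2 sqr_ge0.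
  have gg0 : 0 <= g x * g x by rewrite -expr2 sqr_ge0.
  have -> : f x * g x * (f x * g x) = (g x * g x) * (f x * f x) by ring.
  have CC : 0 <= C * C by exact: mulr_ge0.
  rewrite (ger0_norm (mulr_ge0 gg0 ff0)) (ger0_norm (mulr_ge0 CC ff0)).
  rewrite ler_wpM2r// -!expr2.
  by rewrite -real_normK ?num_real// ler_pXn2r ?nnegrE// gC.
- under eq_fun do rewrite EFinM.
  exact: integrableZl.
Qed.

Lemma ip_lin D a f g h : measurable D -> inL2 mu D f -> inL2 mu D g -> inL2 mu D h ->
  ip mu D (fun x => a * f x + g x) h = a * ip mu D f h + ip mu D g h.
Proof.
move=> mD Df Dg Dh; rewrite /ip -RintegralZl//; last exact: inL2_mul_integrable.
rewrite -RintegralD//.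
- by apply: eq_Rintegral => x _; rewrite mulrDl mulrA.
- have Daf := inL2_Z a Df.
  by under eq_fun do rewrite /= mulrA; exact: inL2_mul_integrable.
- exact: inL2_mul_integrable.
Qed.

Lemma ip_sym D f g : ip mu D f g = ip mu D g f.
Proof. by apply: eq_Rintegral => x _; rewrite mulrC. Qed.

Lemma ip_ge0 D f : 0 <= ip mu D f f.
Proof. by apply: Rintegral_ge0 => x _; rewrite -expr2 sqr_ge0. Qed.

Lemma ip_ae D f f' g g' : measurable D ->
  measurable_fun D f -> measurable_fun D f' -> measurable_fun D g -> measurable_fun D g' ->
  ae_eq mu D f f' -> ae_eq mu D g g' -> ip mu D f g = ip mu D f' g'.
Proof.
move=> mD mf mf' mg mg' ff' gg'; rewrite /ip /Rintegral; congr fine.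
apply: ae_eq_integral => //; try by apply/measurable_EFinP; exact: measurable_funM.
near=> x => Dx; congr (_ * _)%:E.
- by move: Dx; near: x.
- by move: Dx; near: x.
Unshelve. all: by end_near. Qed.

Lemma inL2_ae D f g : measurable D -> measurable_fun D g -> ae_eq mu D f g ->
  inL2 mu D f -> inL2 mu D g.
Proof.
move=> mD mg fg /(inL2P _ mD)[mf iff]; apply/(inL2P _ mD); split=> //.
move/integrableP : iff => [mff ff]; apply/integrableP; split.
  by apply/measurable_EFinP; exact: measurable_funM.
move: ff; congr (_ < _)%E; apply: ge0_ae_eq_integral => //.
- exact: measurableT_comp.
- by apply: measurableT_comp => //; apply/measurable_EFinP; exact: measurable_funM.
- near=> x => Dx; suff -> : f x = g x by [].
  by move: Dx; near: x.
Unshelve. all: by end_near. Qed.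

Lemma ip_eq0 D f : measurable D -> inL2 mu D f -> ip mu D f f = 0 ->
  ae_eq mu D f (fun=> 0).
Proof.
move=> mD Df f0; have mf := inL2_measurable mD Df.
have iff := inL2_mul_integrable mD Df Df.
have mff : measurable_fun D (fun x => (f x * f x)%:E).
  by apply/measurable_EFinP; exact: measurable_funM.
have /(ae_eq_integral_abs _ mD mff) : (\int[mu]_(x in D) `|(f x * f x)%:E| = 0)%E.
  have fin : (\int[mu]_(x in D) (f x * f x)%:E \is a fin_num)%E.
    exact: integrable_fin_num.
  rewrite (eq_integral (fun x => (f x * f x)%:E)).
    by rewrite -(fineK fin) -[fine _]/(ip mu D f f) f0.
  by move=> x _; rewrite gee0_abs// lee_fin -expr2 sqr_ge0.
apply: filterS => x H Dx; have [/eqP] := H Dx.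
by rewrite mulf_eq0 orbb => /eqP.
Qed.

End L2_scalar.

Section L2_vector.
Context d (T : measurableType d) (R : realType) (mu : {measure set T -> \bar R}).
Context (n : nat).
Implicit Types (f g h : T -> 'rV[R]_n) (D : set T).

Lemma ipv_sumE D f g : measurable D -> inL2v mu D f -> inL2v mu D g ->
  ipv mu D f g = \sum_i ip mu D (fun x => f x ord0 i) (fun x => g x ord0 i).
Proof.
move=> mD Df Dg; rewrite /ipv /dotv /ip.
elim: (index_enum _) => [|i r IH].
  rewrite big_nil (_ : (fun _ => _) = (fun=> 0)); first by rewrite Rintegral_cst// mul0r.
  by apply/funext => x; rewrite big_nil.
rewrite big_cons -IH -RintegralD//; last 2 first.
- exact: inL2_mul_integrable.
- rewrite (_ : EFin \o _ =
    (fun x => \sum_(j <- r) (f x ord0 j * g x ord0 j)%:E)%E); last first.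
    by apply/funext => x /=; rewrite sumEFin.
  apply: integrable_sum => // j _; exact: inL2_mul_integrable.
by apply: eq_Rintegral => x _; rewrite big_cons.
Qed.

Lemma inL2v_lin D a f g : inL2v mu D f -> inL2v mu D g ->
  inL2v mu D (fun x => a *: f x + g x).
Proof.
move=> Df Dg i; have := inL2_lin a (Df i) (Dg i).
by congr (inL2 _ _ _); apply/funext => x; rewrite !mxE.
Qed.

Lemma ipv_lin D a f g h : measurable D -> inL2v mu D f -> inL2v mu D g -> inL2v mu D h ->
  ipv mu D (fun x => a *: f x + g x) h = a * ipv mu D f h + ipv mu D g h.
Proof.
move=> mD Df Dg Dh; rewrite !ipv_sumE//; last exact: inL2v_lin.
rewrite mulr_sumr -big_split/=; apply: eq_bigr => i _.
by rewrite -ip_lin//; congr (ip _ _ _ _); apply/funext => x; rewrite !mxE.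
Qed.

Lemma ipv_sym D f g : ipv mu D f g = ipv mu D g f.
Proof. by apply: eq_Rintegral => x _; apply: eq_bigr => i _; rewrite mulrC. Qed.

Lemma ipv_ge0 D f : 0 <= ipv mu D f f.
Proof.
by apply: Rintegral_ge0 => x _; apply: sumr_ge0 => i _; rewrite -expr2 sqr_ge0.
Qed.

Lemma ae_eq_coord D f g : ae_eq mu D f g <->
  forall i, ae_eq mu D (fun x => f x ord0 i) (fun x => g x ord0 i).
Proof.
split=> [fg i|fg]; first by apply: filterS fg => x H /H ->.
have : \forall x \ae mu, forall i, D x -> f x ord0 i = g x ord0 i.
  by apply: filter_forall => i; exact: fg.
by apply: filterS => x H Dx; apply/rowP => i; exact: H.
Qed.

Lemma ipv_ae D f f' g g' : measurable D ->
  inL2v mu D f -> inL2v mu D f' -> inL2v mu D g -> inL2v mu D g' ->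
  ae_eq mu D f f' -> ae_eq mu D g g' -> ipv mu D f g = ipv mu D f' g'.
Proof.
move=> mD Df Df' Dg Dg' /ae_eq_coord ff' /ae_eq_coord gg'; rewrite !ipv_sumE//.
by apply: eq_bigr => i _; apply: ip_ae => //; exact: inL2_measurable.
Qed.

Lemma ipv_eq0 D f : measurable D -> inL2v mu D f -> ipv mu D f f = 0 ->
  ae_eq mu D f (fun=> 0).
Proof.
move=> mD Df; rewrite ipv_sumE// => /eqP; rewrite psumr_eq0 => [|i _]; last exact: ip_ge0.
move=> /allP f0; apply/ae_eq_coord => i.
have := ip_eq0 mD (Df i) (eqP (f0 i (mem_index_enum _))).
by apply: filterS => x H /H; rewrite mxE.
Qed.

End L2_vector.

Section L2_field.
Context (R : realType) (d : nat).
Notation pt := (measurableTypeR R * 'rV[R]_d)%type.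
Notation fld := (fld R d).
Notation mu := (mu_tx R d).
Implicit Types (u v w : fld) (D : set pt).

(** [wgrad] and [wdiv] are arbitrarily chosen representatives, so identities between fields that
    involve them are stated in this sense. *)
Definition aef D u v : Prop := ae_eq mu D u.1 v.1 /\ ae_eq mu D u.2 v.2.

Lemma inL2f_lin D a u v : inL2f D u -> inL2f D v -> inL2f D (a *: u + v).
Proof. by move=> [u1 u2] [v1 v2]; split; [exact: inL2_lin|exact: inL2v_lin]. Qed.

Lemma inL2f_0 D : inL2f D (0 : fld).
Proof.
split; first exact: inL2_0.
by move=> i; have := inL2_0 mu D; congr (inL2 _ _ _); apply/funext => x; rewrite mxE.
Qed.

Lemma ipf_semi_ip D : measurable D -> semi_ip (V := fld) (inL2f D) (ipf D).
Proof.
move=> mD; split => //.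
- by split=> [|a u v]; [exact: inL2f_0|exact: inL2f_lin].
- move=> a u v w [u1 u2] [v1 v2] [w1 w2]; rewrite /ipf.
  rewrite [X in X + _](ip_lin a mD u1 v1 w1) [X in _ + X](ipv_lin a mD u2 v2 w2); ring.
- by move=> u v _ _; rewrite /ipf ip_sym ipv_sym.
- by move=> u _; rewrite addr_ge0// ?ip_ge0// ipv_ge0.
Qed.

Lemma ipf_ae D u u' v v' : measurable D -> inL2f D u -> inL2f D u' ->
  inL2f D v -> inL2f D v' -> aef D u u' -> aef D v v' -> ipf D u v = ipf D u' v'.
Proof.
move=> mD [u1 u2] [u1' u2'] [v1 v2] [v1' v2'] [e1 e2] [e1' e2'].
congr (_ + _); last exact: ipv_ae.
exact: (ip_ae mD (inL2_measurable mD u1) (inL2_measurable mD u1')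
  (inL2_measurable mD v1) (inL2_measurable mD v1')).
Qed.

Lemma ipf_eq0 D u : measurable D -> inL2f D u -> ipf D u u = 0 -> aef D u 0.
Proof.
move=> mD [u1 u2] /eqP; rewrite paddr_eq0 ?ip_ge0 ?ipv_ge0// => /andP[/eqP e1 /eqP e2].
by split; [exact: ip_eq0|exact: ipv_eq0].
Qed.

Lemma aef_refl D u : aef D u u. Proof. by split; exact: ae_eq_refl. Qed.

Lemma aef_sym D u v : aef D u v -> aef D v u.
Proof. by move=> [? ?]; split; exact: ae_eq_sym. Qed.

Lemma aef_trans D u v w : aef D u v -> aef D v w -> aef D u w.
Proof.
by move=> [e1 e2] [e1' e2']; split; [exact: ae_eq_trans e1 e1'|exact: ae_eq_trans e2 e2'].
Qed.

Lemma aef_lin D a u u' v v' : aef D u u' -> aef D v v' ->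
  aef D (a *: u + v) (a *: u' + v').
Proof.
move=> [e1 e2] [e1' e2']; split.
- apply: filterS2 e1 e1' => x H H' Dx.
  by change (a * u.1 x + v.1 x = a * u'.1 x + v'.1 x); rewrite H// H'.
- apply: filterS2 e2 e2' => x H H' Dx.
  by change (a *: u.2 x + v.2 x = a *: u'.2 x + v'.2 x); rewrite H// H'.
Qed.

Lemma inL2f_subset D E u : measurable D -> measurable E -> E `<=` D ->
  inL2f D u -> inL2f E u.
Proof.
move=> mD mE ED [u1 u2]; split=> [|i].
  exact: (inL2_subset mD).
exact: (inL2_subset mD).
Qed.

End L2_field.

(** * Coordinate boxes and the measurable sets of space-time *)

Section coordinates.
Context (R : realType) (d : nat).
Notation pt := (measurableTypeR R * 'rV[R]_d)%type.
Notation mu := (mu_tx R d).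
Implicit Types (z y : pt) (a b : 'I_d.+1 -> R) (D : set pt).

(** Time becomes coordinate 0, so boxes and bumps treat time and space alike. *)
Definition coord (z : R * 'rV[R]_d) (k : 'I_d.+1) : R := rvcons z ord0 k.

Lemma coord0 z : coord z ord0 = z.1.
Proof. by rewrite /coord /rvcons mxE unlift_none. Qed.

Lemma coord_lift z j : coord z (lift ord0 j) = z.2 ord0 j.
Proof. by rewrite /coord /rvcons mxE liftK. Qed.

Lemma ball_coord (z y : R * 'rV[R]_d) e : 0 < e ->
  ball z e y <-> forall k, `|coord z k - coord y k| < e.
Proof.
move=> e0; split=> [[b1 [_ b2]] k|H].
- case: (unliftP ord0 k) => [j|] ->; rewrite ?coord0 ?coord_lift//.
  exact: (b2 ord0 j).
- split; first by have := H ord0; rewrite !coord0.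
  by split=> // i j; rewrite (ord1 i); have := H (lift ord0 j); rewrite !coord_lift.
Qed.

Lemma measurable_coord k : measurable_fun [set: pt] (fun z => coord z k).
Proof.
case: (unliftP ord0 k) => [j|] ->.
- under eq_fun do rewrite coord_lift.
  rewrite (_ : (fun _ => _) = (fun x : 'rV[R]_d => x ord0 j) \o snd)//.
  by apply: measurableT_comp => //; exact: measurable_rv_coord.
- by under eq_fun do rewrite coord0; exact: measurable_fst.
Qed.

Definition obox a b : set (R * 'rV[R]_d) := [set z | forall k, a k < coord z k < b k].
Definition cbox a b : set (R * 'rV[R]_d) := [set z | forall k, a k <= coord z k <= b k].

Lemma obox_cbox a b : obox a b `<=` cbox a b.
Proof. by move=> z H k; have /andP[/ltW -> /ltW ->] := H k. Qed.

Lemma measurable_coord_forall (P : 'I_d.+1 -> set R) :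
  (forall k, measurable (P k)) -> measurable ([set z | forall k, P k (coord z k)] : set pt).
Proof.
move=> mP; rewrite (_ : [set _ | _] =
    \big[setI/setT]_(k < d.+1) ((fun z => coord z k) @^-1` P k)).
  apply: bigsetI_measurable => k _.
  by rewrite -[X in measurable X]setTI; exact: measurable_coord.
rewrite -bigcap_seq; apply/seteqP; split=> z; first by move=> H i _ /=; exact: H.
by move=> H k; apply: H; rewrite /= mem_index_enum.
Qed.

Lemma measurable_obox a b : measurable (obox a b : set pt).
Proof.
rewrite (_ : obox a b = [set z | forall k, `]a k, b k[%classic (coord z k)]).
  by apply: (@measurable_coord_forall (fun k => `]a k, b k[%classic)) => k; exact: measurable_itv.
by apply/seteqP; split=> z H k; have := H k; rewrite /= in_itv.
Qed.

Definition rat_box (i : 'rV[rat]_d.+1 * nat) : set (R * 'rV[R]_d) :=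
  obox (fun k => ratr (i.1 ord0 k) - i.2.+1%:R^-1) (fun k => ratr (i.1 ord0 k) + i.2.+1%:R^-1).
Definition rat_cbox (i : 'rV[rat]_d.+1 * nat) : set (R * 'rV[R]_d) :=
  cbox (fun k => ratr (i.1 ord0 k) - i.2.+1%:R^-1) (fun k => ratr (i.1 ord0 k) + i.2.+1%:R^-1).

Lemma open_rat_box (D : set (R * 'rV[R]_d)) z : open D -> D z ->
  exists i, rat_box i z /\ rat_cbox i `<=` D.
Proof.
move=> oD Dz; have /nbhs_ballP[e /= e0 zeD] := open_nbhs_nbhs (conj oD Dz).
(* Twice the radius has to stay below [e]: the rational centre lies within one radius of [z], a
   point of the closed box within another radius of the centre. *)
have [n ne] : exists n, n.+1%:R^-1 < e / 2.
  have e20 : 0 < (e / 2)^-1 by rewrite invr_gt0 divr_gt0.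
  have := archi_boundP (ltW e20); set N := Num.bound _ => H; exists N.
  rewrite -[ltRHS]invrK ltf_pV2 ?posrE ?ltr0n//.
  by apply: (lt_trans H); rewrite ltr_nat.
have n0 : (0 : R) < n.+1%:R^-1 by rewrite invr_gt0 ltr0n.
have /choice[q qP] : forall k : 'I_d.+1, exists q : rat,
    coord z k - n.+1%:R^-1 < ratr q < coord z k + n.+1%:R^-1.
  move=> k; have zz : coord z k - n.+1%:R^-1 < coord z k + n.+1%:R^-1 by rewrite ltrD2l gtrN.
  by have [q] := rat_in_itvoo zz; rewrite in_itv/=; exists q.
exists (\row_k q k, n); split=> [k|y /= H] /=.
  by rewrite mxE; have := qP k; move: (n.+1%:R^-1) => r; lra.
apply: zeD; apply/ball_coord => // k.
have := H k; have := qP k; rewrite mxE/= ltr_norml; move: ne.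
by move: (n.+1%:R^-1) => r re /andP[? ?] /andP[? ?]; apply/andP; split; lra.
Qed.

(** Rational boxes are enumerated by their codes. A box is kept only if its closed version lies in
    [D], so that bumps on it are test functions on [D]. *)
Definition countable_cover (D : set (R * 'rV[R]_d)) (n : nat) : set (R * 'rV[R]_d) :=
  if @unpickle ('rV[rat]_d.+1 * nat)%type n is Some i
  then (if `[< rat_cbox i `<=` D >] then rat_box i else set0) else set0.

Lemma open_bigcup_rat_box (D : set (R * 'rV[R]_d)) : open D ->
  D = \bigcup_n countable_cover D n.
Proof.
move=> oD; apply/seteqP; split=> z.
  move=> /(open_rat_box oD)[i [zi iD]]; exists (pickle i) => //.
  by rewrite /countable_cover pickleK; case: asboolP.
move=> [n _]; rewrite /countable_cover; case: unpickle => // i.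
by case: asboolP => // iD zi; apply: iD; exact: obox_cbox.
Qed.

(** The sigma-algebra is generated by coordinates and not by open sets; a countable cover by
    rational boxes links the two. *)
Lemma open_measurable_pt (D : set pt) : open (D : set (R * 'rV[R]_d)) -> measurable D.
Proof.
move=> /open_bigcup_rat_box ->; apply: bigcupT_measurable => n.
rewrite /countable_cover; case: unpickle => // i; case: ifP => // _.
exact: measurable_obox.
Qed.

Lemma closed_measurable_pt (D : set pt) : closed (D : set (R * 'rV[R]_d)) -> measurable D.
Proof.
by rewrite -openC => /open_measurable_pt mD; rewrite -[D]setCK; exact: measurableC.
Qed.

Lemma open_measurable_rv (D : set 'rV[R]_d) : open D -> measurable D.
Proof.
move=> oD; have oTD : open ([set z | D z.2] : set (R * 'rV[R]_d)).
  by apply: (@open_comp _ _ snd) => // z _; exact: cvg_snd.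
have := measurable_xsection (0 : measurableTypeR R) (open_measurable_pt oTD).
by congr measurable; apply/seteqP; split=> x; rewrite /xsection/= inE.
Qed.

Lemma continuous_measurable_pt (f : pt -> R) :
  continuous (f : R * 'rV[R]_d -> R) -> measurable_fun setT f.
Proof.
move=> cf; apply: (measurability _ (measurable_realfun.RGenOpens.measurableE R)).
move=> _ [_ [a [b ->]] <-]; rewrite setTI; apply: open_measurable_pt.
by apply: open_comp => //; exact: interval_open.
Qed.

Definition ray b : set (R * 'rV[R]_d) := [set z | forall k, coord z k < b k].

(** Rays are stable under intersection, which makes them a generator fit for Dynkin's theorem. A
    half-space in one coordinate is the union of the rays whose other bounds are a growing
    integer. *)
Lemma measurable_ray_generated :
  @measurable _ pt = <<s [set ray b | b in [set: 'I_d.+1 -> R]] >>.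
Proof.
set G := [set ray b | b in _].
apply/seteqP; split; last first.
  apply: smallest_sub; first exact: sigma_algebra_measurable.
  move=> _ [b _ <-].
  rewrite (_ : ray b = [set z | forall k, `]-oo, b k[%classic (coord z k)]).
    by apply: (@measurable_coord_forall (fun k => `]-oo, b k[%classic)) => k; exact: measurable_itv.
  by apply/seteqP; split=> z H k; have := H k; rewrite /= in_itv.
pose S := g_sigma_algebraType (G : set (set pt)).
have mc k : measurable_fun [set: S] (fun z : S => coord z k).
  apply: (measurability _ (measurable_realfun.RGenInftyO.measurableE R)).
  move=> _ [_ [x ->] <-]; rewrite setTI.
  rewrite (_ : _ @^-1` _ =
      \bigcup_n ray (fun j => if j == k then x else n%:R)); last first.
    apply/seteqP; split=> z /=.
      rewrite in_itv/= => zx.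
      have [n zn] : exists n : nat, forall j, coord z j < n%:R.
        exists (\max_j Num.bound (coord z j)) => j.
        apply: (lt_le_trans (_ : _ < (Num.bound (coord z j))%:R)).
          apply: (le_lt_trans (ler_norm _)).
          by have := archi_boundP (normr_ge0 (coord z j)); rewrite /Num.bound/= normr_id.
        by rewrite ler_nat (leq_bigmax j).
      by exists n => // j; case: eqP => [->//|_]; exact: zn.
    by move=> [n _ /(_ k)]; rewrite eqxx in_itv.
  by apply: bigcupT_measurable => n; apply: sub_sigma_algebra; eexists.
have mid : measurable_fun [set: S] (fun z : S => (z : pt)).
  apply/measurable_fun_pairP; split.
    move=> _ Y mY; have := mc ord0 measurableT Y mY; rewrite !setTI.
    by congr measurable; apply/seteqP; split=> z; rewrite /preimage/= coord0.
  apply: measurable_fun_rv => j.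
  by have := mc (lift ord0 j); under eq_fun do rewrite coord_lift.
by move=> A mA; have := mid measurableT A mA; rewrite setTI.
Qed.

End coordinates.

(** * Smooth functions, functions flat at 0, and bumps on boxes *)

Section directional.
Context (R : realType) (V : normedModType R).
Implicit Types (f g : V -> R) (x v : V).

(** Both sides have the same difference quotient; one-variable rules thereby apply to directional
    derivatives. *)
Lemma is_derive_line f x v (df : R) :
  is_derive (0 : R) (1 : R) (fun t : R => f (t *: v + x)) df <-> is_derive x v f df.
Proof.
have E : (fun h : R => h^-1 *: (((fun t : R => f (t *: v + x)) \o shift 0) (h *: 1)
            - f (0 *: v + x))) =
         (fun h : R => h^-1 *: ((f \o shift x) (h *: v) - f x)).
  by apply/funext => h /=; rewrite addr0 scale0r add0r [h *: 1]mulr1.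
by split=> -[H1 H2]; constructor; move: H1 H2; rewrite /derivable /derive E.
Qed.

Lemma CkS k f : Ck k.+1 f -> Ck k f.
Proof.
elim: k f => [|k IH] f; first by move=> [].
move=> [cf [df Df]]; split=> //; split=> // v; exact/IH/Df.
Qed.

Lemma Ck_cst k (c : R) : Ck k (fun _ : V => c).
Proof.
elim: k c => [|k IH] c; split=> //; [exact: cst_continuous|exact: cst_continuous|].
split=> [x v|v]; first exact: derivable_cst.
suff -> : (fun x => 'D_v (fun _ : V => c) x) = (fun _ : V => 0) by [].
by apply/funext => x; exact: derive_cst.
Qed.

Lemma CkD k f g : Ck k f -> Ck k g -> Ck k (fun x => f x + g x).
Proof.
elim: k f g => [|k IH] f g [cf df] [cg dg].
  by split=> // x; apply: continuousD; [exact: cf|exact: cg].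
split; first by move=> x; apply: continuousD; [exact: cf|exact: cg].
split=> [x v|v]; first by apply: derivableD; [exact: df.1|exact: dg.1].
suff -> : (fun x => 'D_v (fun x => f x + g x) x) = (fun x => 'D_v f x + 'D_v g x).
  by apply: IH; [exact: df.2|exact: dg.2].
by apply/funext => x; apply: deriveD; [exact: df.1|exact: dg.1].
Qed.

Lemma CkM k f g : Ck k f -> Ck k g -> Ck k (fun x => f x * g x).
Proof.
elim: k f g => [|k IH] f g Hf Hg.
  by split=> // x; apply: continuousM; [exact: Hf.1|exact: Hg.1].
have [[cf df] [cg dg]] := (Hf, Hg).
split; first by move=> x; apply: continuousM; [exact: cf|exact: cg].
split=> [x v|v]; first by apply: derivableM; [exact: df.1|exact: dg.1].
suff -> : (fun x => 'D_v (fun x => f x * g x) x) =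
    (fun x => f x * 'D_v g x + g x * 'D_v f x).
  apply: CkD; apply: IH; [exact: CkS|exact: dg.2|exact: CkS|exact: df.2].
by apply/funext => x; rewrite [LHS]deriveM//; [exact: df.1|exact: dg.1].
Qed.

Lemma smooth_cst (c : R) : smooth (fun _ : V => c).
Proof. by move=> k; exact: Ck_cst. Qed.

Lemma smoothD f g : smooth f -> smooth g -> smooth (fun x => f x + g x).
Proof. by move=> sf sg k; exact: CkD. Qed.

Lemma smoothM f g : smooth f -> smooth g -> smooth (fun x => f x * g x).
Proof. by move=> sf sg k; exact: CkM. Qed.

Lemma smoothX f n : smooth f -> smooth (fun x => f x ^+ n).
Proof.
move=> sf; elim: n => [|n IH]; first by under eq_fun do rewrite expr0; exact: smooth_cst.
by under eq_fun do rewrite exprS; exact: smoothM.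
Qed.

Lemma smooth_sum (I : Type) (r : seq I) (P : pred I) (F : I -> V -> R) :
  (forall i, P i -> smooth (F i)) -> smooth (fun x => \sum_(i <- r | P i) F i x).
Proof.
move=> sF; elim: r => [|i r IH].
  by under eq_fun do rewrite big_nil; exact: smooth_cst.
have [Pi|Pi] := boolP (P i); last by under eq_fun do rewrite big_cons (negbTE Pi).
by under eq_fun do rewrite big_cons Pi; apply: smoothD => //; exact: sF.
Qed.

Lemma smooth_prod (I : Type) (r : seq I) (P : pred I) (F : I -> V -> R) :
  (forall i, P i -> smooth (F i)) -> smooth (fun x => \prod_(i <- r | P i) F i x).
Proof.
move=> sF; elim: r => [|i r IH].
  by under eq_fun do rewrite big_nil; exact: smooth_cst.
have [Pi|Pi] := boolP (P i); last by under eq_fun do rewrite big_cons (negbTE Pi).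
by under eq_fun do rewrite big_cons Pi; apply: smoothM => //; exact: sF.
Qed.

Lemma smooth_continuous f : smooth f -> continuous f.
Proof. by move=> /(_ 0%N)[]. Qed.

Lemma smooth_derivable f x v : smooth f -> derivable f x v.
Proof. by move=> /(_ 1%N)[_ []]. Qed.

Lemma smooth_derive f v : smooth f -> smooth (fun x => 'D_v f x).
Proof. by move=> sf k; have [_ [_]] := sf k.+1; apply. Qed.

(** [l0] is the linear part of [l], hence its derivative in every direction at every point. *)
Definition affine (l : V -> R) (l0 : V -> R) :=
  continuous l /\ forall (t : R) v x, l (t *: v + x) = t * l0 v + l x.

Lemma affine_is_derive l l0 x v : affine l l0 -> is_derive x v l (l0 v).
Proof.
move=> [_ al]; apply/is_derive_line.
have -> : (fun t : R => l (t *: v + x)) = (fun t : R => t * l0 v + l x).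
  by apply/funext => t.
have dM : is_derive (0 : R) (1 : R) (fun t : R => t * l0 v) (0 *: 0 + l0 v *: 1).
  exact: (is_deriveM (is_derive_id (0 : R) 1) (is_derive_cst (l0 v) (0 : R) 1)).
apply: (is_derive_eq (is_deriveD dM (is_derive_cst (l x) (0 : R) 1))).
by rewrite scale0r add0r addr0 [LHS]mulr1.
Qed.

Lemma smooth_affine l l0 : affine l l0 -> smooth l.
Proof.
move=> al [|k]; split=> //; [exact: al.1|exact: al.1|].
split=> [x v|v]; first by have [] := affine_is_derive x v al.
suff -> : (fun x => 'D_v l x) = (fun=> l0 v) by exact: Ck_cst.
by apply/funext => x; apply: derive_val; exact: affine_is_derive.
Qed.

End directional.

Lemma is_derive_line_at (R : realType) (V : normedModType R) (f : V -> R) x v (t : R) (df : R) :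
  is_derive (t *: v + x) v f df -> is_derive t (1 : R) (fun t : R => f (t *: v + x)) df.
Proof.
move=> /is_derive_line H.
apply: (is_derive_line (fun t : R => f (t *: v + x)) t 1 df).1 => /=.
have -> : (fun s : R => f ((s *: (1 : R) + t) *: v + x)) =
    (fun s : R => f (s *: v + (t *: v + x))).
  by apply/funext => s; rewrite [s *: 1]mulr1 scalerDl addrA.
exact: H.
Qed.

Section flat_exponential.
Context (R : realType).

(* For k = 0 this is the classical smooth function flat at 0; the family over k is
   stable under differentiation up to linear combinations. *)
Definition flat_exp (k : nat) (x : R) : R :=
  if 0 < x then x^-1 ^+ k * expR (- x^-1) else 0.

Lemma flat_exp_ge0 k x : 0 <= flat_exp k x.
Proof.
rewrite /flat_exp; case: ifP => // x0; rewrite mulr_ge0 ?expR_ge0//.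
by rewrite exprn_ge0// invr_ge0 ltW.
Qed.

(** With y = 1/x, the exponential of y dominates its Taylor term of degree k+1, so y^k exp (-y) is
    at most (k+1)! / y. A linear bound is what the derivative at 0 requires. *)
Lemma flat_exp_le k x : flat_exp k x <= k.+1`!%:R * `|x|.
Proof.
rewrite /flat_exp; case: ifPn => [x0|_]; last by rewrite mulr_ge0.
rewrite expRN gtr0_norm// ler_pdivrMr ?expR_gt0//.
have xn := lt0r_neq0 x0.
have := @expR_ge1Dxn R x^-1 k; rewrite invr_ge0 (ltW x0) => /(_ isT) H.
have {}H : x^-1 ^+ k.+1 / k.+1`!%:R <= expR x^-1 by apply: le_trans H; rewrite lerDr.
apply: (@le_trans _ _ (k.+1`!%:R * x * (x^-1 ^+ k.+1 / k.+1`!%:R))); last first.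
  by rewrite ler_wpM2l// mulr_ge0// ltW.
rewrite le_eqVlt exprS; apply/orP; left; apply/eqP.
have fn : k.+1`!%:R != 0 :> R by rewrite pnatr_eq0 -lt0n fact_gt0.
by field; rewrite xn fn.
Qed.

Lemma flat_exp_is_derive k (x : R) :
  is_derive x (1 : R) (flat_exp k) (- k%:R * flat_exp k.+1 x + flat_exp k.+2 x).
Proof.
have [x0|x0|x0] := ltgtP 0 x; last rewrite -{x}x0.
- have xn := lt0r_neq0 x0.
  apply: (@near_eq_is_derive _ _ _ (fun y : R => y^-1 ^+ k * expR (- y^-1))).
    near=> y; rewrite /flat_exp ifT//; near: y.
    by apply: lt_nbhsr.
  have dV : is_derive x (1 : R) (fun y : R => y^-1) (- x ^- 2).
    apply: is_derive_eq; first by apply: is_deriveV.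
    by rewrite [_ *: _]mulr1.
  have dN : is_derive x (1 : R) (fun y : R => - y^-1) (x ^- 2).
    by rewrite -[x ^- 2]opprK; exact: (is_deriveN dV).
  have dE := is_derive1_comp (g := fun y : R => - y^-1) (is_derive_expR (- x^-1)) dN.
  have dX : is_derive x (1 : R) (fun y : R => y^-1 ^+ k) (k%:R * x^-1 ^+ k.-1 * - x ^- 2).
    by have := is_deriveX k dV; congr is_derive; apply/funext => y; rewrite exprfctE.
  apply: (is_derive_eq (is_deriveM dX dE)).
  rewrite /flat_exp x0 /= /GRing.scale/=.
  case: k dX => [|k] dX; first by rewrite /= !mul0r mulr0 oppr0 !expr0 !mul0r addr0 add0r mul1r -exprVn mulrC.
  by rewrite /= -!exprVn !exprS expr0; ring.
- rewrite /flat_exp !(ltNge 0 x) (ltW x0)/= mulr0 addr0.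
  apply: (@near_eq_is_derive _ _ _ (fun=> 0)) => //.
  near=> y; rewrite ifF//; apply/negbTE; rewrite -leNgt ltW//; near: y.
  exact: lt_nbhsl.
- rewrite /flat_exp ltxx mulr0 addr0.
  have lim0 : h^-1 *: ((flat_exp k \o shift 0) (h *: 1) - flat_exp k 0) @[h --> (0:R)^'] --> (0 : R).
    apply/cvgrPdist_le => e e0; near=> h.
    rewrite sub0r normrN /= addr0 [h *: 1]mulr1 [flat_exp k 0]/flat_exp ltxx subr0.
    have hn : h != 0 by near: h; exact: nbhs_dnbhs_neq.
    (* The difference quotient at 0 is the next member of the family, to which the linear bound
       applies. *)
    have -> : h^-1 *: flat_exp k h = flat_exp k.+1 h.
      by rewrite /flat_exp; case: ifP => _; rewrite ?scaler0// exprS [_ *: _]mulrA.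
    rewrite ger0_norm ?flat_exp_ge0//; apply: (le_trans (flat_exp_le _ _)).
    have c0 : 0 < k.+2`!%:R :> R by rewrite ltr0n fact_gt0.
    rewrite -ler_pdivlMl// mulrC; apply: ltW; near: h.
    apply: dnbhs0_lt; exact: divr_gt0.
  by constructor; [apply/cvg_ex; exists 0|exact: cvg_lim lim0].
Unshelve. all: by end_near. Qed.

Lemma flat_exp_continuous k : continuous (flat_exp k).
Proof.
move=> x; apply: differentiable_continuous; apply/derivable1_diffP.
by have [] := flat_exp_is_derive k x.
Qed.

Lemma flat_exp_gt0 k x : 0 < x -> 0 < flat_exp k x.
Proof. by move=> x0; rewrite /flat_exp x0 mulr_gt0 ?expR_gt0// exprn_gt0// invr_gt0. Qed.

Lemma flat_exp0_le1 x : flat_exp 0 x <= 1.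
Proof.
rewrite /flat_exp; case: ifP => // x0; rewrite mul1r -expR0 ler_expR oppr_le0.
by rewrite invr_ge0 ltW.
Qed.

Lemma flat_exp_le0 k x : x <= 0 -> flat_exp k x = 0.
Proof. by rewrite /flat_exp leNgt; case: ifP. Qed.

Lemma flat_exp_cvg1 x : 0 < x -> flat_exp 0 (n.+1%:R * x) @[n --> \oo] --> (1 : R).
Proof.
move=> x0; rewrite -[X in _ --> X](@expR0 R).
have -> : (fun n => flat_exp 0 (n.+1%:R * x)) = (fun n => expR (- (n.+1%:R^-1 * x^-1))).
  apply/funext => n; rewrite /flat_exp mulr_gt0// mul1r invfM//.
apply: (continuous_cvg _ (@continuous_expR R 0)).
rewrite -[X in _ --> X]oppr0 -(mul0r (x^-1)); apply: cvgN; apply: cvgMr_tmp.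
exact: cvg_harmonic.
Qed.

Lemma smooth_flat_exp_affine (V : normedModType R) (l l0 : V -> R) k :
  affine l l0 -> smooth (fun x => flat_exp k (l x)).
Proof.
move=> al j.
have cf i : continuous (fun x => flat_exp i (l x)).
  by move=> x; apply: continuous_comp; [exact: al.1|exact: flat_exp_continuous].
elim: j k => [|j IH] k; split=> //.
have D x v : is_derive x v (fun x => flat_exp k (l x))
    (l0 v * (- k%:R * flat_exp k.+1 (l x) + flat_exp k.+2 (l x))).
  apply/is_derive_line.
  have dl : is_derive (0 : R) (1 : R) (fun t : R => l (t *: v + x)) (l0 v).
    by apply/is_derive_line; exact: affine_is_derive.
  have := is_derive1_comp (f := flat_exp k) (g := fun t : R => l (t *: v + x)) (x := 0).
  move=> /(_ _ _ (flat_exp_is_derive _ _) dl).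
  by rewrite /= scale0r add0r mulrC.
split=> [x v|v]; first by have [] := D x v.
suff -> : (fun x => 'D_v (fun x => flat_exp k (l x)) x) =
    (fun x => l0 v * (- k%:R * flat_exp k.+1 (l x) + flat_exp k.+2 (l x))).
  apply: CkM; first exact: Ck_cst.
  by apply: CkD; [apply: CkM; [exact: Ck_cst|exact: IH]|exact: IH].
by apply/funext => x; by have [_ ->] := D x v.
Qed.

End flat_exponential.

Section bumps.
Context (R : realType) (d : nat).
Notation pt := (R * 'rV[R]_d)%type.
Notation ptM := (measurableTypeR R * 'rV[R]_d)%type.
Notation mu := (mu_tx R d).
Implicit Types (z y : pt) (a b : 'I_d.+1 -> R) (D : set pt).

Lemma coord_affine k : affine (fun z : pt => coord z k) (fun z => coord z k).
Proof.
split.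
- case: (unliftP ord0 k) => [j|] ->.
  + rewrite (_ : (fun _ => _) = (fun x : 'rV[R]_d => x ord0 j) \o (snd : pt -> _)).
      by move=> z; apply: continuous_comp; [exact: cvg_snd|exact: coord_continuous].
    by apply/funext => z; rewrite coord_lift.
  + by under eq_fun do rewrite coord0; move=> z; exact: cvg_fst.
- by move=> t v x; case: (unliftP ord0 k) => [j|] ->; rewrite ?coord0 ?coord_lift//= !mxE.
Qed.

Lemma continuous_coord k : continuous (fun z : pt => coord z k).
Proof. by have [] := coord_affine k. Qed.

Lemma smooth_coord k : smooth (fun z : pt => coord z k).
Proof. exact: smooth_affine (coord_affine k). Qed.

(** A smooth substitute for the indicator of the open box: values in [0, 1], zero outside the box,
    and convergence to 1 at each point inside as [n] grows. *)
Definition bump (n : nat) a b (z : pt) : R :=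
  \prod_k (flat_exp 0 (n.+1%:R * (coord z k - a k)) *
           flat_exp 0 (n.+1%:R * (b k - coord z k))).

Lemma smooth_bump n a b : smooth (bump n a b).
Proof.
apply: smooth_prod => k _; apply: smoothM.
- apply: (@smooth_flat_exp_affine _ _ _ (fun v => n.+1%:R * coord v k)); split.
    move=> z; apply: cvgM; first exact: cvg_cst.
    by apply: cvgB; [exact: continuous_coord|exact: cvg_cst].
  by move=> t v x; rewrite (coord_affine k).2; ring.
- apply: (@smooth_flat_exp_affine _ _ _ (fun v => - (n.+1%:R * coord v k))); split.
    move=> z; apply: cvgM; first exact: cvg_cst.
    by apply: cvgB; [exact: cvg_cst|exact: continuous_coord].
  by move=> t v x; rewrite (coord_affine k).2; ring.
Qed.

Lemma bump_ge0 n a b z : 0 <= bump n a b z.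
Proof. by apply: prodr_ge0 => k _; rewrite mulr_ge0 ?flat_exp_ge0. Qed.

Lemma bump_le1 n a b z : bump n a b z <= 1.
Proof.
apply: prodr_ile1 => k _.
by rewrite mulr_ge0 ?flat_exp_ge0//= mulr_ile1 ?flat_exp_ge0 ?flat_exp0_le1.
Qed.

Lemma bump_out n a b z : ~ obox a b z -> bump n a b z = 0.
Proof.
move=> /existsNP[k /negP]; rewrite negb_and -!leNgt => H.
rewrite /bump (bigD1 k)//=; apply/eqP; rewrite mulf_eq0 mulf_eq0.
have n0 : (0 : R) <= n.+1%:R by exact: ler0n.
case/orP : H => H.
  by rewrite (@flat_exp_le0 _ _ (_ * (_ - a k))) ?eqxx// mulr_ge0_le0// subr_le0.
by rewrite (@flat_exp_le0 _ _ (_ * (b k - _))) ?eqxx ?orbT// mulr_ge0_le0// subr_le0.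
Qed.

Lemma bump_cvg1 a b z : obox a b z -> bump n a b z @[n --> \oo] --> (1 : R).
Proof.
move=> zab; rewrite /bump.
suff : \prod_k (flat_exp 0 (n.+1%:R * (coord z k - a k)) *
    flat_exp 0 (n.+1%:R * (b k - coord z k))) @[n --> \oo] -->
    \prod_(k : 'I_d.+1) (1 : R) by rewrite big1_eq.
elim: (index_enum 'I_d.+1) => [|k r IH].
  by rewrite big_nil; under eq_fun do rewrite big_nil; exact: cvg_cst.
rewrite big_cons; under eq_fun do rewrite big_cons.
have /andP[az zb] := zab k.
apply: cvgM => //; rewrite -[X in _ --> X]mulr1.
by apply: cvgM; apply: flat_exp_cvg1; rewrite subr_gt0.
Qed.

Lemma cbox_compact a b : compact (cbox a b).
Proof.
pose P (j : 'I_d) : set R := `[a (lift ord0 j), b (lift ord0 j)]%classic.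
rewrite (_ : cbox a b = `[a ord0, b ord0]%classic `*`
    [set v : 'rV[R]_d | forall j, P j (v ord0 j)]).
  apply: compact_setX; first exact: segment_compact.
  by apply: rV_compact => j; exact: segment_compact.
apply/seteqP; split=> z.
  move=> H; split=> [|j]; rewrite /P/= in_itv/=.
    by have := H ord0; rewrite coord0.
  by have := H (lift ord0 j); rewrite coord_lift.
move=> [/= H1 H2] k; case: (unliftP ord0 k) => [j|] ->.
  by have := H2 j; rewrite /P/= in_itv/= coord_lift.
by rewrite coord0; move: H1; rewrite in_itv.
Qed.

Lemma cbox_closed a b : closed (cbox a b).
Proof. by apply: compact_closed; [exact: norm_hausdorff|exact: cbox_compact]. Qed.

Lemma csupp_bump n a b : csupp (bump n a b) `<=` cbox a b.
Proof.
rewrite ((closure_id (cbox a b)).1 (@cbox_closed a b)).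
apply: closure_subset => z /eqP; apply: contra_notP => H.
by apply: bump_out => ?; apply: H; exact: obox_cbox.
Qed.

Lemma test_bump D n a b : cbox a b `<=` D -> test_fun D (bump n a b).
Proof.
move=> abD; split; first exact: smooth_bump.
  apply: subclosed_compact; [exact: closed_closure|exact: (cbox_compact (a := a) (b := b))|].
  exact: csupp_bump.
by apply: subset_trans abD; exact: csupp_bump.
Qed.

Lemma smooth_measurable (f : pt -> R) : smooth f -> measurable_fun [set: ptM] f.
Proof. by move=> /smooth_continuous; exact: continuous_measurable_pt. Qed.

End bumps.

(** * Measures of boxes and hyperplanes *)

Section box_measure.
Context (R : realType).

Definition rv_obox n (a b : 'I_n -> R) : set 'rV[R]_n :=
  [set x | forall j, a j < x ord0 j < b j].

Lemma measurable_rv_obox n (a b : 'I_n -> R) : measurable (rv_obox a b).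
Proof.
rewrite (_ : rv_obox a b =
    \bigcap_(k in [set` index_enum 'I_n]) ((fun x : 'rV[R]_n => x ord0 k) @^-1` `]a k, b k[%classic)).
  rewrite bigcap_seq; apply: bigsetI_measurable => k _.
  by rewrite -[X in measurable X]setTI; exact: measurable_rv_coord.
apply/seteqP; split=> x H k.
  by move=> _; have := H k; rewrite /= in_itv.
by have := H k (mem_index_enum _); rewrite /= in_itv.
Qed.

Lemma oboxE d (a b : 'I_d.+1 -> R) : obox a b = (`]a ord0, b ord0[%classic : set R) `*`
  rv_obox (fun j => a (lift ord0 j)) (fun j => b (lift ord0 j)).
Proof.
apply/seteqP; split=> z.
  move=> H; split=> [|j] /=; first by have := H ord0; rewrite coord0 in_itv.
  by have := H (lift ord0 j); rewrite coord_lift.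
move=> [/= H1 H2] k; case: (unliftP ord0 k) => [j|] ->.
  by have := H2 j; rewrite coord_lift.
by rewrite coord0; move: H1; rewrite in_itv.
Qed.

Lemma lebesgue_measure_itvoo (a b : R) : exists r : R,
  [/\ lebesgue_measure `]a, b[%classic = r%:E, 0 <= r & (a < b -> 0 < r)].
Proof.
rewrite lebesgue_measure_itv/= lte_fin; case: ifPn => ab.
  by exists (b - a); split; rewrite ?subr_ge0 ?subr_gt0// ltW.
by exists 0; split=> //; rewrite (negbTE ab).
Qed.

Lemma mu_x_rv_obox n (a b : 'I_n -> R) : exists r : R,
  [/\ mu_x R n (rv_obox a b) = r%:E, 0 <= r & ((forall j, a j < b j) -> 0 < r)].
Proof.
elim: n a b => [|n IH] a b.
  exists 1; split=> //; by rewrite /mu_x/= diracE mem_set// => -[].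
have [r1 [E1 r10 r1p]] := lebesgue_measure_itvoo (a ord0) (b ord0).
have [r2 [E2 r20 r2p]] := IH (fun j => a (lift ord0 j)) (fun j => b (lift ord0 j)).
exists (r1 * r2); split; [|exact: mulr_ge0|by move=> H; rewrite mulr_gt0 ?r1p ?r2p].
rewrite EFinM -E1 -E2 /mu_x/= /lebesgue_rvS /pushforward.
rewrite (_ : _ @^-1` _ = (`]a ord0, b ord0[%classic : set (measurableTypeR R)) `*`
  rv_obox (fun j => a (lift ord0 j)) (fun j => b (lift ord0 j))).
  by rewrite [LHS]product_measure1E//; exact: measurable_rv_obox.
by rewrite -oboxE.
Qed.

Lemma mu_tx_obox d (a b : 'I_d.+1 -> R) : exists r : R,
  [/\ mu_tx R d (obox a b) = r%:E, 0 <= r & ((forall j, a j < b j) -> 0 < r)].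
Proof.
have [r1 [E1 r10 r1p]] := lebesgue_measure_itvoo (a ord0) (b ord0).
have [r2 [E2 r20 r2p]] := mu_x_rv_obox (fun j => a (lift ord0 j)) (fun j => b (lift ord0 j)).
exists (r1 * r2); split; [|exact: mulr_ge0|by move=> H; rewrite mulr_gt0 ?r1p ?r2p].
rewrite oboxE EFinM -E1 -E2.
by rewrite [LHS]product_measure1E//; exact: measurable_rv_obox.
Qed.

(** Induction on the dimension by Fubini. If only the first entry of [a] is nonzero, the set is a
    point times the whole space; otherwise each slice is a hyperplane of lower dimension. *)
Lemma mu_x_hyperplane n (a : 'rV[R]_n) (c : R) : a != 0 ->
  mu_x R n [set x | dotv a x = c] = 0%E.
Proof.
elim: n a c => [|n IH] a c; first by rewrite thinmx0 eqxx.
move=> a0; rewrite /mu_x/= /lebesgue_rvS /pushforward.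
pose a' : 'rV_n := \row_j a ord0 (lift ord0 j).
have dotE (z : R * 'rV[R]_n) : dotv a (rvcons z) = a ord0 ord0 * z.1 + dotv a' z.2.
  rewrite /dotv big_ord_recl -[rvcons z ord0 ord0]/(coord z ord0) coord0; congr (_ + _).
  by apply: eq_bigr => j _; rewrite -[rvcons z _ _]/(coord z _) coord_lift mxE.
rewrite (_ : _ @^-1` _ = [set z | a ord0 ord0 * z.1 + dotv a' z.2 = c]); last first.
  by apply/seteqP; split=> z /=; rewrite dotE.
have [a'0|a'n0] := eqVneq a' 0.
  have a00 : a ord0 ord0 != 0.
    apply: contraNneq a0 => a00; apply/eqP/rowP => j; rewrite mxE.
    case: (unliftP ord0 j) => [k|] ->//.
    by have /rowP/(_ k) := a'0; rewrite !mxE.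
  rewrite (_ : [set _ | _] = ([set c / a ord0 ord0] : set (measurableTypeR R)) `*` setT); last first.
    have d0 x : dotv a' x = 0 by rewrite a'0 /dotv big1// => i _; rewrite mxE mul0r.
    apply/seteqP; split=> z /=; rewrite d0 addr0.
      by move=> <-; split=> //; rewrite /= mulrC mulKf.
    by move=> [-> _]; rewrite mulrC divfK.
  rewrite [LHS]product_measure1E// -[RHS](mul0e (lebesgue_rv R n setT)).
  by congr (_ * _)%E; exact: lebesgue_measure_set1.
rewrite /product_measure1 /= integral0_eq// => t _ /=.
rewrite -[RHS](IH a' (c - a ord0 ord0 * t) a'n0); congr (_ _).
apply/seteqP; split=> x; rewrite /xsection/= inE/=.
  by move=> <-; rewrite addrC addKr.
by move=> ->; rewrite addrC subrK.
Qed.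

End box_measure.

(** * The fundamental lemma of the calculus of variations in space-time *)

Section fundamental_lemma.
Context (R : realType) (d : nat).
Notation pt := (R * 'rV[R]_d)%type.
Notation ptM := (measurableTypeR R * 'rV[R]_d)%type.
Notation mu := (mu_tx R d).
Implicit Types (z y : pt) (a b : 'I_d.+1 -> R) (D : set pt).

Lemma obox_lty a b : (mu (obox a b) < +oo)%E.
Proof. by have [r [-> _ _]] := mu_tx_obox a b; rewrite ltry. Qed.

Lemma inL2_obox_integrable (g : ptM -> R) a b : inL2 mu (obox a b) g ->
  mu.-integrable (obox a b) (fun z => (g z)%:E).
Proof.
move=> gB; have mB : measurable (obox a b : set ptM) := measurable_obox a b.
have oneB : inL2 mu (obox a b) (fun=> 1).
  apply: (@inL2_bounded _ _ _ _ _ _ 1) => //; first exact: obox_lty.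
  by move=> z _; rewrite normr1.
by have := inL2_mul_integrable mB gB oneB; under eq_fun do rewrite mulr1.
Qed.

(** The bumps converge to 1 on the box and are at most 1, so dominated convergence with majorant
    [|g|] carries the vanishing products over to [g] itself. *)
Lemma bump_integral0 (g : ptM -> R) D a b : open D -> inL2 mu D g ->
  cbox a b `<=` D -> (forall n, ip mu D g (bump n a b) = 0) ->
  (\int[mu]_(z in obox a b) (g z)%:E = 0)%E.
Proof.
move=> oD gD abD H.
have mD : measurable (D : set ptM) by exact: open_measurable_pt.
have mB : measurable (obox a b : set ptM) := measurable_obox a b.
have BD : obox a b `<=` D by move=> z /obox_cbox /abD.
have gB : inL2 mu (obox a b) g := inL2_subset mD mB BD gD.
have iB := inL2_obox_integrable gB.
have mg : measurable_fun (obox a b : set ptM) g := inL2_measurable mB gB.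
have mbump n : measurable_fun (obox a b : set ptM) (bump n a b).
  by apply: measurable_funTS; apply: smooth_measurable; exact: smooth_bump.
have bump1 n z : `|bump n a b z| <= 1 by rewrite ger0_norm ?bump_ge0 ?bump_le1.
have [_ _] : [/\ mu.-integrable (obox a b) (fun z => (g z)%:E),
   ([sequence \int[mu]_(x in obox a b) `| (g x * bump n a b x)%:E - (g x)%:E |]_n @ \oo --> 0)%E &
   ([sequence \int[mu]_(x in obox a b) ((g x * bump n a b x)%:E) ]_n @ \oo -->
     \int[mu]_(x in obox a b) (g x)%:E)%E].
  apply: (@dominated_convergence _ _ _ mu _ mB
    (fun n z => (g z * bump n a b z)%:E) _ (fun z => `|(g z)%:E|%E)).
  - by move=> n; apply/measurable_EFinP; exact: measurable_funM.
  - exact/measurable_EFinP.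
  - apply: aeW => z zB; apply: cvg_EFin; first by near=> n.
    rewrite -[X in _ --> X]mulr1; apply: cvgMl_tmp; exact: bump_cvg1.
  - exact: integrable_abse.
  - apply: aeW => z n zB; rewrite lee_fin normrM ler_piMr//.
have -> : [sequence (\int[mu]_(x in obox a b) (g x * bump n a b x)%:E)%E]_n = (fun=> 0%E).
  apply/funext => n /=.
  have gbD : mu.-integrable D (fun z => (g z * bump n a b z)%:E).
    apply: inL2_mul_integrable => //.
    apply/(inL2P _ _ mD); split.
      by apply: measurable_funTS; apply: smooth_measurable; exact: smooth_bump.
    apply/(integrable_mkcond _ mD).
    rewrite (_ : _ \_ _ = (fun z => (bump n a b z * bump n a b z)%:E) \_ (obox a b)).
      have bB : inL2 mu (obox a b) (bump n a b).
        by apply: (@inL2_bounded _ _ _ _ _ _ 1) => //; exact: obox_lty.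
      by apply/(integrable_mkcond _ mB); exact: (inL2_mul_integrable mB bB bB).
    apply/funext => z; rewrite !patchE; case: ifPn => [/set_mem zD|zD].
      by case: ifPn => // /negP zB; rewrite bump_out ?mul0r// => zB'; apply: zB; rewrite inE.
    by case: ifPn => // /set_mem/BD/mem_set zB; rewrite zB in zD.
  have -> : (\int[mu]_(x in obox a b) (g x * bump n a b x)%:E =
             \int[mu]_(x in D) (g x * bump n a b x)%:E)%E.
    rewrite [LHS]integral_mkcond [RHS]integral_mkcond; congr integral.
    apply/funext => z; rewrite !patchE; case: ifPn => [/set_mem/BD/mem_set -> //|zB].
    case: ifPn => // _; rewrite bump_out ?mulr0// => zB'; move/negP: zB; apply.
    exact/mem_set.
  have fin := integrable_fin_num mD gbD.
  by rewrite -(fineK fin) -[fine _]/(ip mu D g (bump n a b)) H.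
by move=> /(cvg_unique _ (@cvg_cst _ 0%E nat \oo _)) <-.
Unshelve. all: by end_near. Qed.

(** A box cut by a ray is again a box, so the integral of [g] vanishes over these pieces; Dynkin's
    theorem extends this to all measurable parts of the box, where [g] is therefore null. Countably
    many such boxes cover [D]. *)
Lemma fundamental_lemma (g : ptM -> R) D : open D -> inL2 mu D g ->
  (forall n a b, cbox a b `<=` D -> ip mu D g (bump n a b) = 0) ->
  ae_eq mu D g (fun=> 0).
Proof.
move=> oD gD H.
have mD : measurable (D : set ptM) by exact: open_measurable_pt.
have local0 a b : cbox a b `<=` D -> ae_eq mu (obox a b) g (fun=> 0).
  move=> abD; have BD : obox a b `<=` D by move=> z /obox_cbox /abD.
  have mB : measurable (obox a b : set ptM) := measurable_obox a b.
  have gB : inL2 mu (obox a b) g := inL2_subset mD mB BD gD.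
  have iB := inL2_obox_integrable gB.
  suff K : forall A : set ptM, measurable A -> (\int[mu]_(z in obox a b `&` A) (g z)%:E = 0)%E.
    have : ae_eq mu (obox a b) (fun z => (g z)%:E) (fun z => 0%:E).
      apply: (integral_ae_eq mB iB) => // E EB mE.
      by rewrite integral0 -(setIidr EB) K.
    by apply: filterS => z Hz zB; have [] := Hz zB.
  move=> A; rewrite measurable_ray_generated.
  have iS S : measurable S -> mu.-integrable (obox a b `&` S) (fun z => (g z)%:E).
    by move=> mS; apply: integrableS iB => //; exact: measurableI.
  apply: (dynkin_induction (@measurable_ray_generated R d)
      (P := fun A => (\int[mu]_(z in obox a b `&` A) (g z)%:E = 0)%E)).
  - move=> _ _ [b1 _ <-] [b2 _ <-]; exists (fun k => Num.min (b1 k) (b2 k)) => //.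
    apply/seteqP; split=> z.
      by move=> zb; split=> k; have := zb k; rewrite lt_min => /andP[].
    by move=> [z1 z2] k; rewrite lt_min z1 z2.
  - by rewrite setIT; apply: (bump_integral0 oD gD abD) => n; exact: H.
  - move=> _ [b1 _ <-] /=.
    rewrite (_ : _ `&` _ = obox a (fun k => Num.min (b k) (b1 k))); last first.
      apply/seteqP; split=> z.
        by move=> [zab zb] k; rewrite lt_min zb; have /andP[-> ->] := zab k.
      by move=> zab; split=> k; have := zab k; rewrite lt_min => /and3P[? ? ?]; rewrite ?andbT; first [by apply/andP|by []].
    have sub : cbox a (fun k => Num.min (b k) (b1 k)) `<=` D.
      apply: subset_trans abD => z zab k; have /andP[-> /=] := zab k.
      by rewrite le_min => /andP[].
    by apply: (bump_integral0 oD gD sub) => n; exact: H.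
  - move=> S mS S0.
    have := bump_integral0 oD gD abD (fun n => H n _ _ abD).
    rewrite -[X in (\int[_]_(z in X) _)%E](setIT (obox a b)) -(setUv S) setIUr.
    rewrite integral_setU//.
    + by rewrite [X in (X + _)%E]S0 add0e.
    + exact: measurableI.
    + by apply: measurableI => //; exact: measurableC.
    + by rewrite -setIUr setUv setIT; exact: measurable_int iB.
    + by apply/eqP; rewrite setIACA setICr setI0.
  - move=> F mF tF F0; rewrite setI_bigcupr.
    have tF' : trivIset setT (fun i => obox a b `&` F i).
      exact: (@trivIset_setIl _ _ setT F (fun=> obox a b) tF).
    have mF' i : measurable (obox a b `&` F i : set ptM) by exact: (measurableI _ _ mB (mF i)).
    have iU : mu.-integrable (\bigcup_i (obox a b `&` F i)) (fun z => (g z)%:E).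
      by rewrite -setI_bigcupr; apply: iS; exact: bigcupT_measurable.
    apply: (etrans (@integral_bigcup _ ptM R mu (fun i => obox a b `&` F i) (fun z => (g z)%:E) tF' mF' iU)).
    by rewrite eseries0// => i _ _; exact: F0.
have : \forall x \ae mu, forall n, (fun x : ptM => countable_cover D n x -> g x = 0) x.
  apply: ae_foralln => n; rewrite /countable_cover; case: unpickle => [i|].
    by case: asboolP => [/local0//|_]; exact: aeW.
  exact: aeW.
apply: filterS => z Hz; rewrite (open_bigcup_rat_box oD) => -[n _]; exact: Hz.
Qed.

End fundamental_lemma.

(** * Fubini's theorem on space-time cylinders *)

Section fubini_cylinder.
Context (R : realType) (d : nat).
Notation TR := (measurableTypeR R).
Notation ptM := (measurableTypeR R * 'rV[R]_d)%type.
Notation mu := (mu_tx R d).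
Notation leb := (@lebesgue_measure R).
Context (I : set TR) (W : set 'rV[R]_d).
Hypotheses (mI : measurable I) (mW : measurable W).
Implicit Types f g : ptM -> R.

Lemma measurable_cylinder : measurable (I `*` W : set ptM).
Proof. exact: measurableX. Qed.

Let restrictE f t x : ((fun z => (f z)%:E) \_ (I `*` W)) (t, x) =
  if t \in I then ((fun x => (f (t, x))%:E) \_ W) x else 0%E.
Proof. by rewrite !patchE in_setX/=; case: (t \in I). Qed.

(** Fubini for the extension of [f] by zero. The inner integral is finite for almost every time
    only, which is enough to replace it by its real part. *)
Lemma cylinder_fubini f : mu.-integrable (I `*` W) (fun z => (f z)%:E) ->
  [/\ {ae leb, forall t, I t -> (mu_x R d).-integrable W (fun x => (f (t, x))%:E)},
    leb.-integrable I (fun t => (\int[mu_x R d]_(x in W) f (t, x))%:E) &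
    \int[mu]_(z in I `*` W) f z =
    \int[leb]_(t in I) \int[mu_x R d]_(x in W) f (t, x)].
Proof.
move=> fi; have /(integrable_mkcond _ measurable_cylinder) fT := fi.
have a1 := @ae_integrable1 _ _ _ _ _ leb (lebesgue_rv R d) _ fT.
have iF := @integrable_fubini_F _ _ _ _ _ leb (lebesgue_rv R d) _ fT.
have eF := @integral12_prod_meas1 _ _ _ _ _ leb (lebesgue_rv R d) _ fT.
have FE t : fubini_F (lebesgue_rv R d) ((fun z => (f z)%:E) \_ (I `*` W)) t =
    ((fun t => \int[mu_x R d]_(x in W) (f (t, x))%:E)%E \_ I) t.
  rewrite /fubini_F patchE.
  under eq_integral do rewrite restrictE.
  by case: (t \in I); [rewrite [RHS]integral_mkcond|rewrite integral0].
have aei : {ae leb, forall t, I t -> (mu_x R d).-integrable W (fun x => (f (t, x))%:E)}.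
  apply: filterS a1 => t Ht It; apply/(integrable_mkcond _ mW).
  move: Ht; congr (_.-integrable _ _); apply/funext => x.
  by rewrite restrictE mem_set.
pose G := fun t => (\int[mu_x R d]_(x in W) (f (t, x))%:E)%E.
have iG : leb.-integrable I G.
  apply/(integrable_mkcond _ mI); move: iF; congr (_.-integrable _ _).
  by apply/funext => t; rewrite FE.
have aeG : ae_eq leb I G (fun t => (fine (G t))%:E).
  apply: filterS aei => t Ht It; rewrite fineK//.
  by apply: integrable_fin_num => //; exact: Ht.
have mG : measurable_fun I (fun t => (fine (G t))%:E).
  apply/measurable_EFinP; apply: measurableT_comp; first exact: fine_measurable.
  exact: measurable_int iG.
split => //.
- move/integrableP : iG => [mG' GG]; apply/integrableP; split; first exact: mG.
  move: GG; congr (_ < _)%E; apply: ge0_ae_eq_integral => //.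
  + exact: measurableT_comp.
  + by apply: measurableT_comp.
  + by apply: filterS aeG => t Ht It; rewrite -Ht.
- rewrite /Rintegral [in LHS]integral_mkcond -eF; congr fine.
  rewrite (_ : fubini_F _ _ = G \_ I); last by apply/funext => t; rewrite FE.
  rewrite -integral_mkcond; apply: ae_eq_integral => //.
  exact: measurable_int iG.
Qed.

Lemma cylinder_integral_eq f g : mu.-integrable (I `*` W) (fun z => (f z)%:E) ->
  mu.-integrable (I `*` W) (fun z => (g z)%:E) ->
  {ae leb, forall t, I t -> \int[mu_x R d]_(x in W) f (t, x) = \int[mu_x R d]_(x in W) g (t, x)} ->
  \int[mu]_(z in I `*` W) f z = \int[mu]_(z in I `*` W) g z.
Proof.
move=> fi gi fg; have [_ F1 F2] := cylinder_fubini fi; have [_ G1 G2] := cylinder_fubini gi.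
rewrite F2 G2 /Rintegral; congr fine; apply: ae_eq_integral => //.
- exact: measurable_int F1.
- exact: measurable_int G1.
- by apply: filterS fg => t Ht It; congr (_%:E); exact: Ht.
Qed.

(** The measures of the sections of a null set integrate to 0, so almost every section is null. *)
Lemma cylinder_ae (P : ptM -> Prop) : {ae mu, forall z, (I `*` W) z -> P z} ->
  {ae leb, forall t, I t -> {ae mu_x R d, forall x, W x -> P (t, x)}}.
Proof.
move=> [A [mA A0 PA]].
have ms := @measurable_fun_xsection _ _ _ _ R (lebesgue_rv R d) _ mA.
have /(ae_eq_integral_abs leb measurableT ms) : (\int[leb]_t `|((lebesgue_rv R d) \o xsection A) t| = 0)%E.
  by rewrite -[RHS]A0; apply: eq_integral => t _; rewrite gee0_abs.
apply: filterS => t /= /(_ Logic.I) At It; exists (xsection A t); split=> //.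
  exact: measurable_xsection.
move=> x /= /not_implyP[Wx nP]; rewrite /xsection/= inE; apply: PA => /= H.
exact/nP/H.
Qed.

Lemma cylinder_inL2 f : inL2 mu (I `*` W) f ->
  {ae leb, forall t, I t -> inL2 (mu_x R d) W (fun x => f (t, x))}.
Proof.
move=> fD; have [mf ff] := (inL2P _ _ measurable_cylinder).1 fD.
have [H _ _] := cylinder_fubini ff.
apply: filterS H => t Ht It; apply/(inL2P _ _ mW); split; last exact: Ht.
move=> _ Y mY; have := measurable_xsection t (mf measurable_cylinder Y mY).
congr measurable; apply/seteqP; split=> x; rewrite /xsection/= inE/=.
  by move=> [[]].
by move=> [Wx fY]; split.
Qed.

End fubini_cylinder.

(** * Integration by parts against test functions *)

Section partial_integral.
Context (R : realType).
Notation leb := (@lebesgue_measure R).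

(** The fundamental theorem on an interval with [h] zero at both ends; [L] exceeds [M] for this and
    is positive so that the interval is proper. *)
Lemma integral_derive_line (h h' : R -> R) (M : R) :
  (forall t : R, is_derive t (1 : R) h (h' t)) -> continuous h' ->
  (forall t, M < `|t| -> h t = 0) ->
  (\int[leb]_t (h' t)%:E = 0)%E.
Proof.
move=> dh ch' h0; have [L ML L0] : exists2 L : R, M < L & 0 < L.
  exists (`|M| + 1); last by rewrite ltr_wpDl.
  by apply: (le_lt_trans (ler_norm M)); rewrite ltrDl.
have ch : continuous h.
  by move=> t; apply: differentiable_continuous; apply/derivable1_diffP; have [] := dh t.
have h'0 t : L < `|t| -> h' t = 0.
  move=> Lt; have [_ <-] := dh t.
  have : \forall s \near t, M < `|s|.
    have := @cvgr_norm_gt _ _ _ (nbhs t) _ id t (@cvg_id _ (nbhs t)).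
    by move=> /(_ _ M); apply; exact: lt_trans ML Lt.
  move=> Mt; have : is_derive t (1 : R) h 0.
    apply: (@near_eq_is_derive _ _ _ (fun=> 0)) => //.
    by apply: filterS Mt => s Ms; rewrite h0.
  by move=> [_ ->].
have LL : - L < L by rewrite gtrN.
have FTC : (\int[leb]_(t in `[(- L)%R, L]) (h' t)%:E = (h L)%:E - (h (- L))%:E)%E.
  apply: (@continuous_FTC2 R h' h (- L) L LL).
  - by apply: continuous_subspaceT.
  - split; first by move=> t _; have [] := dh t.
    + by apply: cvg_at_right_filter; exact: ch.
    + by apply: cvg_at_left_filter; exact: ch.
  - by move=> t _; rewrite derive1E; have [] := dh t.
rewrite !h0 ?normrN ?(gtr0_norm L0)// sube0 in FTC.
rewrite -[RHS]FTC [RHS]integral_mkcond; apply: eq_integral => t _; rewrite patchE.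
case: ifPn => // /negP tL; rewrite h'0// ltNge; apply/negP => tL'; apply: tL.
by rewrite inE/= in_itv/= -ler_norml.
Qed.

Lemma continuous_measurable_rv n (f : 'rV[R]_n -> R) :
  continuous f -> measurable_fun setT f.
Proof.
move=> cf; apply: (measurability _ (measurable_realfun.RGenOpens.measurableE R)).
move=> _ [_ [a [b ->]] <-]; rewrite setTI; apply: open_measurable_rv.
by apply: open_comp => //; exact: interval_open.
Qed.

Lemma rvcons_lin n t (v x : R * 'rV[R]_n) :
  rvcons (t *: v + x) = t *: rvcons v + rvcons x.
Proof.
apply/rowP => k; rewrite [LHS](@coord_affine R _ k).2 [RHS]mxE.
by congr (_ + _); rewrite [RHS]mxE.
Qed.

Lemma continuous_rvcons n : continuous (@rvcons R n).
Proof.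
move=> z; apply/cvg_ballP => e e0.
apply: (filterS _ (nbhsx_ballx z e e0)) => y zy.
split=> // i j; rewrite (ord1 i); move: j; exact/(ball_coord _ _ e0).
Qed.

Lemma continuous_pairl n (x : 'rV[R]_n) : continuous (fun t : R => (t, x)).
Proof.
move=> t; apply/cvg_ballP => e e0.
by apply: (filterS _ (nbhsx_ballx t e e0)) => s ts; split=> //; exact: ballxx.
Qed.

Lemma continuous_pairr n (t : R) : continuous (fun x : 'rV[R]_n => (t, x)).
Proof.
move=> x; apply/(@cvg_ballP _ _ _ (nbhs x)) => e e0.
by apply/nbhs_ballP; exists e => // s ts; split=> //; exact: ballxx.
Qed.

Lemma continuous_bounded_cbox n (f : R * 'rV[R]_n -> R) a b :
  continuous f -> exists C, forall z, cbox a b z -> `|f z| <= C.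
Proof.
move=> cf; have /compact_bounded[C [_ HC]] : compact (f @` cbox a b).
  by apply: continuous_compact; [exact: continuous_subspaceT|exact: cbox_compact].
by exists (C + 1) => z zab; apply: (HC (C + 1)); rewrite ?ltrDl//; exists z.
Qed.

Definition bounded_support n (f : R * 'rV[R]_n -> R) :=
  exists M, forall z, ~ cbox (fun=> - M) (fun=> M) z -> f z = 0.

Lemma is_derive_out n (f f' : R * 'rV[R]_n -> R) e M :
  (forall z, is_derive z e f (f' z)) ->
  (forall z, ~ cbox (fun=> - M) (fun=> M) z -> f z = 0) ->
  forall z, ~ cbox (fun=> - M) (fun=> M) z -> f' z = 0.
Proof.
move=> df f0 z zM; have [_ <-] := df z.
have : is_derive z e f 0.
  apply: (@near_eq_is_derive _ _ _ (fun=> 0)) => //.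
  have : open (~` cbox (fun _ : 'I_n.+1 => - M) (fun=> M)).
    by apply: closed_openC; exact: cbox_closed.
  by rewrite openE => /(_ z zM); apply: filterS => y yM; rewrite f0.
by move=> [_ ->].
Qed.

Lemma continuous_bounded_support_integrable n (f : R * 'rV[R]_n -> R) M :
  continuous f -> (forall z, ~ cbox (fun=> - M) (fun=> M) z -> f z = 0) ->
  (mu_tx R n).-integrable setT (fun z => (f z)%:E).
Proof.
move=> cf f0; pose a := fun _ : 'I_n.+1 => - (M + 1); pose b := fun _ : 'I_n.+1 => M + 1.
have sub : cbox (fun _ : 'I_n.+1 => - M) (fun=> M) `<=` obox a b.
  by move=> z H k; have := H k; rewrite /a /b; lra.
have mB : measurable (obox a b : set (measurableTypeR R * 'rV[R]_n)) := measurable_obox a b.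
have [C HC] := continuous_bounded_cbox a b cf.
have : (mu_tx R n).-integrable (obox a b) (fun z => (f z)%:E).
  apply: inL2_obox_integrable; apply: (@inL2_bounded _ _ _ _ _ _ C) => //.
  - exact: obox_lty.
  - by apply: measurable_funTS; exact: continuous_measurable_pt.
  - by move=> z /obox_cbox; exact: HC.
move/(integrable_mkcond _ mB); congr (_.-integrable _ _); apply/funext => z.
rewrite patchE; case: ifPn => // /negP zB; rewrite f0// => /sub zB'; apply: zB.
exact/mem_set.
Qed.

Let e_0 n : R * 'rV[R]_n := (1, 0).
Let e_S n (i : 'I_n) : R * 'rV[R]_n := (0, delta_mx ord0 i).

(** By Fubini, a time derivative integrates to 0 along each time line, and a spatial one on each
    time slice by the hypothesis in dimension [n]. *)
Lemma integral_derive_pt n :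
  (forall (i : 'I_n) (f f' : 'rV[R]_n -> R) M,
    (forall x, is_derive x (delta_mx ord0 i) f (f' x)) -> continuous f' ->
    (forall x : 'rV[R]_n, ~ (forall j, - M <= x ord0 j <= M) -> f x = 0) ->
    (\int[mu_x R n]_x (f' x)%:E = 0)%E) ->
  forall (e : R * 'rV[R]_n) (f f' : R * 'rV[R]_n -> R),
    e = e_0 n \/ (exists i, e = e_S i) ->
    (forall z, is_derive z e f (f' z)) -> continuous f' -> bounded_support f ->
    (\int[mu_tx R n]_z (f' z)%:E = 0)%E.
Proof.
move=> IH e f f' He df cf' [M f0].
have int := continuous_bounded_support_integrable cf' (is_derive_out df f0).
case: He => [He|[i He]]; subst e.
- rewrite -(@integral21_prod_meas1 _ _ _ _ _ leb (lebesgue_rv R n) _ int).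
  rewrite /fubini_G integral0_eq// => x _.
  apply: (@integral_derive_line (fun t => f (t, x)) (fun t => f' (t, x)) M).
  + move=> t; have := df (t *: (1, 0) + (0, x)).
    have E s : s *: ((1, 0) : R * 'rV[R]_n) + (0, x) = (s, x).
      by congr (_, _); rewrite /= ?scaler0 ?add0r// addr0 [LHS]mulr1.
    move=> /is_derive_line_at; rewrite E.
    by under [X in is_derive _ _ X]eq_fun do rewrite E.
  + move=> t; apply: (@continuous_comp _ _ _ (fun t : R => (t, x)) f'); last exact: cf'.
    exact: continuous_pairl.
  + move=> t tM; apply: f0 => /(_ ord0); rewrite coord0/= -ler_norml.
    by rewrite leNgt tM.
- rewrite -(@integral12_prod_meas1 _ _ _ _ _ leb (lebesgue_rv R n) _ int).
  rewrite /fubini_F integral0_eq// => t _.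
  apply: (IH i (fun x => f (t, x)) (fun x => f' (t, x)) M).
  + move=> x; apply/is_derive_line; have /is_derive_line := df (t, x).
    congr (is_derive _ _ _ _); apply/funext => s.
    by congr (f (_, _)); rewrite /= scaler0 add0r.
  + move=> x; apply: (@continuous_comp _ _ _ (fun x : 'rV[R]_n => (t, x)) f'); last exact: cf'.
    exact: continuous_pairr.
  + move=> x H; apply: f0 => H'; apply: H => j.
    by have := H' (lift ord0 j); rewrite coord_lift.
Qed.

(** Induction on the dimension: [rvcons] transports a function of n+1 variables to one on R times
    R^n, where [integral_derive_pt] applies. *)
Lemma integral_derive_rv n (i : 'I_n) (f f' : 'rV[R]_n -> R) M :
  (forall x, is_derive x (delta_mx ord0 i) f (f' x)) -> continuous f' ->
  (forall x : 'rV[R]_n, ~ (forall j, - M <= x ord0 j <= M) -> f x = 0) ->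
  (\int[mu_x R n]_x (f' x)%:E = 0)%E.
Proof.
elim: n i f f' M => [[]//|n IH] i f f' M df cf' f0.
have cr := @continuous_rvcons n.
have cF : continuous (fun z => f' (@rvcons R n z)).
  by move=> z; apply: continuous_comp; [exact: cr|exact: cf'].
pose F z := f (@rvcons R n z).
have F0 z : ~ cbox (fun=> - M) (fun=> M) z -> F z = 0 by move=> zM; exact: f0.
have dF : exists2 e, (e = e_0 n \/ (exists i, e = e_S i)) & rvcons e = delta_mx ord0 i.
  case: (unliftP ord0 i) => [j|] ->.
    exists (e_S j); first by right; exists j.
    apply/rowP => k; rewrite -[LHS]/(coord _ k) !mxE eqxx/=.
    case: (unliftP ord0 k) => [l|] ->; last by rewrite coord0.
    by rewrite coord_lift !mxE (inj_eq lift_inj).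
  exists (e_0 n); first by left.
  apply/rowP => k; rewrite -[LHS]/(coord _ k) !mxE eqxx/=.
  case: (unliftP ord0 k) => [l|] ->; last by rewrite coord0.
  by rewrite coord_lift !mxE.
have [e He eE] := dF.
have dFe z : is_derive z e F (f' (rvcons z)).
  apply/is_derive_line; have /is_derive_line := df (rvcons z).
  rewrite -eE; congr (is_derive _ _ _ _); apply/funext => s.
  by rewrite /F rvcons_lin.
have int := continuous_bounded_support_integrable cF (is_derive_out dFe F0).
have mf : measurable_fun setT (fun x => (f' x)%:E).
  by apply/measurable_EFinP; exact: continuous_measurable_rv.
apply: etrans (integral_derive_pt IH He dFe cF _); last by exists M.
exact: (@integral_pushforward _ _ (measurableTypeR R * 'rV[R]_n)%type _ _ _
  (@measurable_rvcons R n) (mu_tx R n) setT _ mf int measurableT).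
Qed.

End partial_integral.

Section integrable_support.
Context d (T : measurableType d) (R : realType) (mu : {measure set T -> \bar R}).

Lemma inL2_bounded_support (B D : set T) (f : T -> R) C :
  measurable B -> (mu B < +oo)%E -> measurable D ->
  measurable_fun setT f -> (forall x, B x -> `|f x| <= C) -> (forall x, ~ B x -> f x = 0) ->
  inL2 mu D f.
Proof.
move=> mB Boo mD mf fC f0; apply: (@inL2_subset _ _ _ _ setT) => //.
have /(inL2P _ _ mB)[_ fB] : inL2 mu B f.
  by apply: (inL2_bounded (C := C)) => //; exact: measurable_funTS.
apply/(inL2P _ _ measurableT); split=> //.
move/(integrable_mkcond _ mB): fB; congr (_.-integrable _ _); apply/funext => x.
rewrite patchE; case: ifPn => // /negP xB; rewrite f0 ?mul0r// => xB'; apply: xB.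
exact/mem_set.
Qed.

Lemma integrable_bounded_support (B : set T) (f : T -> R) C :
  measurable B -> (mu B < +oo)%E -> measurable_fun setT f ->
  (forall x, B x -> `|f x| <= C) -> (forall x, ~ B x -> f x = 0) ->
  mu.-integrable setT (fun x => (f x)%:E).
Proof.
move=> mB Boo mf fC f0.
have : mu.-integrable B (EFin \o f).
  apply: measurable_bounded_integrable => //; first exact: measurable_funTS.
  exists C; split; first exact: num_real.
  by move=> M CM x /fC fx; exact: le_trans fx (ltW CM).
move/(integrable_mkcond _ mB); congr (_.-integrable _ _); apply/funext => x.
rewrite patchE; case: ifPn => //= /negP xB; rewrite f0// => xB'; apply: xB.
exact/mem_set.
Qed.

(* Integration by parts on D from the vanishing of the integral of the derivative of
   a product on the whole space. *)
Lemma ip_opp_by_parts (D : set T) (f f' g g' : T -> R) :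
  measurable D ->
  mu.-integrable setT (fun x => (f x * g' x)%:E) ->
  mu.-integrable setT (fun x => (f' x * g x)%:E) ->
  (forall x, ~ D x -> g x = 0) -> (forall x, ~ D x -> g' x = 0) ->
  (\int[mu]_x (f x * g' x + f' x * g x)%:E = 0)%E ->
  ip mu D f g' = - ip mu D f' g.
Proof.
move=> mD i1 i2 g0 g'0 H; apply/eqP; rewrite -addr_eq0; apply/eqP.
rewrite /ip ![\int[mu]_(x in D) _]Rintegral_mkcond.
have -> : (fun x => f x * g' x) \_ D = (fun x => f x * g' x).
  apply/funext => x; rewrite patchE; case: ifPn => // /negP xD.
  by rewrite g'0 ?mulr0// => xD'; apply: xD; exact/mem_set.
have -> : (fun x => f' x * g x) \_ D = (fun x => f' x * g x).
  apply/funext => x; rewrite patchE; case: ifPn => // /negP xD.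
  by rewrite g0 ?mulr0// => xD'; apply: xD; exact/mem_set.
by rewrite -RintegralD// /Rintegral H.
Qed.

End integrable_support.

Section compact_support.
Context (R : realType).

Lemma test_fun_out (V : normedModType R) (D : set V) (phi : V -> R) :
  test_fun D phi -> (forall x, ~ D x -> phi x = 0) /\
  forall v x, ~ D x -> 'D_v phi x = 0.
Proof.
move=> [sphi cphi phiD].
have out x : ~ csupp phi x -> \forall y \near x, phi y = 0.
  move=> xs; have : open (~` csupp phi) by apply: closed_openC; exact: closed_closure.
  rewrite openE => /(_ x xs); apply: filterS => y ys; apply/eqP/negPn/negP => y0.
  by apply: ys; exact: subset_closure.
split=> [x xD|v x xD].
  by apply: nbhs_singleton (out x _) => /phiD.
have : is_derive x v phi 0.
  apply: (@near_eq_is_derive _ _ _ (fun=> 0)) => //.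
  have : \forall y \near x, phi y = 0 by apply: out => /phiD.
  by apply: filterS => y ->.
by move=> [_ ->].
Qed.

Lemma test_fun_bounded_support n (D : set (R * 'rV[R]_n)) phi : test_fun D phi ->
  exists M, forall z, ~ cbox (fun=> - M) (fun=> M) z -> phi z = 0.
Proof.
move=> [sphi cphi phiD].
have /choice[M HM] : forall k : 'I_n.+1, exists M : R,
    forall z, csupp phi z -> `|coord z k| <= M.
  move=> k; have /compact_bounded[C [_ HC]] : compact ((fun z : R * 'rV[R]_n => coord z k) @` csupp phi).
    by apply: continuous_compact => //; apply: continuous_subspaceT; exact: continuous_coord.
  by exists (C + 1) => z zs; apply: (HC (C + 1)); rewrite ?ltrDl//; exists z.
exists (\sum_k `|M k|) => z; apply: contra_notP => /eqP z0 k.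
rewrite -ler_norml; apply: (@le_trans _ _ (M k)).
  by apply: HM; exact: subset_closure.
apply: (le_trans (ler_norm _)); rewrite (bigD1 k)//= lerDl.
by apply: sumr_ge0.
Qed.

Lemma test_fun_bounded_support_rv n (D : set 'rV[R]_n) phi : test_fun D phi ->
  exists M, forall x : 'rV[R]_n, ~ (forall j, - M <= x ord0 j <= M) -> phi x = 0.
Proof.
move=> [sphi cphi phiD].
have /choice[M HM] : forall k : 'I_n, exists M : R,
    forall z, csupp phi z -> `|z ord0 k| <= M.
  move=> k; have /compact_bounded[C [_ HC]] : compact ((fun z : 'rV[R]_n => z ord0 k) @` csupp phi).
    by apply: continuous_compact => //; apply: continuous_subspaceT; exact: coord_continuous.
  by exists (C + 1) => z zs; apply: (HC (C + 1)); rewrite ?ltrDl//; exists z.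
exists (\sum_k `|M k|) => z; apply: contra_notP => /eqP z0 k.
rewrite -ler_norml; apply: (@le_trans _ _ (M k)).
  by apply: HM; exact: subset_closure.
apply: (le_trans (ler_norm _)); rewrite (bigD1 k)//= lerDl.
by apply: sumr_ge0.
Qed.

Lemma smooth_product_is_derive (V : normedModType R) (f g : V -> R) x v :
  smooth f -> smooth g ->
  is_derive x v (fun y => f y * g y) (f x * 'D_v g x + 'D_v f x * g x).
Proof.
move=> sf sg; have df : is_derive x v f ('D_v f x).
  by constructor => //; exact: smooth_derivable.
have dg : is_derive x v g ('D_v g x).
  by constructor => //; exact: smooth_derivable.
by apply: (is_derive_eq (is_deriveM df dg)); congr (_ + _); exact: mulrC.
Qed.

Lemma smooth_product_continuous (V : normedModType R) (f g : V -> R) v :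
  smooth f -> smooth g -> continuous (fun x => f x * 'D_v g x + 'D_v f x * g x).
Proof.
move=> sf sg; apply: smooth_continuous; apply: smoothD; apply: smoothM => //;
  exact: smooth_derive.
Qed.

End compact_support.

Section smooth_space_time.
Context (R : realType) (d : nat).
Notation pt := (R * 'rV[R]_d)%type.
Notation ptM := (measurableTypeR R * 'rV[R]_d)%type.
Notation mu := (mu_tx R d).
Implicit Types (D : set pt) (f g phi : pt -> R).

Lemma smooth_inL2_support f D M : smooth f -> measurable (D : set ptM) ->
  (forall z, ~ cbox (fun=> - M) (fun=> M) z -> f z = 0) -> inL2 mu D f.
Proof.
move=> sf mD f0; pose a := fun _ : 'I_d.+1 => - (M + 1); pose b := fun _ : 'I_d.+1 => M + 1.
have [C HC] := continuous_bounded_cbox a b (smooth_continuous sf).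
apply: (@inL2_bounded_support _ ptM _ mu (obox a b) D f C) => //.
- exact: measurable_obox.
- exact: obox_lty.
- exact: smooth_measurable.
- by move=> z /obox_cbox; exact: HC.
- move=> z zB; apply: f0 => H; apply: zB => k; have := H k; rewrite /a /b; lra.
Qed.

Lemma smooth_inL2 f D M : smooth f -> measurable (D : set ptM) ->
  D `<=` cbox (fun=> - M) (fun=> M) -> inL2 mu D f.
Proof.
move=> sf mD DM; pose a := fun _ : 'I_d.+1 => - (M + 1); pose b := fun _ : 'I_d.+1 => M + 1.
have [C HC] := continuous_bounded_cbox a b (smooth_continuous sf).
have mB : measurable (obox a b : set ptM) := measurable_obox a b.
have DB : D `<=` obox a b.
  by move=> z /DM zD k; have := zD k; rewrite /a /b; lra.
apply: (inL2_subset mB mD DB); apply: (inL2_bounded (C := C)) => //.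
- exact: obox_lty.
- by apply: measurable_funTS; exact: smooth_measurable.
- by move=> z /obox_cbox; exact: HC.
Qed.

Definition axis (e : pt) : Prop := e = (1, 0) \/ exists i, e = (0, e_x R i).

(** The product [f * phi] has bounded support, so its derivative integrates to 0 over the whole
    space; both terms of the product rule vanish off [D] because [phi] does so near every outside
    point. *)
Lemma smooth_by_parts e f phi D : axis e -> smooth f -> smooth phi ->
  measurable (D : set ptM) -> test_fun D phi ->
  ip mu D f (fun z => 'D_e phi z) = - ip mu D (fun z => 'D_e f z) phi.
Proof.
move=> He sf sphi mD tphi; have [phi0 dphi0D] := test_fun_out tphi.
have [M HM] := test_fun_bounded_support tphi.
have dphi0 : forall z, ~ cbox (fun=> - M) (fun=> M) z -> 'D_e phi z = 0.
  apply: (is_derive_out (f := phi) (e := e)) => // z.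
  by constructor => //; exact: smooth_derivable.
have intP : forall g g' : pt -> R, smooth g -> smooth g' -> (forall z, ~ cbox (fun=> - M) (fun=> M) z -> g' z = 0) ->
    mu.-integrable setT (fun z => (g z * g' z)%:E).
  move=> g g' sg sg' g'0; apply: (@continuous_bounded_support_integrable _ _ _ M).
    by apply: smooth_continuous; exact: smoothM.
  by move=> z zM; rewrite g'0 ?mulr0.
apply: ip_opp_by_parts => //.
- by apply: intP => //; exact: smooth_derive.
- by apply: intP => //; exact: smooth_derive.
- by move=> z; exact: dphi0D.
- apply: (integral_derive_pt _ (e := e) (f := fun z => f z * phi z)) => //.
  + exact: integral_derive_rv.
  + by move=> z; exact: smooth_product_is_derive.
  + exact: smooth_product_continuous.
  + by exists M => z zM; rewrite HM ?mulr0.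
Qed.

Lemma test_inL2 phi D E : measurable (E : set ptM) -> test_fun D phi -> inL2 mu E phi.
Proof.
move=> mE tphi; have [M HM] := test_fun_bounded_support tphi.
by apply: smooth_inL2_support HM => //; have [] := tphi.
Qed.

Lemma test_derive_inL2 e phi D E : measurable (E : set ptM) -> test_fun D phi ->
  inL2 mu E (fun z => 'D_e phi z).
Proof.
move=> mE tphi; have [M HM] := test_fun_bounded_support tphi; have [sphi _ _] := tphi.
apply: (@smooth_inL2_support _ _ M) => //; first exact: smooth_derive.
apply: (is_derive_out (f := phi) (e := e)) => // z.
by constructor => //; exact: smooth_derivable.
Qed.

Lemma test_grad_inL2 i phi D E : measurable (E : set ptM) -> test_fun D phi ->
  inL2 mu E (fun z => grad_x phi z ord0 i).
Proof.
by move=> mE tphi; under eq_fun do rewrite mxE; exact: test_derive_inL2 tphi.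
Qed.

End smooth_space_time.

Lemma ip_0l d (T : measurableType d) (R : realType) (mu : {measure set T -> \bar R})
  (D : set T) (f : T -> R) : ip mu D (fun=> 0) f = 0.
Proof.
by rewrite /ip /Rintegral; under eq_integral do rewrite mul0r; rewrite integral0.
Qed.

(** * Weak derivatives, the operator A and its adjoint *)

Section weak_derivatives.
Context (R : realType) (d : nat).
Notation pt := (R * 'rV[R]_d)%type.
Notation ptM := (measurableTypeR R * 'rV[R]_d)%type.
Notation mu := (mu_tx R d).
Notation fld := (fld R d).
Context (D : set pt).
Hypothesis oD : open D.
Let mD : measurable (D : set ptM) := open_measurable_pt oD.
Implicit Types (v : pt -> R) (g : pt -> 'rV[R]_d) (u w : fld) (h phi : pt -> R).

Lemma test_d_t_inL2 phi : test_fun D phi -> inL2 mu D (d_t phi).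
Proof. by move=> tphi; exact: test_derive_inL2 mD tphi. Qed.

Lemma test_grad_inL2v phi : test_fun D phi -> inL2v mu D (grad_x phi).
Proof. by move=> tphi i; exact: test_grad_inL2 mD tphi. Qed.

Lemma fundamental_lemma_test (f : ptM -> R) : inL2 mu D f ->
  (forall phi, test_fun D phi -> ip mu D f phi = 0) -> ae_eq mu D f (fun=> 0).
Proof.
move=> fD H; apply: fundamental_lemma => // n a b abD; apply: H.
exact: test_bump.
Qed.

Lemma ae_eq_test (f f' : ptM -> R) : inL2 mu D f -> inL2 mu D f' ->
  (forall phi, test_fun D phi -> ip mu D f phi = ip mu D f' phi) -> ae_eq mu D f f'.
Proof.
move=> fD fD' H.
have : ae_eq mu D (fun z => -1 * f' z + f z) (fun=> 0).
  apply: fundamental_lemma_test; first exact: inL2_lin.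
  move=> phi tphi; rewrite ip_lin//; first by rewrite H// mulN1r addNr.
  exact: test_inL2 mD tphi.
by apply: filterS => z Hz Dz; have := Hz Dz; rewrite mulN1r addrC => /eqP; rewrite subr_eq0 => /eqP.
Qed.

Lemma is_wgrad_unique v g g' : is_wgrad D v g -> is_wgrad D v g' -> ae_eq mu D g g'.
Proof.
move=> [gD Hg] [gD' Hg']; apply/ae_eq_coord => i; apply: ae_eq_test => // phi tphi.
by apply: oppr_inj; rewrite -Hg// Hg'.
Qed.

Lemma is_wdiv_unique u h h' : is_wdiv D u h -> is_wdiv D u h' -> ae_eq mu D h h'.
Proof.
move=> [hD Hh] [hD' Hh']; apply: ae_eq_test => // phi tphi.
by apply: oppr_inj; rewrite -Hh// Hh'.
Qed.

Lemma wgradP v : (exists g, is_wgrad D v g) -> is_wgrad D v (wgrad D v).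
Proof. exact: xgetPex. Qed.

Lemma wdivP u : (exists h, is_wdiv D u h) -> is_wdiv D u (wdiv D u).
Proof. exact: xgetPex. Qed.

Lemma is_wgrad_lin a v v' g g' : inL2 mu D v -> inL2 mu D v' ->
  is_wgrad D v g -> is_wgrad D v' g' ->
  is_wgrad D (fun z => a * v z + v' z) (fun z => a *: g z + g' z).
Proof.
move=> vD vD' [gD Hg] [gD' Hg']; split=> [|i phi tphi]; first exact: inL2v_lin.
have tD := test_grad_inL2v tphi.
rewrite ip_lin// Hg// Hg'//; under [in RHS]eq_fun do rewrite !mxE.
have pD := test_inL2 mD tphi.
by rewrite (ip_lin a mD (gD i) (gD' i) pD); ring.
Qed.

Lemma is_wdiv_lin a u u' h h' : inL2f D u -> inL2f D u' ->
  is_wdiv D u h -> is_wdiv D u' h' -> is_wdiv D (a *: u + u') (fun z => a * h z + h' z).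
Proof.
move=> [u1 u2] [u1' u2'] [hD Hh] [hD' Hh']; split=> [|phi tphi]; first exact: inL2_lin.
have pD := test_inL2 mD tphi.
rewrite (ip_lin a mD hD hD' pD) opprD -mulrN -Hh// -Hh'//.
rewrite [X in X + _](ip_lin a mD u1 u1' (test_d_t_inL2 tphi)).
rewrite [X in _ + X](ipv_lin a mD u2 u2' (test_grad_inL2v tphi)).
by ring.
Qed.

Lemma is_wgrad_ae v v' g g' : inL2 mu D v -> inL2 mu D v' -> inL2v mu D g' ->
  ae_eq mu D v v' -> ae_eq mu D g g' -> is_wgrad D v g -> is_wgrad D v' g'.
Proof.
move=> vD vD' gD' vv' /ae_eq_coord gg' [gD Hg]; split=> // i phi tphi.
have m1 : measurable_fun (D : set ptM) (fun z => grad_x phi z ord0 i).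
  by apply: inL2_measurable mD _; exact: test_grad_inL2v.
have m2 : measurable_fun (D : set ptM) phi.
  by apply: inL2_measurable mD _; exact: test_inL2 mD tphi.
rewrite -(ip_ae mD (inL2_measurable mD vD) (inL2_measurable mD vD') m1 m1 vv' (ae_eq_refl _ _ _)).
by rewrite -(ip_ae mD (inL2_measurable mD (gD i)) (inL2_measurable mD (gD' i)) m2 m2 (gg' i) (ae_eq_refl _ _ _)) Hg.
Qed.

Lemma is_wdiv_ae u u' h h' : inL2f D u -> inL2f D u' -> inL2 mu D h' ->
  aef D u u' -> ae_eq mu D h h' -> is_wdiv D u h -> is_wdiv D u' h'.
Proof.
move=> [u1 u2] [u1' u2'] hD' [e1 e2] hh' [hD Hh]; split=> // phi tphi.
have m1 : measurable_fun (D : set ptM) (d_t phi).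
  by apply: inL2_measurable mD _; exact: test_d_t_inL2.
have m2 : measurable_fun (D : set ptM) phi.
  by apply: inL2_measurable mD _; exact: test_inL2 mD tphi.
have m3 := test_grad_inL2v tphi.
rewrite -(ip_ae mD (inL2_measurable mD u1) (inL2_measurable mD u1') m1 m1 e1 (ae_eq_refl _ _ _)).
rewrite -(ipv_ae mD u2 u2' m3 m3 e2 (ae_eq_refl _ _ _)).
by rewrite -(ip_ae mD (inL2_measurable mD hD) (inL2_measurable mD hD') m2 m2 hh' (ae_eq_refl _ _ _)) Hh.
Qed.

Lemma is_wgrad0 : is_wgrad D (fun=> 0) (fun=> 0).
Proof.
split=> [i|i phi tphi]; first exact: (inL2f_0 D).2.
rewrite ip_0l (_ : (fun z => _) = (fun=> 0)) ?ip_0l ?oppr0//.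
by apply/funext => z; rewrite mxE.
Qed.




Lemma H_A_inL2 u : H_A D u -> inL2f D u.
Proof. by case. Qed.

Lemma H_A_wgrad u : H_A D u -> is_wgrad D u.1 (wgrad D u.1).
Proof. by case=> _ /wgradP. Qed.

Lemma H_A_wdiv u : H_A D u -> is_wdiv D u (wdiv D u).
Proof. by case=> _ _ /wdivP. Qed.

Lemma H_A_lin a u u' : H_A D u -> H_A D u' -> H_A D (a *: u + u').
Proof.
move=> [uD [g Hg] [h Hh]] [uD' [g' Hg'] [h' Hh']]; split; first exact: inL2f_lin.
- exists (fun z => a *: g z + g' z).
  by have := is_wgrad_lin a uD.1 uD'.1 Hg Hg'.
- by exists (fun z => a * h z + h' z); exact: is_wdiv_lin.
Qed.

(** By uniqueness, any weak gradient and divergence may replace the chosen representatives inside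
    [opA]. *)
Lemma opA_E u g h : inL2f D u -> is_wgrad D u.1 g -> is_wdiv D u h ->
  aef D (opA D u) (h, g + u.2).
Proof.
move=> uD Hg Hh; split => /=.
- by apply: (is_wdiv_unique (wdivP (ex_intro _ h Hh)) Hh).
- have : ae_eq mu D (wgrad D u.1) g by exact: (is_wgrad_unique (wgradP (ex_intro _ g Hg)) Hg).
  by apply: filterS => z Hz Dz; change (wgrad D u.1 z + u.2 z = g z + u.2 z); rewrite Hz.
Qed.

Lemma opAadj_E u g h : inL2f D u -> is_wgrad D u.1 g -> is_wdiv D u h ->
  aef D (opAadj D u) (fun z => - h z, fun z => - g z + u.2 z).
Proof.
move=> uD Hg Hh; split => /=.
- have : ae_eq mu D (wdiv D u) h by apply: (is_wdiv_unique (wdivP (ex_intro _ h Hh)) Hh).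
  by apply: filterS => z Hz Dz; change (- wdiv D u z = - h z); rewrite Hz.
- have : ae_eq mu D (wgrad D u.1) g by exact: (is_wgrad_unique (wgradP (ex_intro _ g Hg)) Hg).
  by apply: filterS => z Hz Dz; change (- wgrad D u.1 z + u.2 z = - g z + u.2 z); rewrite Hz.
Qed.

Lemma opA_inL2 u : H_A D u -> inL2f D (opA D u).
Proof.
move=> Hu; have [gD _] := H_A_wgrad Hu; have [hD _] := H_A_wdiv Hu; split=> // i.
have := inL2_D (gD i) ((H_A_inL2 Hu).2 i).
by congr (inL2 _ _ _); apply/funext => z; rewrite mxE.
Qed.

Lemma opAadj_inL2 u : H_A D u -> inL2f D (opAadj D u).
Proof.
move=> Hu; have [gD _] := H_A_wgrad Hu; have [hD _] := H_A_wdiv Hu; split => [|i].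
  exact: inL2_N.
have := inL2_D (inL2_N (gD i)) ((H_A_inL2 Hu).2 i).
by congr (inL2 _ _ _); apply/funext => z; rewrite !mxE.
Qed.

Lemma opA_lin a u u' : H_A D u -> H_A D u' ->
  aef D (opA D (a *: u + u')) (a *: opA D u + opA D u').
Proof.
move=> Hu Hu'; have [uD uD'] := (H_A_inL2 Hu, H_A_inL2 Hu').
have G := is_wgrad_lin a uD.1 uD'.1 (H_A_wgrad Hu) (H_A_wgrad Hu').
have H := is_wdiv_lin a uD uD' (H_A_wdiv Hu) (H_A_wdiv Hu').
apply: (aef_trans (opA_E (inL2f_lin a uD uD') G H)); split => /=; first exact: ae_eq_refl.
apply: aeW => z _.
change ((a *: wgrad D u.1 z + wgrad D u'.1 z) + (a *: u.2 z + u'.2 z) =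
    a *: (wgrad D u.1 z + u.2 z) + (wgrad D u'.1 z + u'.2 z)).
by rewrite scalerDr addrACA.
Qed.

Lemma opAadj_lin a u u' : H_A D u -> H_A D u' ->
  aef D (opAadj D (a *: u + u')) (a *: opAadj D u + opAadj D u').
Proof.
move=> Hu Hu'; have [uD uD'] := (H_A_inL2 Hu, H_A_inL2 Hu').
have G := is_wgrad_lin a uD.1 uD'.1 (H_A_wgrad Hu) (H_A_wgrad Hu').
have H := is_wdiv_lin a uD uD' (H_A_wdiv Hu) (H_A_wdiv Hu').
apply: (aef_trans (opAadj_E (inL2f_lin a uD uD') G H)); split => /=; apply: aeW => z _.
- by change (- (a * wdiv D u z + wdiv D u' z) = a * (- wdiv D u z) + (- wdiv D u' z)); ring.
- change (- (a *: wgrad D u.1 z + wgrad D u'.1 z) + (a *: u.2 z + u'.2 z) =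
    a *: (- wgrad D u.1 z + u.2 z) + (- wgrad D u'.1 z + u'.2 z)).
  by rewrite opprD addrACA scalerDr scalerN.
Qed.

Lemma H_A_ae u u' : inL2f D u' -> aef D u u' -> H_A D u -> H_A D u'.
Proof.
move=> uD' uu' Hu; have uD := H_A_inL2 Hu; split => //.
- exists (wgrad D u.1); apply: is_wgrad_ae (H_A_wgrad Hu) => //; [exact: uD.1|exact: uD'.1| |exact: uu'.1|exact: ae_eq_refl].
  by have [] := H_A_wgrad Hu.
- exists (wdiv D u); apply: is_wdiv_ae (H_A_wdiv Hu) => //; last exact: ae_eq_refl.
  by have [] := H_A_wdiv Hu.
Qed.

End weak_derivatives.

Section smooth_fields.
Context (R : realType) (d : nat).
Notation pt := (R * 'rV[R]_d)%type.
Notation ptM := (measurableTypeR R * 'rV[R]_d)%type.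
Notation mu := (mu_tx R d).
Notation fld := (fld R d).
Implicit Types (u : fld).

Lemma grad_xE (f : pt -> R) i :
  (fun z => grad_x f z ord0 i) = (fun z => 'D_((0, e_x R i) : pt) f z).
Proof. by apply/funext => z; rewrite mxE. Qed.

Definition smooth_fld u := smooth u.1 /\ forall i, smooth (fun z => u.2 z ord0 i).

Definition smooth_div u (z : pt) : R := d_t u.1 z + div_x u.2 z.

Lemma smooth_smooth_div u : smooth_fld u -> smooth (smooth_div u).
Proof.
move=> [s1 s2]; apply: smoothD; first exact: smooth_derive.
by apply: smooth_sum => i _; exact: smooth_derive.
Qed.

Lemma smooth_grad v i : smooth v -> smooth (fun z : pt => grad_x v z ord0 i).
Proof. by move=> sv; under eq_fun do rewrite mxE; exact: smooth_derive. Qed.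

Context (D : set pt) (M : R).
Hypotheses (oD : open D) (DM : D `<=` cbox (fun=> - M) (fun=> M)).
Let mD : measurable (D : set ptM) := open_measurable_pt oD.

Lemma smooth_fld_inL2 u : smooth_fld u -> inL2f D u.
Proof. by move=> [s1 s2]; split=> [|i]; exact: smooth_inL2 DM. Qed.

Lemma smooth_is_wgrad v : smooth v -> is_wgrad D v (grad_x v).
Proof.
move=> sv; split=> [i|i phi tphi].
  by apply: smooth_inL2 mD DM; exact: smooth_grad.
rewrite !grad_xE; apply: smooth_by_parts => //; first by right; exists i.
by have [] := tphi.
Qed.

Lemma smooth_is_wdiv u : smooth_fld u -> is_wdiv D u (smooth_div u).
Proof.
move=> su; have [s1 s2] := su; have [u1 u2] := smooth_fld_inL2 su; split=> [|phi tphi].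
  by apply: smooth_inL2 mD DM; exact: smooth_smooth_div.
have [sphi _ _] := tphi.
have pD := test_inL2 mD tphi.
rewrite ipv_sumE//; last exact: test_grad_inL2v.
rewrite [X in X + _](smooth_by_parts (or_introl erefl) s1 sphi mD tphi).
under eq_bigr => i _.
  rewrite grad_xE (smooth_by_parts (or_intror (ex_intro _ i erefl)) (s2 i) sphi mD tphi).
  over.
have d1 : inL2 mu D (d_t u.1) by apply: smooth_inL2 mD DM; exact: smooth_derive.
have d2 i : inL2 mu D (fun z => 'D_((0, e_x R i) : pt) (fun y => u.2 y ord0 i) z).
  by apply: smooth_inL2 mD DM; exact: smooth_derive.
have -> : ip mu D (smooth_div u) phi = ip mu D (d_t u.1) phi + ip mu D (div_x u.2) phi.
  have := ip_lin 1 mD d1 (inL2_sum (index_enum _) (P := xpredT) (fun i _ => d2 i)) pD.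
  by rewrite mul1r => <-; congr ip; apply/funext => z; rewrite mul1r.
rewrite opprD; congr (_ + _); rewrite sumrN; congr (- _).
rewrite /div_x; elim: (index_enum _) => [|i r IH].
  by rewrite big_nil; under eq_fun do rewrite big_nil; rewrite ip_0l.
rewrite big_cons IH.
have := ip_lin 1 mD (d2 i) (inL2_sum r (P := xpredT) (fun i _ => d2 i)) pD.
rewrite mul1r => <-; congr ip; apply/funext => z.
by rewrite big_cons mul1r.
Qed.

Lemma smooth_H_A u : smooth_fld u -> H_A D u.
Proof.
move=> su; split; first exact: smooth_fld_inL2.
- by exists (grad_x u.1); apply: smooth_is_wgrad; have [] := su.
- by exists (smooth_div u); exact: smooth_is_wdiv.
Qed.

(** The adjoint in its classical form. It does not refer to a domain, so for smooth fields the
    operators on different cells fit together. *)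
Definition smooth_opAadj u : fld :=
  (fun z => - smooth_div u z, fun z => - grad_x u.1 z + u.2 z).

Lemma smooth_opAadjE u : smooth_fld u -> aef D (opAadj D u) (smooth_opAadj u).
Proof.
move=> su; apply: opAadj_E => //; first exact: smooth_fld_inL2.
- by apply: smooth_is_wgrad; have [] := su.
- exact: smooth_is_wdiv.
Qed.

End smooth_fields.

(** * Limits of integrals and the fundamental lemma in space *)

Section ae_bounds.
Context d (T : measurableType d) (R : realType) (mu : {measure set T -> \bar R}).

Lemma ae_norm_Rintegral_le (D : set T) (f g : T -> R) : measurable D ->
  mu.-integrable D (fun x => (f x)%:E) -> mu.-integrable D (fun x => (g x)%:E) ->
  (forall x, D x -> 0 <= g x) ->
  {ae mu, forall x, D x -> `|f x| <= g x} ->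
  `|\int[mu]_(x in D) f x| <= \int[mu]_(x in D) g x.
Proof.
move=> mD fi gi g0 fg; apply: (le_trans (le_normr_Rintegral mD fi)).
have nfi : mu.-integrable D (fun x => (`|f x|)%:E) by exact: (integrable_abse fi).
rewrite /Rintegral fine_le//; [exact: integrable_fin_num|exact: integrable_fin_num|].
apply: ae_ge0_le_integral => //.
- exact: measurable_int nfi.
- exact: measurable_int gi.
Qed.

(* Dominated convergence for a bounded multiplier tending to 0. *)
Lemma ip_cvg0 (D : set T) (f : T -> R) (p : nat -> T -> R) C :
  measurable D -> (mu D < +oo)%E -> inL2 mu D f ->
  (forall n, measurable_fun D (p n)) -> (forall n x, D x -> `|p n x| <= C) ->
  (forall x, D x -> p n x @[n --> \oo] --> (0 : R)) ->
  ip mu D f (p n) @[n --> \oo] --> (0 : R).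
Proof.
move=> mD Doo fD mp pC p0.
have oneD : inL2 mu D (fun=> 1).
  by apply: (@inL2_bounded _ _ _ _ _ _ 1) => // x _; rewrite normr1.
have fi : mu.-integrable D (fun x => (f x)%:E).
  by have := inL2_mul_integrable mD fD oneD; under eq_fun do rewrite mulr1.
have mf := inL2_measurable mD fD.
have mfp n : measurable_fun D (fun x => (f x * p n x)%:E).
  by apply/measurable_EFinP; exact: measurable_funM.
have Cfi : mu.-integrable D (fun x => (C%:E * `|(f x)%:E|)%E).
  by apply: integrableZl => //; exact: integrable_abse.
have bnd n x : D x -> (`|(f x * p n x)%:E| <= C%:E * `|(f x)%:E|)%E.
  by move=> Dx; rewrite lee_fin normrM mulrC ler_wpM2r// pC.
have := @dominated_convergence _ _ _ mu _ mD
    (fun n x => (f x * p n x)%:E) (fun=> 0%E) (fun x => (C%:E * `|(f x)%:E|)%E) mfp.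
move=> /(_ _ _ Cfi _)[//|||_ _].
- apply: aeW => x Dx; apply: cvg_EFin; first exact: nearW.
  by rewrite -[X in _ --> X](mulr0 (f x)); apply: cvgMl_tmp; exact: p0.
- by apply: aeW => x n Dx; exact: bnd.
rewrite integral0 => /fine_cvg; apply: cvg_trans; apply: near_eq_cvg.
exact: nearW.
Qed.

End ae_bounds.

Section fundamental_lemma_rv.
Context (R : realType) (d : nat).
Notation mux := (mu_x R d).
Notation rv := 'rV[R]_d.
Implicit Types a b : 'I_d -> R.

Definition rv_cbox a b : set rv := [set x | forall j, a j <= x ord0 j <= b j].

Definition rv_bump n a b (x : rv) : R :=
  \prod_j (flat_exp 0 (n.+1%:R * (x ord0 j - a j)) *
           flat_exp 0 (n.+1%:R * (b j - x ord0 j))).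

Lemma bump_pair n (a b : 'I_d.+1 -> R) (z : R * rv) : bump n a b z =
  (flat_exp 0 (n.+1%:R * (z.1 - a ord0)) * flat_exp 0 (n.+1%:R * (b ord0 - z.1))) *
  rv_bump n (fun j => a (lift ord0 j)) (fun j => b (lift ord0 j)) z.2.
Proof.
rewrite /bump big_ord_recl coord0; congr (_ * _).
by apply: eq_bigr => j _; rewrite coord_lift.
Qed.

Lemma rv_bump_ge0 n a b x : 0 <= rv_bump n a b x.
Proof. by apply: prodr_ge0 => k _; rewrite mulr_ge0 ?flat_exp_ge0. Qed.

Lemma rv_bump_le1 n a b x : rv_bump n a b x <= 1.
Proof.
apply: prodr_ile1 => k _.
by rewrite mulr_ge0 ?flat_exp_ge0//= mulr_ile1 ?flat_exp_ge0 ?flat_exp0_le1.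
Qed.

Lemma smooth_rv_bump_snd n a b : smooth (fun z : R * rv => rv_bump n a b z.2).
Proof.
apply: smooth_prod => k _; apply: smoothM; under eq_fun do rewrite -coord_lift.
- apply: (@smooth_flat_exp_affine _ _ _ (fun v => n.+1%:R * coord v (lift ord0 k))); split.
    move=> z; apply: cvgM; first exact: cvg_cst.
    by apply: cvgB; [exact: continuous_coord|exact: cvg_cst].
  by move=> t v x; rewrite (@coord_affine R _ _).2; ring.
- apply: (@smooth_flat_exp_affine _ _ _ (fun v => - (n.+1%:R * coord v (lift ord0 k)))); split.
    move=> z; apply: cvgM; first exact: cvg_cst.
    by apply: cvgB; [exact: cvg_cst|exact: continuous_coord].
  by move=> t v x; rewrite (@coord_affine R _ _).2; ring.
Qed.

Lemma measurable_rv_bump n a b : measurable_fun setT (rv_bump n a b).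
Proof.
apply: continuous_measurable_rv => x.
have := @continuous_comp _ _ _ (fun x : rv => (0 : R, x)) (fun z : R * rv => rv_bump n a b z.2) x.
by apply; [exact: continuous_pairr|exact: smooth_continuous (smooth_rv_bump_snd n a b) _].
Qed.

Lemma inL2_rv_bump n a b (W : set rv) : measurable W -> (mux W < +oo)%E ->
  inL2 mux W (rv_bump n a b).
Proof.
move=> mW Woo; apply: (inL2_bounded (C := 1)) => //.
  by apply: measurable_funTS; exact: measurable_rv_bump.
by move=> x _; rewrite ger0_norm ?rv_bump_ge0 ?rv_bump_le1.
Qed.

Lemma inL2_cylinder_snd (I : set (measurableTypeR R)) (W : set rv) (g : rv -> R) :
  measurable I -> measurable W -> (lebesgue_measure I < +oo)%E -> inL2 mux W g ->
  inL2 (mu_tx R d) (I `*` W) (fun z => g z.2).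
Proof.
move=> mI mW Ioo /(inL2P _ _ mW)[mg gg].
have mIW : measurable (I `*` W : set (measurableTypeR R * rv)%type) by exact: measurableX.
have mg2 : measurable_fun (I `*` W : set (measurableTypeR R * rv)%type) (fun z => g z.2).
  move=> _ Y mY; rewrite (_ : _ `&` _ = I `*` (W `&` g @^-1` Y)).
    by apply: measurableX => //; exact: mg.
  by apply/seteqP; split=> z [] /=; [move=> [Iz Wz] gY|move=> Iz [Wz gY]].
apply/(inL2P _ _ mIW); split=> //; apply/integrableP; split.
  by apply/measurable_EFinP; exact: measurable_funM.
rewrite integral_mkcond.
have mF : measurable_fun setT
    ((fun z : measurableTypeR R * rv => `|(g z.2 * g z.2)%:E|%E) \_ (I `*` W)).
  apply/(measurable_restrictT _ mIW); apply: measurableT_comp => //.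
  by apply/measurable_EFinP; exact: measurable_funM.
rewrite (@fubini_tonelli1 _ _ _ _ R lebesgue_measure (lebesgue_rv R d) _ mF); last first.
  by move=> z; rewrite patchE; case: ifP.
rewrite (_ : fubini_F _ _ = (fun=> (\int[mux]_(x in W) `|(g x * g x)%:E|)%E) \_ I); last first.
  apply/funext => t; rewrite /fubini_F patchE.
  under eq_integral do rewrite patchE in_setX/=.
  case: ifP => tI; last by rewrite integral0.
  by rewrite [RHS]integral_mkcond; apply: eq_integral => x _; rewrite patchE.
rewrite -integral_mkcond; move/integrableP : gg => [_ ggoo].
have gge : (\int[mux]_(x in W) `|(g x * g x)%:E|)%E \is a fin_num.
  by rewrite ge0_fin_numE// integral_ge0.
rewrite -(fineK gge) integral_cst// lte_mul_pinfty//.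
by rewrite lee_fin fine_ge0// integral_ge0.
Qed.

(** Extend [g] constantly in time to the cylinder over the unit interval. A space-time bump is a
    time factor times a spatial bump ([bump_pair]), so the extension meets the hypothesis of
    [fundamental_lemma], and one good time slice returns the claim for [g]. *)
Lemma fundamental_lemma_rv (W : set rv) (g : rv -> R) : open W -> (mux W < +oo)%E ->
  inL2 mux W g ->
  (forall n a b, rv_cbox a b `<=` W -> ip mux W g (rv_bump n a b) = 0) ->
  ae_eq mux W g (fun=> 0).
Proof.
move=> oW Woo gW H; have mW := open_measurable_rv oW.
pose I : set (measurableTypeR R) := `]0%R, 1%R[%classic.
have mI : measurable I by exact: measurable_itv.
have I1 : lebesgue_measure I = 1%E.
  by rewrite /I lebesgue_measure_itv/= lte_fin ltr01 sube0.
have Ioo : (lebesgue_measure I < +oo)%E by rewrite I1 ltry.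
have oD : open (I `*` W : set (R * rv)).
  apply: (@openI _ [set z : R * rv | I z.1] [set z | W z.2]).
    by apply: (@open_comp _ _ fst) => [z _|]; [exact: cvg_fst|exact: interval_open].
  by apply: (@open_comp _ _ snd) => // z _; exact: cvg_snd.
have gD := inL2_cylinder_snd mI mW Ioo gW.
have mD := measurable_cylinder mI mW.
have Doo : (mu_tx R d (I `*` W) < +oo)%E.
  have -> : (mu_tx R d (I `*` W) = lebesgue_measure I * mux W)%E.
    exact: product_measure1E.
  by rewrite I1 mul1e.
have : ae_eq (mu_tx R d) (I `*` W) (fun z => g z.2) (fun=> 0).
  apply: fundamental_lemma => // n a b abD.
  pose tb t : R := flat_exp 0 (n.+1%:R * (t - a ord0)) * flat_exp 0 (n.+1%:R * (b ord0 - t)).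
  pose rb := rv_bump n (fun j => a (lift ord0 j)) (fun j => b (lift ord0 j)).
  (* An empty time interval makes the bump zero; otherwise the points at time [a ord0] of the closed
     box show that its spatial part lies in [W]. *)
  have [ab0|ab0] := ltP (b ord0) (a ord0).
    rewrite ip_sym (_ : bump n a b = (fun=> 0)) ?ip_0l//.
    apply/funext => z; apply: bump_out => /(_ ord0)/andP[a0 b0].
    by have := lt_trans (lt_trans a0 b0) ab0; rewrite ltxx.
  have rbW : ip mux W g rb = 0.
    apply: H => x xab; have [] : (I `*` W) (a ord0, x).
      apply: abD => k; case: (unliftP ord0 k) => [j|] ->.
        by rewrite coord_lift; exact: xab.
      by rewrite coord0/= lexx.
    by [].
  have bD : inL2 (mu_tx R d) (I `*` W) (bump n a b).
    apply: (inL2_bounded (C := 1)) => //.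
      by apply: measurable_funTS; apply: smooth_measurable; exact: smooth_bump.
    by move=> z _; rewrite ger0_norm ?bump_ge0 ?bump_le1.
  have gb : (mu_tx R d).-integrable (I `*` W) (fun z => (g z.2 * bump n a b z)%:E).
    exact: inL2_mul_integrable.
  have i0 : (mu_tx R d).-integrable (I `*` W) (fun z => (0 : R)%:E) by exact: integrable0.
  rewrite /ip (cylinder_integral_eq mI mW gb i0).
    by rewrite /Rintegral integral0.
  apply: aeW => t _.
  transitivity (\int[mux]_(x in W) (tb t * (g x * rb x))).
    apply: eq_Rintegral => x _; rewrite bump_pair /= -/(tb t) -/(rb x); ring.
  rewrite RintegralZl//; last by apply: inL2_mul_integrable => //; exact: inL2_rv_bump.
  by rewrite -/(ip mux W g rb) rbW mulr0 /Rintegral integral0.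
move=> /(cylinder_ae (I := I) (W := W)) aet.
have [t It Ht] : exists2 t, I t & {ae mux, forall x, W x -> g x = 0}.
  (* Without a good time, the null exceptional set would contain the unit interval. *)
  apply: contrapT => nex; have := aet.
  have nall t : I t -> ~ {ae mux, forall x, W x -> g x = 0} by move=> It Ht; apply: nex; exists t.
  move=> [A [mA A0 IA]]; have : (lebesgue_measure I <= lebesgue_measure A)%E.
    apply: le_measure; rewrite ?inE//.
    by move=> t It; apply: IA => /= /(_ It); exact: nall It.
  by rewrite A0 I1 leNgt lte01.
exact: Ht.
Qed.

End fundamental_lemma_rv.

(** * Time cutoffs and the recovery of initial values *)

Section time_cutoff.
Context (R : realType).
Notation leb := (@lebesgue_measure R).

(** A smooth bump on (-1, 1). It is positive at 0, so [- theta 0] can be cancelled; [cutoff n]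
    compresses it to times below 1/(n+1) in absolute value. *)
Definition theta (s : R) : R := flat_exp 0 (1 + s) * flat_exp 0 (1 - s).

Lemma smooth_theta : smooth (theta : R -> R).
Proof.
apply: smoothM.
- apply: (@smooth_flat_exp_affine _ _ _ (fun v : R => v)); split.
    by move=> z; apply: cvgD; [exact: cvg_cst|exact: cvg_id].
  by move=> t v x; rewrite /GRing.scale/=; ring.
- apply: (@smooth_flat_exp_affine _ _ _ (fun v : R => - v)); split.
    by move=> z; apply: cvgB; [exact: cvg_cst|exact: cvg_id].
  by move=> t v x; rewrite /GRing.scale/=; ring.
Qed.

Definition dtheta (s : R) : R := 'D_1 theta s.

Lemma theta0_gt0 : 0 < theta 0.
Proof. by rewrite /theta addr0 subr0 mulr_gt0// flat_exp_gt0. Qed.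

Lemma theta_ge0 s : 0 <= theta s.
Proof. by rewrite mulr_ge0// flat_exp_ge0. Qed.

Lemma theta_le1 s : theta s <= 1.
Proof. by rewrite mulr_ile1 ?flat_exp_ge0 ?flat_exp0_le1. Qed.

Lemma theta_out s : 1 <= s -> theta s = 0.
Proof. by move=> s1; rewrite /theta [X in _ * X]flat_exp_le0 ?mulr0// subr_le0. Qed.

Lemma continuous_dtheta : continuous dtheta.
Proof. by apply: smooth_continuous; apply: smooth_derive; exact: smooth_theta. Qed.

Lemma is_derive_theta (s : R) : is_derive s (1 : R) theta (dtheta s).
Proof. by constructor => //; apply: smooth_derivable; exact: smooth_theta. Qed.

Lemma dtheta_out s : 1 < s -> dtheta s = 0.
Proof.
move=> s1; have : is_derive s (1 : R) theta 0.
  apply: (@near_eq_is_derive _ _ _ (fun=> 0)) => //.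
  by near=> t; rewrite theta_out// ltW//; near: t; exact: lt_nbhsr.
by have [_ <-] := is_derive_theta s; move=> [_ ->].
Unshelve. all: by end_near. Qed.

Lemma dtheta_bounded : exists2 C, 0 <= C & forall s, 0 <= s -> `|dtheta s| <= C.
Proof.
have /compact_bounded[C [_ HC]] : compact (dtheta @` `[0, 1]%classic).
  by apply: continuous_compact; [exact: continuous_subspaceT continuous_dtheta|exact: segment_compact].
exists (`|C| + 1) => [|s s0]; first by rewrite addr_ge0.
have [s1|s1] := leP s 1; last by rewrite dtheta_out// normr0 addr_ge0.
apply: (HC (`|C| + 1)); first by apply: (le_lt_trans (ler_norm C)); rewrite ltrDl.
by exists s => //=; rewrite in_itv/= s0 s1.
Qed.

Definition cutoff n (t : R) : R := theta (n.+1%:R * t).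
Definition dcutoff n (t : R) : R := n.+1%:R * dtheta (n.+1%:R * t).

Lemma is_derive_cutoff n (t : R) : is_derive t (1 : R) (cutoff n) (dcutoff n t).
Proof.
have dl : is_derive t (1 : R) (fun t : R => n.+1%:R * t) n.+1%:R.
  have := is_deriveZ (n.+1%:R : R) (is_derive_id t (1 : R)).
  by move=> H; apply: (is_derive_eq H); rewrite [LHS]mulr1.
have := is_derive1_comp (g := fun t : R => n.+1%:R * t) (is_derive_theta _) dl.
by move=> H; apply: (is_derive_eq H); rewrite mulrC.
Qed.

Lemma continuous_dcutoff n : continuous (dcutoff n).
Proof.
move=> t; apply: cvgM; first exact: cvg_cst.
apply: continuous_comp; last exact: continuous_dtheta.
by apply: cvgM; [exact: cvg_cst|exact: cvg_id].
Qed.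

Lemma dcutoff_integrable n (a b : R) : leb.-integrable `]a, b[ (fun t => (dcutoff n t)%:E).
Proof.
have : leb.-integrable `[a, b] (EFin \o dcutoff n).
  apply: continuous_compact_integrable; first exact: segment_compact.
  exact: continuous_subspaceT (@continuous_dcutoff n).
apply: integrableS; [exact: measurable_itv|exact: measurable_itv|].
by move=> t /=; rewrite !in_itv/= => /andP[/ltW -> /ltW ->].
Qed.

(** The cutoff has already vanished at [b], so only its value at 0 survives. The total mass does not
    depend on [n]. *)
Lemma integral_dcutoff n (b : R) : 0 < b -> 1 <= n.+1%:R * b ->
  \int[leb]_(t in `]0, b[) dcutoff n t = - theta 0.
Proof.
move=> b0 nb.
rewrite Rintegral_itv_bndo_bndc; last exact: dcutoff_integrable.
rewrite Rintegral_itv_obnd_cbnd; last first.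
  have : leb.-integrable `[0, b] (EFin \o dcutoff n).
    apply: continuous_compact_integrable; first exact: segment_compact.
    exact: continuous_subspaceT (@continuous_dcutoff n).
  apply: integrableS; [exact: measurable_itv|exact: measurable_itv|].
  by move=> t /=; rewrite !in_itv/= => /andP[/ltW -> ->].
rewrite /Rintegral (@continuous_FTC2 _ (dcutoff n) (cutoff n) 0 b b0).
- by rewrite /= /cutoff mulr0 theta_out// sub0r.
- exact: continuous_subspaceT (@continuous_dcutoff n).
- have cc : continuous (cutoff n).
    move=> t; apply: differentiable_continuous; apply/derivable1_diffP.
    by have [] := is_derive_cutoff n t.
  split; first by move=> t _; have [] := is_derive_cutoff n t.
  + by apply: cvg_at_right_filter; exact: cc.
  + by apply: cvg_at_left_filter; exact: cc.
- by move=> t _; rewrite derive1E; have [] := is_derive_cutoff n t.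
Qed.

End time_cutoff.

Section initial_values.
Context (R : realType) (d : nat) (Omega : set 'rV[R]_d) (Tend : R).
Notation leb := (@lebesgue_measure R).
Notation mux := (mu_x R d).
Notation ptM := (measurableTypeR R * 'rV[R]_d)%type.
Notation I := (`]0, Tend[%classic : set (measurableTypeR R)).
Notation Q := (Qdom Omega Tend).
Hypotheses (oO : open Omega) (Ooo : (mux Omega < +oo)%E) (Tend0 : 0 < Tend).
Let mO : measurable Omega := open_measurable_rv oO.
Let mI : measurable I := measurable_itv _.

Lemma measurable_Q : measurable (Q : set ptM).
Proof. exact: measurable_cylinder. Qed.

Lemma mu_Q_lty : (mu_tx R d Q < +oo)%E.
Proof.
have -> : (mu_tx R d Q = lebesgue_measure I * mux Omega)%E by exact: product_measure1E.
by rewrite lebesgue_measure_itv/= lte_fin Tend0 sube0 lte_mul_pinfty// ltW.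
Qed.

Lemma initial_value_inL2 v g : initial_value Omega Tend v g -> inL2 mux Omega g.
Proof. by move=> [vt [H _ _ <-]]; apply: H; rewrite lexx ltW. Qed.

Lemma dcutoff_bump_inL2 n m a b : inL2 (mu_tx R d) Q
  (fun z : ptM => dcutoff n z.1 * rv_bump m a b z.2).
Proof.
have [C C0 HC] := dtheta_bounded R.
apply: (inL2_bounded (C := n.+1%:R * C)); [exact: measurable_Q|exact: mu_Q_lty| |].
- apply: measurable_funTS; apply: measurable_funM.
    apply: continuous_measurable_pt => z; apply: continuous_comp; first exact: cvg_fst.
    exact: continuous_dcutoff.
  by apply: measurableT_comp => //; exact: measurable_rv_bump.
- move=> z [/= + _]; rewrite in_itv/= => /andP[z0 _].
  rewrite normrM /dcutoff normrM ger0_norm//.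
  rewrite -[leRHS]mulr1 ler_pM ?mulr_ge0//.
    by rewrite ler_wpM2l// HC// mulr_ge0// ltW.
  by rewrite ger0_norm ?rv_bump_ge0 ?rv_bump_le1.
Qed.

(* The derivative of the cutoff is minus an approximate identity at t = 0. *)
Lemma initial_value_limit v g m a b : inL2 (mu_tx R d) Q v ->
  initial_value Omega Tend v g ->
  ip (mu_tx R d) Q v (fun z : ptM => dcutoff n z.1 * rv_bump m a b z.2) @[n --> \oo] -->
  - theta 0 * ip mux Omega g (rv_bump m a b).
Proof.
move=> vQ [vt [vtL vtC vae vt0]]; set psi := rv_bump m a b.
have psiL : inL2 mux Omega psi by exact: inL2_rv_bump.
pose c t := ip mux Omega (vt t) psi.
have [C C0 HC] := dtheta_bounded R.
have T0 : 0 <= (0 : R) <= Tend by rewrite lexx ltW.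
have psin := ip_ge0 mux Omega psi.
apply/cvgrPdist_le => e e0.
(* Closeness [e1] of the slices gives closeness [e / (C + 1)] after pairing with [psi], and [C]
   bounds [dtheta]; adding 1 keeps both denominators positive. *)
pose e1 := e / (C + 1) / (norm2 mux Omega psi + 1).
have p1 : 0 < norm2 mux Omega psi + 1 by rewrite ltr_wpDl ?sqrtr_ge0.
have C1 : 0 < C + 1 by rewrite ltr_wpDl.
have e10 : 0 < e1 by rewrite !divr_gt0.
have [delta dl0 Hdl] := vtC 0 T0 e1 e10.
have cdiff s : 0 <= s <= Tend -> `|s| < delta -> `|c s - c 0| <= e / (C + 1).
  move=> sT sdl; have sL := vtL s sT; have L0 := vtL 0 T0.
  have dL : inL2 mux Omega (fun x => vt s x - vt 0 x) by exact: inL2_B.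
  have -> : c s - c 0 = ip mux Omega (fun x => vt s x - vt 0 x) psi.
    have := ip_lin (-1) mO L0 sL psiL; rewrite mulN1r addrC => <-.
    by congr ip; apply/funext => x; rewrite mulN1r addrC.
  have H := Hdl s sT; rewrite subr0 in H; have {}H := H sdl.
  have CS : `|ip mux Omega (fun x => vt s x - vt 0 x) psi| <=
      norm2 mux Omega (fun x => vt s x - vt 0 x) * norm2 mux Omega psi.
    have sip : semi_ip (V := 'rV[R]_d -> R) (inL2 mux Omega) (ip mux Omega).
      split => //.
      - by split=> [|k f f' fL fL']; [exact: inL2_0|exact: inL2_lin].
      - by move=> k f f' h fL fL' hL; exact: ip_lin.
      - by move=> f f' _ _; exact: ip_sym.
      - by move=> f _; exact: ip_ge0.
    exact: (sip_CS_sqrt sip dL psiL).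
  apply: (le_trans CS); apply: (@le_trans _ _ (e1 * norm2 mux Omega psi)).
    by rewrite ler_wpM2r ?sqrtr_ge0// ltW.
  rewrite /e1 -mulrA ler_piMr//; first by rewrite divr_ge0// ltW.
  by rewrite mulrC ler_pdivrMr// mul1r lerDl.
near=> n.
have nT : 1 <= n.+1%:R * Tend.
  rewrite -ler_pdivrMr// div1r; near: n.
  near=> k; apply: (@le_trans _ _ k%:R); last by rewrite ler_nat.
  by near: k; exact: nbhs_infty_ger.
have ndl : n.+1%:R^-1 < delta by near: n; exact: (@near_infty_natSinv_lt R (PosNum dl0)).
have kL := @dcutoff_bump_inL2 n m a b; rewrite -/psi in kL.
have vk := inL2_mul_integrable measurable_Q vQ kL.
have [_ intH HE] := cylinder_fubini mI mO vk.
pose H t := \int[mux]_(x in Omega) (v (t, x) * (dcutoff n t * psi x)).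
have HE' : ip (mu_tx R d) Q v (fun z : ptM => dcutoff n z.1 * psi z.2) = \int[leb]_(t in I) H t by exact: HE.
have aeH : {ae leb, forall t : measurableTypeR R, I t -> H t = dcutoff n t * c t}.
  have vL := cylinder_inL2 mI mO vQ.
  have vae' : {ae leb, forall t : measurableTypeR R, 0 < t < Tend ->
      {ae mux, forall x, Omega x -> v (t, x) = vt t x}} by exact: vae.
  apply: filterS2 vae' vL => t Ht Lt It.
  have tT : 0 < t < Tend by move: It; rewrite /= in_itv.
  have tT' : 0 <= t <= Tend by case/andP : tT => /ltW -> /ltW ->.
  have {}Ht := Ht tT; have {}Lt := Lt It.
  have -> : H t = dcutoff n t * ip mux Omega (fun x => v (t, x)) psi.
    rewrite /ip -RintegralZl//; last exact: inL2_mul_integrable.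
    by apply: eq_Rintegral => x _; rewrite mulrCA.
  congr (_ * _); apply: ip_ae => //; try exact: inL2_measurable.
  - by apply: (inL2_measurable mO); exact: Lt.
  - by apply: (inL2_measurable mO); exact: vtL.
  - by apply: (inL2_measurable mO); exact: psiL.
  - by apply: (inL2_measurable mO); exact: psiL.
  - exact: ae_eq_refl.
have intk := dcutoff_integrable n 0 Tend.
have ikc : leb.-integrable I (fun t => (dcutoff n t * c 0)%:E).
  exact: (integrableZr mI (c 0) intk).
have E0 : - theta 0 * ip mux Omega g psi = \int[leb]_(t in I) (dcutoff n t * c 0).
  by rewrite RintegralZr// integral_dcutoff// /c vt0.
rewrite E0 HE' distrC -RintegralB//.
pose J : set (measurableTypeR R) := `[0, n.+1%:R^-1]%classic.
have mJ : measurable J by exact: measurable_itv.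
(* The derivative of the cutoff is at most [C * n.+1%:R] and lives on the interval [J] of length
   1/(n+1), so this majorant integrates to at most [e * C / (C + 1)]. *)
pose bd (t : R) := (e / (C + 1) * C * n.+1%:R) * \1_J t.
have eC0 : 0 <= e / (C + 1) by rewrite divr_ge0// ltW.
have Ioo : (leb I < +oo)%E by rewrite lebesgue_measure_itv/= lte_fin Tend0 sube0 ltry.
have iJ : leb.-integrable I (fun t => (\1_J t : R)%:E).
  apply: (@measurable_bounded_integrable _ _ _ leb (\1_J)) => //.
  exists 1; split; first exact: num_real.
    by move=> M M1 t _; rewrite /= indicE ger0_norm ?ler0n// (le_trans _ (ltW M1))// lern1 leq_b1.
have ibd : leb.-integrable I (fun t => (bd t)%:E).
  exact: (integrableZl mI _ iJ).
apply: (@le_trans _ _ (\int[leb]_(t in I) bd t)).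
  apply: ae_norm_Rintegral_le => //.
  - exact: (integrableB mI intH ikc).
  - move=> t _; apply: mulr_ge0; last by rewrite indicE ler0n.
    by apply: mulr_ge0 => //; exact: mulr_ge0.
  apply: filterS aeH => t Ht It; rewrite (Ht It).
  have tT : 0 < t < Tend by move: It; rewrite /= in_itv.
  have t0 : 0 <= t by case/andP : tT => /ltW.
  rewrite -mulrBr normrM /bd indicE.
  have [tJ|tJ] := boolP (t \in J).
    have -> : e / (C + 1) * C * n.+1%:R * 1 = (n.+1%:R * C) * (e / (C + 1)).
      by rewrite mulr1 mulrC mulrA mulrAC.
    rewrite /dcutoff normrM (ger0_norm (ler0n _ _)) ler_pM ?mulr_ge0//.
      by rewrite ler_wpM2l// HC// mulr_ge0.
    apply: cdiff; first by case/andP : tT => /ltW -> /ltW ->.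
    rewrite ger0_norm//; apply: le_lt_trans ndl.
    by move: tJ; rewrite inE /J/= in_itv/= => /andP[].
  rewrite mulr0 /dcutoff dtheta_out ?mulr0 ?normr0 ?mul0r//.
  rewrite ltNge; apply: contraNN tJ => tn; rewrite inE /J/= in_itv/= t0/=.
  by rewrite -[leRHS]mulr1 ler_pdivlMl.
rewrite /bd RintegralZl//.
have -> : \int[leb]_(t in I) (\1_J t : R) = fine (leb (J `&` I)).
  by rewrite /Rintegral integral_indic// setIC.
have JI : (fine (leb (J `&` I)) <= n.+1%:R^-1).
  have lJ : leb J = (n.+1%:R^-1)%:E.
    by rewrite /J lebesgue_measure_itv/= lte_fin invr_gt0 ltr0n sube0.
  have JIJ : (leb (J `&` I) <= leb J)%E by apply: le_measure; rewrite ?inE//; exact: measurableI.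
  rewrite lJ in JIJ; rewrite -lee_fin fineK//.
  by rewrite ge0_fin_numE//; apply: le_lt_trans JIJ _; rewrite ltry.
apply: (@le_trans _ _ (e / (C + 1) * C * n.+1%:R * n.+1%:R^-1)).
  by apply: ler_wpM2l => //; apply: mulr_ge0 => //; exact: mulr_ge0.
rewrite mulfK ?pnatr_eq0// -mulrA ler_piMr ?(ltW e0)//.
by rewrite mulrC ler_pdivrMr// mul1r lerDl.
Unshelve. all: by end_near. Qed.

End initial_values.

(** * Geometry of Lipschitz domains, simplices and mesh cells *)

Section euclidean.
Context (R : realType) (d : nat).
Implicit Types (x y : 'rV[R]_d).

Lemma dotv_semi_ip : semi_ip setT (@dotv R d).
Proof.
split => //.
- move=> a u v w _ _ _; rewrite /dotv mulr_sumr -big_split/=.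
  by apply: eq_bigr => i _; rewrite !mxE mulrDl mulrA.
- by move=> u v _ _; apply: eq_bigr => i _; rewrite mulrC.
- by move=> u _; apply: sumr_ge0 => i _; rewrite -expr2 sqr_ge0.
Qed.

Lemma dotv_le x y : `|dotv x y| <= enorm x * enorm y.
Proof. exact: (sip_CS_sqrt dotv_semi_ip). Qed.

Lemma smooth_rv_coord (i : 'I_d) : smooth (fun x : 'rV[R]_d => x ord0 i).
Proof.
apply: (@smooth_affine _ _ _ (fun x : 'rV[R]_d => x ord0 i)); split.
  exact: coord_continuous.
by move=> t v x; rewrite !mxE.
Qed.

Lemma continuous_dotv_sub y : continuous (fun x => dotv (x - y) (x - y)).
Proof.
apply: smooth_continuous; apply: smooth_sum => i _.
have s : smooth (fun x : 'rV[R]_d => (x - y) ord0 i).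
  have -> : (fun x : 'rV[R]_d => (x - y) ord0 i) = (fun x => x ord0 i + - y ord0 i).
    by apply/funext => x; rewrite !mxE.
  by apply: smoothD; [exact: smooth_rv_coord|exact: smooth_cst].
exact: smoothM.
Qed.

(** The topology comes from the maximum norm; continuity of the quadratic form makes Euclidean balls
    neighbourhoods. *)
Lemma enorm_ball_nbhs y r : 0 < r -> nbhs y [set x | enorm (x - y) < r].
Proof.
move=> r0; have r20 : 0 < r ^+ 2 by rewrite exprn_gt0.
have : nbhs y [set x | dotv (x - y) (x - y) < r ^+ 2].
  apply: (@continuous_dotv_sub y y [set s | s < r ^+ 2]).
  rewrite subrr /dotv big1 => [|i _]; last by rewrite mxE mul0r.
  exact: lt_nbhsl.
apply: filterS => x /= H; rewrite -(ltr_pXn2r (ltn0Sn 1)) ?nnegrE ?sqrtr_ge0 ?ltW//.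
by rewrite /enorm sqr_sqrtr// (sip_ge0 dotv_semi_ip).
Qed.

(** At a boundary point the domain lies above a Lipschitz graph. A small step downwards reaches a
    point with a whole neighbourhood below the graph, hence outside the closure; so a boundary point
    is not interior to the closure. *)
Lemma lipschitz_interior_closure (Omega : set 'rV[R]_d) : open Omega ->
  lipschitz_boundary Omega -> interior (closure Omega) `<=` Omega.
Proof.
move=> oO lip x xint; apply: contrapT => nOx.
have [e [r [L [g [r0 e1 ge gL gO]]]]] := lip x (interior_subset xint) nOx.
have ee : dotv e e = 1.
  have : enorm e ^+ 2 = 1 by rewrite e1 expr1n.
  by rewrite /enorm sqr_sqrtr// (sip_ge0 dotv_semi_ip).
have enormZ s : enorm (s *: e) = `|s|.
  by rewrite /enorm (sip_Zl dotv_semi_ip)// (sip_Zr dotv_semi_ip)// ee mulr1 -expr2 sqrtr_sqr.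
have enorm0 : enorm (0 : 'rV[R]_d) = 0.
  by rewrite /enorm (sip_0l dotv_semi_ip)// sqrtr0.
have gx : dotv x e <= g x.
  by rewrite leNgt; apply/negP => /(gO x _).2; rewrite subrr enorm0 => /(_ r0).
have cl : continuous (fun s : R => x - s *: e).
  by move=> s; apply: cvgB; [exact: cvg_cst|apply: cvgZr_tmp; exact: cvg_id].
have near0 : \forall s \near (0 : R), closure Omega (x - s *: e).
  by have := cl 0 (closure Omega); rewrite scale0r subr0; apply; exact: xint.
have /nbhs_ballP[del /= del0 Hdel] := near0.
(* A downward step below [del] stays in the closure, and [r / 2] leaves room for a further
   perturbation inside the chart of radius [r]. *)
pose s := Num.min (del / 2) (r / 2).
have s0 : 0 < s by rewrite /s lt_min !divr_gt0.
have sdel : s < del by rewrite /s gt_min ltr_pdivrMr// ltr_pMr// ltr1n.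
have sr : s <= r / 2 by rewrite /s ge_min lexx orbT.
pose y := x - s *: e.
have yc : closure Omega y by apply: Hdel; rewrite /ball/= sub0r normrN gtr0_norm.
have gy : g y = g x by rewrite /y -scaleNr ge.
have ye : dotv y e = dotv x e - s.
  by rewrite /y (sip_Bl dotv_semi_ip)// (sip_Zl dotv_semi_ip)// ee mulr1.
(* Within [rho] of [y] the graph and the height together change by less than [s], the depth of [y]
   below the graph. *)
pose rho := Num.min (r / 2) (s / (`|L| + 2)).
have L2 : 0 < `|L| + 2 by rewrite ltr_wpDl.
have rho0 : 0 < rho by rewrite lt_min !divr_gt0.
have [y' [Oy' /= y'y]] := yc _ (enorm_ball_nbhs y rho0).
have n0 : 0 <= enorm (y' - y) by exact: sqrtr_ge0.
have triang : enorm (y' - x) < r.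
  have -> : y' - x = (y' - y) + (- s) *: e by rewrite /y scaleNr opprB addrA addrAC addrK.
  set u := y' - y; have un : enorm u < r / 2 by move: y'y; rewrite lt_min => /andP[].
  have E : dotv (u + - s *: e) (u + - s *: e) = enorm u ^+ 2 + 2 * - s * dotv u e + s ^+ 2.
    have := sip_sqrD dotv_semi_ip 1 (- s) (I : setT u) (I : setT e).
    rewrite scale1r => ->; rewrite ee expr1n mul1r mulr1 sqrrN /enorm sqr_sqrtr ?mulr1//.
    exact: (sip_ge0 dotv_semi_ip).
  have ue : - dotv u e <= enorm u.
    by have := dotv_le u e; rewrite e1 mulr1 ler_norml lerNl => /andP[].
  have : dotv (u + - s *: e) (u + - s *: e) <= (enorm u + s) ^+ 2.
    rewrite E sqrrD; have := ler_wpM2l (ltW s0) ue; set p := dotv u e; set q := enorm u.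
    by rewrite mulr2n; lra.
  rewrite -(ler_sqrt _ (sqr_ge0 _)) sqrtr_sqr ger0_norm ?addr_ge0 ?sqrtr_ge0 ?(ltW s0)//.
  by move=> H; apply: (le_lt_trans H); lra.
have /(gO y' triang).1 gy' := Oy'.
have Lip : `|g y' - g y| <= `|L| * enorm (y' - y).
  by apply: (le_trans (gL _ _)); rewrite ler_wpM2r// ler_norm.
have dy' : `|dotv (y' - y) e| <= enorm (y' - y).
  by have := dotv_le (y' - y) e; rewrite e1 mulr1.
rewrite (sip_Bl dotv_semi_ip)// ye in dy'.
have small : (`|L| + 2) * enorm (y' - y) < s.
  move: y'y; rewrite lt_min => /andP[_]; rewrite ltr_pdivlMr// mulrC; exact.
move: Lip dy' small; rewrite gy !ler_norml => /andP[l1 l2] /andP[d1 d2].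
rewrite mulrDl; set q := enorm (y' - y) in n0 l1 l2 d1 d2 *.
set Lq := `|L| * q in l1 l2 *; lra.
Qed.

End euclidean.

Section simplices.
Context (R : realType) (d : nat).
Implicit Types (V : 'M[R]_(d.+1, d)) (x : 'rV[R]_d).

Definition simplex_mx V : 'M[R]_(d.+1) := row_mx (const_mx 1 : 'cV[R]_d.+1) V.

(** The barycentric coordinates solve one square system, whose first column says that they sum to 1;
    affine independence of the vertices makes the matrix invertible. *)
Definition bary_coord V x : 'rV[R]_d.+1 :=
  (row_mx (1%:M : 'M[R]_1) x : 'rV[R]_d.+1) *m invmx (simplex_mx V).

Lemma simplex_mxE V (l : 'rV[R]_d.+1) :
  l *m simplex_mx V = row_mx ((\sum_i l ord0 i)%:M : 'M[R]_1) (l *m V).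
Proof.
apply: (etrans (mul_mx_row l (const_mx 1 : 'cV[R]_d.+1) V)); congr row_mx; apply/matrixP => i j.
by rewrite !mxE (ord1 i) (ord1 j) eqxx mulr1n; apply: eq_bigr => k _; rewrite mxE mulr1.
Qed.

Lemma simplex_bary V x : affine_independent V ->
  simplex V x -> forall i, 0 <= bary_coord V x ord0 i.
Proof.
move=> ai [l [l0 l1] xE] i; have uB : simplex_mx V \in unitmx by rewrite -row_free_unit.
have E : (row_mx (1%:M : 'M[R]_1) x : 'rV[R]_d.+1) = l *m simplex_mx V.
  by rewrite simplex_mxE l1 xE.
by rewrite /bary_coord E mulmxK.
Qed.

Lemma bary_simplex V x : affine_independent V ->
  (forall i, 0 <= bary_coord V x ord0 i) -> simplex V x.
Proof.
move=> ai l0; have uB : simplex_mx V \in unitmx by rewrite -row_free_unit.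
have : bary_coord V x *m simplex_mx V = row_mx (1%:M : 'M[R]_1) x by rewrite mulmxKV.
rewrite simplex_mxE => E; have [/matrixP/(_ ord0 ord0) E1 E2] := @eq_row_mx _ 1 1 d _ _ _ _ E.
rewrite !mxE !mulr1n in E1.
by exists (bary_coord V x).
Qed.

Lemma bary_coord_affine V i : exists (a : 'rV[R]_d) (c : R),
  forall x, bary_coord V x ord0 i = c + dotv a x.
Proof.
pose B := invmx (simplex_mx V).
exists (\row_j B (lift ord0 j) i), (B ord0 i) => x.
rewrite /bary_coord mxE big_ord_recl; congr (_ + _).
  rewrite [X in X * _]mxE; case: splitP => [j _|j]; last by [].
  by rewrite mxE (ord1 j) mul1r.
apply: eq_bigr => j _; rewrite [X in X * _]mxE; case: splitP => [k|k].
  by rewrite (ord1 k).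
rewrite lift0 add1n => -[jk].
by rewrite mxE mulrC (_ : k = j)//; exact/val_inj.
Qed.

(** The coordinate is 1 at its own vertex and 0 at another one, which exists for [0 < d]; an affine
    function with zero slope cannot do this. Its zero set is thus a genuine hyperplane. *)
Lemma bary_coord_nonconst V i : (0 < d)%N -> affine_independent V ->
  exists (a : 'rV[R]_d) (c : R), a != 0 /\
  forall x, bary_coord V x ord0 i = c + dotv a x.
Proof.
move=> d0 ai; have [a [c H]] := bary_coord_affine V i; exists a, c; split => //.
apply/eqP => a0; have uB : simplex_mx V \in unitmx by rewrite -row_free_unit.
have vtx k : bary_coord V (row k V) ord0 i = (k == i)%:R.
  have E : (row_mx (1%:M : 'M[R]_1) (row k V) : 'rV[R]_d.+1) = row k (simplex_mx V).
    rewrite /simplex_mx; apply: (etrans _ (esym (row_row_mx k (const_mx 1 : 'cV[R]_d.+1) V))).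
    congr row_mx; apply/matrixP => a' b'.
    by rewrite !mxE (ord1 a') (ord1 b').
  by rewrite /bary_coord E -row_mul mulmxV// !mxE.
have d0' x : dotv a x = 0 by rewrite a0 /dotv big1// => j _; rewrite mxE mul0r.
have [k ki] : exists k : 'I_d.+1, k != i.
  have [->|i0] := eqVneq i ord0; last by exists ord0; rewrite eq_sym.
  by exists (lift ord0 (Ordinal d0)).
have := vtx k; have := vtx i; rewrite !H !d0' eqxx (negbTE ki) => ->/eqP.
by rewrite oner_eq0.
Qed.

End simplices.

Section ae_tools.
Context (R : realType) (d : nat).
Notation ptM := (measurableTypeR R * 'rV[R]_d)%type.
Notation mu := (mu_tx R d).

Lemma ae_time_neq (c : R) : {ae mu, forall z : ptM, z.1 <> c}.
Proof.
exists ([set c] `*` setT); split.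
- by apply: measurableX => //; rewrite -set_itv1; exact: measurable_itv.
- have -> : (mu ([set c] `*` setT) = lebesgue_measure ([set c] : set (measurableTypeR R)) * lebesgue_rv R d setT)%E.
    by apply: product_measure1E => //; rewrite -set_itv1; exact: measurable_itv.
  by rewrite lebesgue_measure_set1 mul0e.
- by move=> z /= /contrapT ->.
Qed.

Lemma ae_hyperplane (a : 'rV[R]_d) (c : R) : a != 0 ->
  {ae mu, forall z : ptM, c + dotv a z.2 <> 0}.
Proof.
move=> a0; pose H : set 'rV[R]_d := [set x | dotv a x = - c].
have mH : measurable H.
  have : measurable_fun setT (fun x : 'rV[R]_d => dotv a x).
    apply: continuous_measurable_rv; apply: smooth_continuous; apply: smooth_sum => i _.
    by apply: smoothM; [exact: smooth_cst|exact: smooth_rv_coord].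
  move=> /(_ measurableT [set - c]); rewrite setTI; apply.
  exact: measurable_set1.
exists (setT `*` H); split.
- exact: measurableX.
- have -> : (mu (setT `*` H) = lebesgue_measure (setT : set (measurableTypeR R)) * lebesgue_rv R d H)%E.
    exact: product_measure1E.
  by rewrite [X in (_ * X)%E](mu_x_hyperplane _ a0) mule0.
- move=> z /= /contrapT zE; split => //=; apply/eqP; rewrite -subr_eq0 opprK addrC.
  exact/eqP.
Qed.

End ae_tools.

Section mesh_facts.
Context (R : realType) (d : nat) (Omega : set 'rV[R]_d) (Tend : R) (N : nat).
Context (K : 'I_N -> cell R d) (kappa : R).
Hypotheses (hd : (0 < d)%N) (hOmega : polyhedral_lipschitz_domain Omega).
Hypothesis hTend : 0 < Tend.
Hypothesis hK : space_time_partition Omega Tend K kappa.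
Notation pt := (R * 'rV[R]_d)%type.
Notation ptM := (measurableTypeR R * 'rV[R]_d)%type.
Notation mu := (mu_tx R d).
Notation Q := (Qdom Omega Tend).

Lemma open_Omega : open Omega.
Proof. by have [[]] := hOmega. Qed.

Lemma open_Q : open Q.
Proof.
apply: (@openI _ [set z : pt | (`]0, Tend[%classic : set R) z.1] [set z | Omega z.2]).
  by apply: (@open_comp _ _ fst) => [z _|]; [exact: cvg_fst|exact: interval_open].
by apply: (@open_comp _ _ snd) => [z _|]; [exact: cvg_snd|exact: open_Omega].
Qed.

Lemma open_Kint i : open (Kint K i).
Proof. exact: open_interior. Qed.

Lemma Omega_bounded : exists M, forall x, Omega x -> forall j, - M <= x ord0 j <= M.
Proof.
have [[_ _ _ [M [_ HM]]] _] := hOmega.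
exists (M + 1) => x Ox j; rewrite -ler_norml.
have := HM (M + 1); rewrite ltrDl ltr01 => /(_ isT x Ox).
apply: le_trans; rewrite [leRHS]mx_normrE.
exact: (le_bigmax _ (fun ij => `|x ij.1 ij.2|) (ord0, j)).
Qed.

Lemma Q_bounded : exists M, Q `<=` cbox (fun=> - M) (fun=> M).
Proof.
have [M HM] := Omega_bounded; exists (Num.max M Tend) => z [/= z1 z2] k.
have MT : M <= Num.max M Tend by rewrite le_max lexx.
have TT : Tend <= Num.max M Tend by rewrite le_max lexx orbT.
case: (unliftP ord0 k) => [j|] ->.
  rewrite coord_lift; have := HM _ z2 j => /andP[H1 H2].
  by rewrite (le_trans H2 MT) andbT; apply: le_trans H1; rewrite lerN2.
rewrite coord0; move: z1; rewrite in_itv/= => /andP[H1 H2].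
rewrite (le_trans (ltW H2) TT) andbT (le_trans _ (ltW H1))// oppr_le0.
exact: le_trans (ltW hTend) TT.
Qed.

Lemma mu_x_Omega_lty : (mu_x R d Omega < +oo)%E.
Proof.
have [M HM] := Omega_bounded.
have [r [E _ _]] := mu_x_rv_obox (fun _ : 'I_d => - (M + 1)) (fun=> M + 1).
apply: (@le_lt_trans _ _ (r%:E)); last exact: ltry.
rewrite -E; apply: le_measure; rewrite ?inE.
- exact: open_measurable_rv open_Omega.
- exact: measurable_rv_obox.
- by move=> x /HM H j; have := H j; lra.
Qed.

Lemma cell_closure i : cell_set (K i) `<=` closure Q.
Proof. by rewrite (mesh_cover hK) => z zi; exists i. Qed.

Lemma cell_bounded : exists M, forall i, cell_set (K i) `<=` cbox (fun=> - M) (fun=> M).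
Proof.
have [M HM] := Q_bounded; exists M => i z /cell_closure zQ.
rewrite ((closure_id (cbox (fun _ : 'I_d.+1 => - M) (fun=> M))).1 (@cbox_closed R d _ _)).
exact: closure_subset zQ.
Qed.

Lemma Kint_cell i : Kint K i `<=` cell_set (K i).
Proof. exact: interior_subset. Qed.

(** An interior point of a cell is interior to the closure of Q. Shifts by [e / 2] in both time
    directions make the time bounds strict, and the Lipschitz boundary handles space. *)
Lemma Kint_subset_Q i : Kint K i `<=` Q.
Proof.
move=> z /nbhs_ballP[e /= e0 ze].
have ce : ball z e `<=` closure Q by move=> y /ze /cell_closure.
have c1 : closure Q `<=` [set y : pt | (`[0, Tend]%classic : set R) y.1].
  have cl : closed [set y : pt | (`[0, Tend]%classic : set R) y.1].
    by apply: (@closed_comp _ _ fst) => [y _|]; [exact: cvg_fst|exact: interval_closed].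
  rewrite [X in _ `<=` X]((closure_id _).1 cl); apply: closure_subset => y [/= + _].
  by rewrite /= !in_itv/= => /andP[/ltW -> /ltW ->].
have c2 : closure Q `<=` [set y : pt | closure Omega y.2].
  have cl : closed [set y : pt | closure Omega y.2].
    by apply: (@closed_comp _ _ snd) => [y _|]; [exact: cvg_snd|exact: closed_closure].
  rewrite [X in _ `<=` X]((closure_id _).1 cl); apply: closure_subset => y [/= _ y2].
  exact: subset_closure.
have tb s : `|s| < e -> 0 <= z.1 + s <= Tend.
  move=> se; have : ball z e (z.1 + s, z.2).
    by split => /=; [rewrite /ball/= opprD addrA subrr sub0r normrN|exact: ballxx].
  by move=> /ce /c1; rewrite /= in_itv.
split=> /=.
  rewrite in_itv/=; have e2 : `|e / 2| < e.
    by rewrite gtr0_norm ?divr_gt0// ltr_pdivrMr// ltr_pMr// ltr1n.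
  have := tb (e / 2) e2; have := tb (- (e / 2)); rewrite normrN => /(_ e2).
  by lra.
apply: lipschitz_interior_closure; [exact: open_Omega|by have [_ []] := hOmega|].
apply/nbhs_ballP; exists e => //= y zy; apply: (c2 (z.1, y)); apply: ce.
by split => //=; exact: ballxx.
Qed.

Lemma Kint_disjoint i j z : Kint K i z -> Kint K j z -> i = j.
Proof.
move=> zi zj; apply/eqP; apply: contraT => ij.
have := mesh_nonoverlapping hK ij; rewrite -subset0 => /(_ z); case; exact.
Qed.

(** Off the two end times and the zero sets of the barycentric coordinates, all null, a point of the
    cell satisfies strict inequalities, and these describe an open subset of the cell. *)
Lemma cell_ae_Kint i : {ae mu, forall z : ptM, cell_set (K i) z -> Kint K i z}.
Proof.
have [lohi ai] := mesh_nondegenerate hK i.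
have /choice[ac Hac] : forall j : 'I_d.+1, exists ac : 'rV[R]_d * R, ac.1 != 0 /\
    forall x, bary_coord (vtx (K i)) x ord0 j = ac.2 + dotv ac.1 x.
  move=> j; have [a [c [a0 H]]] := bary_coord_nonconst j hd ai.
  by exists (a, c).
have hyp : {ae mu, forall z : ptM, forall j, (ac j).2 + dotv (ac j).1 z.2 <> 0}.
  by apply: filter_forall => j; apply: ae_hyperplane; have [] := Hac j.
apply: filterS3 (ae_time_neq d (t_lo (K i))) (ae_time_neq d (t_hi (K i))) hyp.
move=> z zlo zhi zh [/= z1 z2].
pose P : set pt := [set y : pt | t_lo (K i) < y.1 < t_hi (K i)] `&`
  \bigcap_(j in [set` index_enum 'I_d.+1]) [set y : pt | 0 < (ac j).2 + dotv (ac j).1 y.2].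
have oP : open P.
  apply: openI.
    rewrite (_ : [set _ | _] = [set y : pt | (`]t_lo (K i), t_hi (K i)[%classic : set R) y.1]).
      by apply: (@open_comp _ _ fst) => [y _|]; [exact: cvg_fst|exact: interval_open].
    by apply/seteqP; split=> y /=; rewrite in_itv.
  rewrite bigcap_seq; elim/big_ind: _ => [|A B oA oB|j _]; [exact: openT|exact: openI|].
  apply: (@open_comp _ _ (fun y : pt => (ac j).2 + dotv (ac j).1 y.2) [set r | 0 < r]).
    move=> y _; apply: cvgD; first exact: cvg_cst.
    apply: (@continuous_comp _ _ _ snd (fun x => dotv (ac j).1 x)); first exact: cvg_snd.
    apply: smooth_continuous; apply: smooth_sum => k _.
    by apply: smoothM; [exact: smooth_cst|exact: smooth_rv_coord].
  exact: open_gt.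
have PK : P `<=` cell_set (K i).
  move=> y [/= /andP[y1 y2] yb]; split=> /=.
    by rewrite /cell_t/= in_itv/= (ltW y1) (ltW y2).
  apply: bary_simplex => // j; rewrite (Hac j).2.
  by apply/ltW/yb; rewrite /= mem_index_enum.
have Pz : P z.
  move: z1; rewrite /cell_t/= in_itv/= => /andP[l1 l2]; split=> /=.
    by rewrite !lt_neqAle l1 l2 !andbT; apply/andP; split; apply/eqP => // /esym.
  move=> j _ /=; rewrite lt_neqAle -(Hac j).2 simplex_bary// andbT (Hac j).2 eq_sym.
  by apply/eqP; exact: zh.
by rewrite /Kint /interior; apply: filterS PK _; exact: open_nbhs_nbhs.
Qed.

Lemma ae_cover : {ae mu, forall z : ptM, Q z -> exists i, Kint K i z}.
Proof.
have : {ae mu, forall z : ptM, forall i, cell_set (K i) z -> Kint K i z}.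
  by apply: filter_forall => i; exact: cell_ae_Kint.
apply: filterS => z H /subset_closure; rewrite (mesh_cover hK) => -[i _ zi].
by exists i; exact: H.
Qed.

End mesh_facts.

Lemma inL2_patch d (T : measurableType d) (R : realType) (mu : {measure set T -> \bar R})
  (D E : set T) (f : T -> R) : measurable D -> inL2 mu E f -> inL2 mu D (f \_ E).
Proof.
move=> mD fE; apply: (@inL2_subset _ _ _ _ setT) => //.
rewrite /inL2 (_ : (f \_ E) \_ setT = f \_ E)//.
by apply/funext => x; rewrite [LHS]patchE mem_set.
Qed.

(** * Linear structure of the broken spaces, of U_0 and of the traces *)

Section spaces_linear.
Context (R : realType) (d : nat) (Omega : set 'rV[R]_d) (Tend : R) (N : nat).
Context (K : 'I_N -> cell R d) (kappa : R).
Context (gamma0 : fld R d -> 'rV[R]_d -> R).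
Hypotheses (hd : (0 < d)%N) (hOmega : polyhedral_lipschitz_domain Omega).
Hypothesis hTend : 0 < Tend.
Hypothesis hK : space_time_partition Omega Tend K kappa.
Hypothesis hgamma0 : is_gamma0 Omega Tend gamma0.
Notation pt := (R * 'rV[R]_d)%type.
Notation ptM := (measurableTypeR R * 'rV[R]_d)%type.
Notation mu := (mu_tx R d).
Notation mux := (mu_x R d).
Notation fld := (fld R d).
Notation ysp := (ysp R d).
Notation Q := (Qdom Omega Tend).

Let oO := open_Omega hOmega.
Let mO : measurable Omega := open_measurable_rv oO.
Let oQ : open Q := open_Q hOmega.
Let mQ : measurable (Q : set ptM) := open_measurable_pt oQ.
Let oK i : open (Kint K i). Proof. exact: open_Kint. Qed.
Arguments oK : clear implicits.
Let mK i : measurable (Kint K i : set ptM) := open_measurable_pt (oK i).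
Let Ooo := mu_x_Omega_lty hOmega.

Lemma ae_glue (T : Type) (f g : ptM -> T) :
  (forall i, ae_eq mu (Kint K i) f g) -> ae_eq mu Q f g.
Proof.
move=> H; have : {ae mu, forall z : ptM, forall i, Kint K i z -> f z = g z}.
  by apply: filter_forall.
have := ae_cover hd hK; apply: filterS2 => z Hz Hf Qz.
by have [i zi] := Hz Qz; exact: Hf zi.
Qed.

Lemma aef_glue (u v : fld) : (forall i, aef (Kint K i) u v) -> aef Q u v.
Proof. by move=> H; split; apply: ae_glue => i; have [] := H i. Qed.

Lemma opAadj_h_on (w : fld) i z : Kint K i z ->
  (opAadj_h K w).1 z = (opAadj (Kint K i) w).1 z /\
  (opAadj_h K w).2 z = (opAadj (Kint K i) w).2 z.
Proof.
move=> zi; have E j : (z \in Kint K j) = (j == i).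
  apply/idP/eqP => [/set_mem zj|->]; last exact/mem_set.
  exact: (Kint_disjoint hK zj zi).
by split; rewrite /=; under eq_bigl do rewrite E; rewrite big_pred1_eq.
Qed.

Lemma opAadj_h_ae (w : fld) i : aef (Kint K i) (opAadj_h K w) (opAadj (Kint K i) w).
Proof. by split; apply: aeW => z zi; have [] := opAadj_h_on w zi. Qed.

Lemma opAadj_h_inL2 (w : fld) : H_Aadj_T Omega Tend K w -> inL2f Q (opAadj_h K w).
Proof.
move=> [_ Hw]; split=> [|k].
- have : inL2 mu Q (fun z => \sum_i (((opAadj (Kint K i) w).1 : ptM -> R) \_ (Kint K i)) z).
    by apply: inL2_sum => i _; apply: inL2_patch => //; exact: (opAadj_inL2 (Hw i)).1.
  congr (inL2 _ _ _); apply/funext => z; rewrite [RHS]big_mkcond/=.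
  by apply: eq_bigr => i _; rewrite patchE.
- have : inL2 mu Q (fun z => \sum_i ((fun z : ptM => (opAadj (Kint K i) w).2 z ord0 k) \_ (Kint K i)) z).
    by apply: inL2_sum => i _; apply: inL2_patch => //; exact: (opAadj_inL2 (Hw i)).2.
  congr (inL2 _ _ _); apply/funext => z; rewrite /= summxE [RHS]big_mkcond/=.
  by apply: eq_bigr => i _; rewrite patchE.
Qed.

Lemma H_Aadj_T_lin a (w w' : fld) : H_Aadj_T Omega Tend K w -> H_Aadj_T Omega Tend K w' ->
  H_Aadj_T Omega Tend K (a *: w + w').
Proof.
move=> [wQ Hw] [wQ' Hw']; split=> [|i]; first exact: inL2f_lin.
exact: H_A_lin.
Qed.

Lemma opAadj_h_lin a (w w' : fld) : H_Aadj_T Omega Tend K w -> H_Aadj_T Omega Tend K w' ->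
  aef Q (opAadj_h K (a *: w + w')) (a *: opAadj_h K w + opAadj_h K w').
Proof.
move=> [wQ Hw] [wQ' Hw']; apply: aef_glue => i.
apply: (aef_trans (opAadj_h_ae _ i)).
apply: (aef_trans (opAadj_lin (oK i) a (Hw i) (Hw' i))).
by apply: aef_lin; apply: aef_sym; exact: opAadj_h_ae.
Qed.

Lemma smooth_H_Aadj_T (w : fld) : smooth_fld w -> H_Aadj_T Omega Tend K w.
Proof.
move=> sw; have [M HM] := Q_bounded hOmega hTend; have [M' HM'] := cell_bounded hOmega hTend hK.
split=> [|i]; first exact: (smooth_fld_inL2 oQ HM).
apply: (smooth_H_A (oK i) (M := M')) => //.
by apply: subset_trans (HM' i); exact: Kint_cell.
Qed.

Lemma smooth_opAadj_h (w : fld) : smooth_fld w -> aef Q (opAadj_h K w) (smooth_opAadj w).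
Proof.
move=> sw; have [M' HM'] := cell_bounded hOmega hTend hK.
apply: aef_glue => i; apply: (aef_trans (opAadj_h_ae _ i)).
apply: (smooth_opAadjE (oK i) (M := M')) => //.
by apply: subset_trans (HM' i); exact: Kint_cell.
Qed.

Lemma smooth_fld0 : smooth_fld (0 : fld).
Proof.
split=> [|i]; first exact: (@smooth_cst R _ 0).
have -> : (fun z => (0 : fld).2 z ord0 i) = (fun=> 0) by apply/funext => z; rewrite mxE.
exact: smooth_cst.
Qed.

Lemma space_Y_linear : linear_subspace (space_Y Omega Tend K).
Proof.
split=> [|a y y' [H1 H2] [H1' H2']].
- by split; [exact: smooth_H_Aadj_T smooth_fld0|exact: inL2_0].
- by split; [exact: H_Aadj_T_lin|exact: inL2_lin].
Qed.

Lemma ipf_opAadj_h_lin a (w w' : fld) (v : fld) :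
  H_Aadj_T Omega Tend K w -> H_Aadj_T Omega Tend K w' -> inL2f Q v ->
  ipf Q (opAadj_h K (a *: w + w')) v = a * ipf Q (opAadj_h K w) v + ipf Q (opAadj_h K w') v.
Proof.
move=> Hw Hw' vQ; have [aw aw'] := (opAadj_h_inL2 Hw, opAadj_h_inL2 Hw').
rewrite -(sip_lin (ipf_semi_ip mQ))//; apply: ipf_ae => //.
- by apply: opAadj_h_inL2; exact: H_Aadj_T_lin.
- exact: inL2f_lin.
- exact: opAadj_h_lin.
- exact: aef_refl.
Qed.

Lemma ipY_semi_ip : semi_ip (V := ysp) (space_Y Omega Tend K) (ipY Omega Tend K).
Proof.
have sQ := ipf_semi_ip mQ.
split => //; first exact: space_Y_linear.
- move=> a y y' z [H1 H2] [H1' H2'] [Hz1 Hz2]; rewrite /ipY.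
  rewrite [X in X + _ + _](sip_lin sQ a H1.1 H1'.1 Hz1.1).
  rewrite [X in _ + X + _](ipf_opAadj_h_lin a H1 H1' (opAadj_h_inL2 Hz1)).
  by rewrite [X in _ + X](ip_lin a mO H2 H2' Hz2); ring.
- move=> y z _ _; rewrite /ipY ip_sym.
  by congr (_ + _ + _); rewrite /ipf ip_sym ipv_sym.
- by move=> y _; rewrite /ipY !addr_ge0 ?ip_ge0 ?ipv_ge0.
Qed.

Lemma U0_H_A (u : fld) : space_U0 Omega Tend u -> H_A Q u.
Proof. by case. Qed.

Lemma U0_lin a (u u' : fld) : space_U0 Omega Tend u -> space_U0 Omega Tend u' ->
  space_U0 Omega Tend (a *: u + u').
Proof.
move=> [Hu Cu] [Hu' Cu']; split; first exact: H_A_lin.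
move=> chi schi; have [M HM] := Q_bounded hOmega hTend.
have chiL : inL2v mu Q chi by move=> i; exact: smooth_inL2 HM.
have [gL _] := H_A_wgrad Hu; have [gL' _] := H_A_wgrad Hu'.
have Hl := H_A_lin oQ a Hu Hu'; have [gLl _] := H_A_wgrad Hl.
have lin := is_wgrad_lin oQ a (H_A_inL2 Hu).1 (H_A_inL2 Hu').1 (H_A_wgrad Hu) (H_A_wgrad Hu').
have E := is_wgrad_unique oQ (H_A_wgrad Hl) lin.
rewrite (ipv_ae mQ gLl (inL2v_lin a gL gL') chiL chiL E (ae_eq_refl _ _ _)).
rewrite ipv_lin// Cu// Cu'//.
have dL : inL2 mu Q (div_x chi).
  apply: (smooth_inL2 (M := M)) => //.
  by apply: smooth_sum => i _; exact: smooth_derive.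
by rewrite [in RHS](ip_lin a mQ (H_A_inL2 Hu).1 (H_A_inL2 Hu').1 dL); ring.
Qed.

Lemma U0_0 : space_U0 Omega Tend (0 : fld).
Proof.
have [M HM] := Q_bounded hOmega hTend.
have H0 : H_A Q (0 : fld) := smooth_H_A oQ HM smooth_fld0.
split => // chi schi.
have chiL : inL2v mu Q chi by move=> i; exact: smooth_inL2 HM.
have E := is_wgrad_unique oQ (H_A_wgrad H0) (is_wgrad0 Q).
have [gL _] := H_A_wgrad H0; have z2 := (inL2f_0 Q).2.
rewrite (ipv_ae mQ gL z2 chiL chiL E (ae_eq_refl _ _ _)) [in RHS]ip_0l oppr0.
rewrite ipv_sumE// big1// => i _.
by rewrite (_ : (fun z => (0 : fld).2 z ord0 i) = (fun=> 0)) ?ip_0l//; apply/funext => z; rewrite mxE.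
Qed.

Lemma gamma0_inL2 (u : fld) : space_U0 Omega Tend u -> inL2 mux Omega (gamma0 u).
Proof. by move=> /hgamma0; exact: initial_value_inL2. Qed.

Lemma gamma0_limit (u : fld) m a b : space_U0 Omega Tend u ->
  ip mu Q u.1 (fun z : ptM => dcutoff n z.1 * rv_bump m a b z.2) @[n --> \oo] -->
  - theta 0 * ip mux Omega (gamma0 u) (rv_bump m a b).
Proof.
move=> Hu; apply: initial_value_limit => //; first exact: (H_A_inL2 (U0_H_A Hu)).1.
exact: hgamma0.
Qed.

Lemma ae_eq_rv_bump (g g' : 'rV[R]_d -> R) : inL2 mux Omega g -> inL2 mux Omega g' ->
  (forall n a b, rv_cbox a b `<=` Omega ->
    ip mux Omega g (rv_bump n a b) = ip mux Omega g' (rv_bump n a b)) ->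
  ae_eq mux Omega g g'.
Proof.
move=> gL gL' H; have : ae_eq mux Omega (fun x => -1 * g' x + g x) (fun=> 0).
  apply: fundamental_lemma_rv => //; first exact: inL2_lin.
  move=> n a b ab; rewrite ip_lin//; last exact: inL2_rv_bump.
  by rewrite H// mulN1r addNr.
by apply: filterS => x Hx Ox; have := Hx Ox; rewrite mulN1r addrC => /eqP; rewrite subr_eq0 => /eqP.
Qed.

(** [gamma0] merely picks an initial value for each field. Its pairings with spatial bumps are, up
    to the factor [- theta 0], limits of integrals that are linear in the field, and bumps separate
    classes. *)
Lemma gamma0_lin a (u u' : fld) : space_U0 Omega Tend u -> space_U0 Omega Tend u' ->
  ae_eq mux Omega (gamma0 (a *: u + u')) (fun x => a * gamma0 u x + gamma0 u' x).
Proof.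
move=> Hu Hu'; have Hl := U0_lin a Hu Hu'.
have [g1 g2] := (gamma0_inL2 Hu, gamma0_inL2 Hu').
apply: ae_eq_rv_bump; [exact: gamma0_inL2|exact: inL2_lin|].
move=> n p q pq; have psiL : inL2 mux Omega (rv_bump n p q) by exact: inL2_rv_bump.
rewrite ip_lin//.
apply: (@mulfI _ (- theta (0 : R))); first by rewrite oppr_eq0 gt_eqF// theta0_gt0.
have L1 := @gamma0_limit _ n p q Hl.
have L2 : ip mu Q (a *: u + u').1 (fun z : ptM => dcutoff m z.1 * rv_bump n p q z.2) @[m --> \oo] -->
    a * (- theta 0 * ip mux Omega (gamma0 u) (rv_bump n p q)) +
    - theta 0 * ip mux Omega (gamma0 u') (rv_bump n p q).
  have -> : (fun m => ip mu Q (a *: u + u').1 (fun z : ptM => dcutoff m z.1 * rv_bump n p q z.2)) =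
    (fun m => a * ip mu Q u.1 (fun z : ptM => dcutoff m z.1 * rv_bump n p q z.2) +
      ip mu Q u'.1 (fun z : ptM => dcutoff m z.1 * rv_bump n p q z.2)).
    apply/funext => m; apply: ip_lin => //.
    - exact: (H_A_inL2 (U0_H_A Hu)).1.
    - exact: (H_A_inL2 (U0_H_A Hu')).1.
    - exact: dcutoff_bump_inL2.
  apply: cvgD; last exact: gamma0_limit.
  by apply: cvgMl_tmp; exact: gamma0_limit.
have -> : - theta 0 * ip mux Omega (gamma0 (a *: u + u')) (rv_bump n p q) =
    a * (- theta 0 * ip mux Omega (gamma0 u) (rv_bump n p q)) +
    - theta 0 * ip mux Omega (gamma0 u') (rv_bump n p q) by exact: (cvg_unique _ L1 L2).
by ring.
Qed.

Notation gA := (gammaA Omega Tend K gamma0).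

Lemma gammaA_lin a (u u' : fld) y : space_U0 Omega Tend u -> space_U0 Omega Tend u' ->
  space_Y Omega Tend K y -> gA (a *: u + u') y = a * gA u y + gA u' y.
Proof.
move=> Hu Hu' [Y1 Y2]; have sQ := ipf_semi_ip mQ.
have [HA HA'] := (U0_H_A Hu, U0_H_A Hu'); have Hl := U0_lin a Hu Hu'.
have [A1 A1'] := (opA_inL2 HA, opA_inL2 HA').
have aL := opAadj_h_inL2 Y1.
rewrite /gammaA (sip_lin sQ a (H_A_inL2 HA) (H_A_inL2 HA') aL).
have -> : ipf Q (opA Q (a *: u + u')) y.1 = a * ipf Q (opA Q u) y.1 + ipf Q (opA Q u') y.1.
  rewrite -(sip_lin sQ a A1 A1' Y1.1); apply: ipf_ae => //.
  - exact: opA_inL2 (U0_H_A Hl).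
  - exact: inL2f_lin.
  - exact: Y1.1.
  - exact: Y1.1.
  - exact: opA_lin.
  - exact: aef_refl.
have [g1 g2] := (gamma0_inL2 Hu, gamma0_inL2 Hu').
have -> : ip mux Omega (gamma0 (a *: u + u')) y.2 =
    a * ip mux Omega (gamma0 u) y.2 + ip mux Omega (gamma0 u') y.2.
  rewrite -(ip_lin a mO g1 g2 Y2); apply: ip_ae => //.
  - exact: (inL2_measurable mO (gamma0_inL2 Hl)).
  - exact: (inL2_measurable mO (inL2_lin a g1 g2)).
  - exact: (inL2_measurable mO Y2).
  - exact: (inL2_measurable mO Y2).
  - exact: gamma0_lin.
  - exact: ae_eq_refl.
ring.
Qed.

Lemma space_X_linear : linear_subspace (V := xsp R d) (space_X Omega Tend K gamma0).
Proof.
split=> [|a x x' [xL [u Hu xu]] [xL' [u' Hu' xu']]].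
- split; first exact: inL2f_0.
  exists 0; first exact: U0_0.
  move=> y Yy; have := gammaA_lin (-1) U0_0 U0_0 Yy.
  by rewrite scaler0 addr0 mulN1r addNr => ->.
- split; first exact: inL2f_lin.
  exists (a *: u + u'); first exact: U0_lin.
  by move=> y Yy; rewrite gammaA_lin// -xu// -xu'.
Qed.

Lemma bform_lin a (x x' : xsp R d) y : space_X Omega Tend K gamma0 x ->
  space_X Omega Tend K gamma0 x' -> space_Y Omega Tend K y ->
  bform Omega Tend K (a *: x + x') y = a * bform Omega Tend K x y + bform Omega Tend K x' y.
Proof.
move=> [xL _] [xL' _] [Y1 _]; rewrite /bform.
rewrite (sip_lin (ipf_semi_ip mQ) a xL xL' (opAadj_h_inL2 Y1)).
change (a * ipf Q x.1 (opAadj_h K y.1) + ipf Q x'.1 (opAadj_h K y.1) + (a * x.2 y + x'.2 y) =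
  a * (ipf Q x.1 (opAadj_h K y.1) + x.2 y) + (ipf Q x'.1 (opAadj_h K y.1) + x'.2 y)).
ring.
Qed.

End spaces_linear.

(** * The graph of the trial-to-test operator *)

Section cutoff_fields.
Context (R : realType) (d : nat).
Notation pt := (R * 'rV[R]_d)%type.
Notation ptM := (measurableTypeR R * 'rV[R]_d)%type.

Lemma smooth_cutoff_fst n : smooth (fun z : pt => cutoff n z.1).
Proof.
apply: smoothM; under eq_fun do rewrite -coord0.
- apply: (@smooth_flat_exp_affine _ _ _ (fun v => n.+1%:R * coord v ord0)); split.
    move=> z; apply: cvgD; first exact: cvg_cst.
    by apply: cvgM; [exact: cvg_cst|exact: continuous_coord].
  by move=> t v x; rewrite (@coord_affine R _ _).2; ring.
- apply: (@smooth_flat_exp_affine _ _ _ (fun v => - (n.+1%:R * coord v ord0))); split.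
    move=> z; apply: cvgB; first exact: cvg_cst.
    by apply: cvgM; [exact: cvg_cst|exact: continuous_coord].
  by move=> t v x; rewrite (@coord_affine R _ _).2; ring.
Qed.

Lemma is_derive_fst (h : R -> R) (z : pt) (dh : R) : is_derive z.1 (1 : R) h dh ->
  is_derive z ((1, 0) : pt) (fun y : pt => h y.1) dh.
Proof. by move=> /is_derive_line H; apply/is_derive_line. Qed.

Lemma is_derive_line_cst (f : pt -> R) z v : (forall t : R, f (t *: v + z) = f z) ->
  is_derive z v f 0.
Proof.
move=> H; apply/is_derive_line.
have -> : (fun t : R => f (t *: v + z)) = cst (f z) by apply/funext.
exact: is_derive_cst.
Qed.

Definition cutoff_bump n m (a b : 'I_d -> R) (z : pt) : R :=
  cutoff n z.1 * rv_bump m a b z.2.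

Lemma smooth_cutoff_bump n m a b : smooth (cutoff_bump n m a b).
Proof. by apply: smoothM; [exact: smooth_cutoff_fst|exact: smooth_rv_bump_snd]. Qed.

Lemma d_t_cutoff_bump n m a b z :
  d_t (cutoff_bump n m a b) z = dcutoff n z.1 * rv_bump m a b z.2.
Proof.
have D1 : is_derive z ((1, 0) : pt) (fun y : pt => cutoff n y.1) (dcutoff n z.1).
  by apply: is_derive_fst; exact: is_derive_cutoff.
have D2 : is_derive z ((1, 0) : pt) (fun y : pt => rv_bump m a b y.2) 0.
  by apply: is_derive_line_cst => t /=; rewrite scaler0 add0r.
have D3 := is_deriveM D1 D2.
rewrite /d_t (derive_val (f := cutoff_bump n m a b) (is_derive := D3)).
by rewrite scaler0 add0r [LHS]mulrC.
Qed.

Lemma grad_x_cutoff_bump n m a b z i :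
  grad_x (cutoff_bump n m a b) z ord0 i =
  cutoff n z.1 * grad_x (fun y : pt => rv_bump m a b y.2) z ord0 i.
Proof.
have D1 : is_derive z ((0, e_x R i) : pt) (fun y : pt => cutoff n y.1) 0.
  by apply: is_derive_line_cst => t /=; rewrite scaler0 add0r.
have D2 : is_derive z ((0, e_x R i) : pt) (fun y : pt => rv_bump m a b y.2)
    ('D_((0, e_x R i) : pt) (fun y : pt => rv_bump m a b y.2) z).
  constructor => //; apply: smooth_derivable; exact: smooth_rv_bump_snd.
have D3 := is_deriveM D1 D2.
rewrite !mxE (derive_val (f := cutoff_bump n m a b) (is_derive := D3)).
by rewrite scaler0 addr0.
Qed.

Lemma cutoff_cvg0 (t : R) : 0 < t -> cutoff n t @[n --> \oo] --> (0 : R).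
Proof.
move=> t0; apply: (@cvg_near_cst _ _ (0 : R)).
exists (Num.bound t^-1) => // n /= Hn; apply/theta_out.
have B : t^-1 < n.+1%:R.
  apply: (le_lt_trans (ler_norm _)); apply: (lt_le_trans (archi_boundP _)); first exact: normr_ge0.
  by rewrite ler_nat ger0_norm ?invr_ge0 ?(ltW t0)// (leq_trans Hn).
by rewrite -(@ler_pM2r _ t^-1) ?invr_gt0// mul1r mulfK ?gt_eqF// ltW.
Qed.

Lemma cutoff_bounded n (t : R) : 0 <= cutoff n t <= 1.
Proof. by rewrite theta_ge0 theta_le1. Qed.

End cutoff_fields.

Lemma ipv_0l d (T : measurableType d) (R : realType) (mu : {measure set T -> \bar R}) n
  (D : set T) (f : T -> 'rV[R]_n) : ipv mu D (fun=> 0) f = 0.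
Proof.
rewrite -[RHS](ip_0l mu D (fun=> 0)); congr Rintegral; apply/funext => x.
by rewrite /dotv big1 ?mulr0// => i _; rewrite mxE mul0r.
Qed.

Lemma ip_Nr d (T : measurableType d) (R : realType) (mu : {measure set T -> \bar R})
  (D : set T) (f g : T -> R) : measurable D -> inL2 mu D f -> inL2 mu D g ->
  ip mu D f (fun x => - g x) = - ip mu D f g.
Proof.
move=> mD fL gL; have := ip_lin (-1) mD gL (inL2_0 mu D) fL.
rewrite ip_0l addr0 mulN1r [in RHS]ip_sym => <-; rewrite ip_sym; congr ip.
by apply/funext => x; rewrite mulN1r addr0.
Qed.

Lemma ipv_Nr d (T : measurableType d) (R : realType) (mu : {measure set T -> \bar R}) n
  (D : set T) (f g : T -> 'rV[R]_n) : measurable D -> inL2v mu D f -> inL2v mu D g ->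
  ipv mu D f (fun x => - g x) = - ipv mu D f g.
Proof.
move=> mD fL gL; have z2 : inL2v mu D (fun=> 0 : 'rV[R]_n).
  by move=> i; under eq_fun do rewrite mxE; exact: inL2_0.
have := ipv_lin (-1) mD gL z2 fL.
rewrite ipv_0l addr0 mulN1r [in RHS]ipv_sym => <-; rewrite ipv_sym; congr ipv.
by apply/funext => x; rewrite scaleN1r addr0.
Qed.

Lemma cvg_sum0 (R : realType) (I : Type) (r : seq I) (F : I -> nat -> R) :
  (forall i, F i n @[n --> \oo] --> (0 : R)) ->
  \sum_(i <- r) F i n @[n --> \oo] --> (0 : R).
Proof.
move=> F0; elim: r => [|i r IH].
  by under eq_cvg do rewrite big_nil; exact: cvg_cst.
under eq_cvg do rewrite big_cons.
have H := cvgD (F0 i) IH; rewrite addr0 in H; exact: H.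
Qed.

Section graph_trial_to_test.
Context (R : realType) (d : nat) (Omega : set 'rV[R]_d) (Tend : R) (N : nat).
Context (K : 'I_N -> cell R d) (kappa : R).
Context (gamma0 : fld R d -> 'rV[R]_d -> R).
Hypotheses (hd : (0 < d)%N) (hOmega : polyhedral_lipschitz_domain Omega).
Hypothesis hTend : 0 < Tend.
Hypothesis hK : space_time_partition Omega Tend K kappa.
Hypothesis hgamma0 : is_gamma0 Omega Tend gamma0.
Notation pt := (R * 'rV[R]_d)%type.
Notation ptM := (measurableTypeR R * 'rV[R]_d)%type.
Notation mu := (mu_tx R d).
Notation mux := (mu_x R d).
Notation fld := (fld R d).
Notation ysp := (ysp R d).
Notation xsp := (xsp R d).
Notation Q := (Qdom Omega Tend).

Let oO : open Omega := open_Omega hOmega.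
Let mO : measurable Omega := open_measurable_rv oO.
Let oQ : open Q := open_Q hOmega.
Let mQ : measurable (Q : set ptM) := open_measurable_pt oQ.
Let Ooo := mu_x_Omega_lty hOmega.
Let Qoo : (mu Q < +oo)%E := mu_Q_lty oO Ooo hTend.

Section weak_adjoint.
Context (D W : fld).
Hypotheses (DL : inL2f Q D) (WL : inL2f Q W).
(** A weak form of A D = W. The fields [p] are unrestricted on the boundary of Q, so it also encodes
    the lateral boundary condition and a zero initial value. *)
Hypothesis DW : forall p, smooth_fld p -> ipf Q D (smooth_opAadj p) = ipf Q W p.

Lemma weak_adjoint_div p : smooth p ->
  ip mu Q D.1 (d_t p) + ipv mu Q D.2 (grad_x p) = - ip mu Q W.1 p.
Proof.
move=> sp; have [M HM] := Q_bounded hOmega hTend.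
have s0 : forall i, smooth (fun z : pt => (0 : pt -> 'rV[R]_d) z ord0 i).
  by move=> i; under eq_fun do rewrite mxE; exact: smooth_cst.
have spf : smooth_fld ((p, 0) : fld) by split.
have pL : inL2 mu Q p by exact: smooth_inL2 HM.
have dpL : inL2 mu Q (d_t p) by apply: (smooth_inL2 (M := M)) => //; exact: smooth_derive.
have gpL : inL2v mu Q (grad_x p).
  by move=> i; apply: (smooth_inL2 (M := M)) => //; exact: smooth_grad.
have := DW spf; rewrite /ipf /=.
have -> : ipv mu Q W.2 0 = 0.
  by rewrite ipv_sym; exact: ipv_0l.
have -> : ip mu Q D.1 (fun z => - smooth_div (p, 0) z) = - ip mu Q D.1 (d_t p).
  rewrite -(ip_Nr mQ DL.1 dpL); congr ip; apply/funext => z; rewrite /smooth_div /=.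
  congr (- _); rewrite [X in _ + X](_ : _ = 0) ?addr0// /div_x big1// => i _.
  by under eq_fun do rewrite mxE; exact: derive_cst.
have -> : ipv mu Q D.2 (fun z => - grad_x p z + (0 : pt -> 'rV[R]_d) z) = - ipv mu Q D.2 (grad_x p).
  rewrite -(ipv_Nr mQ DL.2 gpL); congr ipv; apply/funext => z.
  by rewrite [X in _ + X](_ : _ = 0) ?addr0.
rewrite addr0 => <-; ring.
Qed.

(** Test with [(0, chi)]. The second component of A D = W asks that the gradient of [D.1] be
    [W.2 - D.2]. *)
Lemma weak_adjoint_grad (chi : pt -> 'rV[R]_d) : (forall i, smooth (fun z : pt => chi z ord0 i)) ->
  ipv mu Q (fun z => - D.2 z + W.2 z) chi = - ip mu Q D.1 (div_x chi).
Proof.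
move=> schi; have [M HM] := Q_bounded hOmega hTend.
have s0 : smooth (0 : pt -> R) by exact: (@smooth_cst R _ 0).
have sf : smooth_fld ((0, chi) : fld) by split.
have cL : inL2v mu Q chi by move=> i; exact: smooth_inL2 HM.
have sdv : smooth (div_x chi) by apply: smooth_sum => i _; exact: smooth_derive.
have dL : inL2 mu Q (div_x chi) by exact: smooth_inL2 HM.
have := DW sf; rewrite /ipf /=.
rewrite [X in _ = X + _](_ : _ = 0); last by rewrite ip_sym ip_0l.
have -> : ip mu Q D.1 (fun z => - smooth_div (0, chi) z) = - ip mu Q D.1 (div_x chi).
  rewrite -(ip_Nr mQ DL.1 dL); congr ip; apply/funext => z; rewrite /smooth_div /=.
  by congr (- _); rewrite /d_t derive_cst add0r.
have -> : ipv mu Q D.2 (fun z => - grad_x 0 z + chi z) = ipv mu Q D.2 chi.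
  congr ipv; apply/funext => z; rewrite [grad_x 0 z](_ : _ = 0) ?oppr0 ?add0r//.
  by apply/rowP => i; rewrite !mxE; exact: derive_cst.
rewrite add0r => E.
have -> : (fun z => - D.2 z + W.2 z) = (fun z => -1 *: D.2 z + W.2 z).
  by apply/funext => z; rewrite scaleN1r.
rewrite ipv_lin//; [|exact: DL.2|exact: WL.2].
by rewrite -E; ring.
Qed.

Lemma weak_adjoint_is_wdiv : is_wdiv Q D W.1.
Proof. by split=> [|p [sp _ _]]; [exact: WL.1|exact: weak_adjoint_div]. Qed.

Lemma weak_adjoint_is_wgrad : is_wgrad Q D.1 (fun z => - D.2 z + W.2 z).
Proof.
have gL : inL2v mu Q (fun z => - D.2 z + W.2 z).
  have -> : (fun z => - D.2 z + W.2 z) = (fun z => -1 *: D.2 z + W.2 z).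
    by apply/funext => z; rewrite scaleN1r.
  by apply: inL2v_lin; [exact: DL.2|exact: WL.2].
split => // i p tp; have [sp _ _] := tp.
pose chi z : 'rV[R]_d := p z *: e_x R i.
have chiE j : (fun z => chi z ord0 j) = (fun z => p z * (j == i)%:R).
  by apply/funext => z; rewrite !mxE eqxx.
have schi j : smooth (fun z : pt => chi z ord0 j).
  by rewrite chiE; apply: smoothM => //; exact: smooth_cst.
have := weak_adjoint_grad schi.
have -> : div_x chi = (fun z => grad_x p z ord0 i).
  apply/funext => z; rewrite /div_x (bigD1 i)//= [X in _ + X]big1 ?addr0.
    by rewrite mxE; congr ('D__ _ _); rewrite chiE; apply/funext => y; rewrite eqxx mulr1.
  move=> j ji; rewrite chiE; under eq_fun do rewrite (negbTE ji) mulr0.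
  exact: derive_cst.
have cL : inL2v mu Q chi.
  have [M HM] := Q_bounded hOmega hTend.
  by move=> j; exact: smooth_inL2 HM.
rewrite ipv_sumE// (bigD1 i)//= [X in _ + X]big1 ?addr0.
  move=> H; rewrite -[LHS]opprK -H; congr (- _).
  by congr ip; rewrite chiE; apply/funext => z; rewrite eqxx mulr1.
move=> j ji; rewrite chiE ip_sym -[RHS](ip_0l mu Q (fun z => (- D.2 z + W.2 z) ord0 j)).
by congr ip; apply/funext => z; rewrite (negbTE ji) mulr0.
Qed.

Lemma weak_adjoint_H_A : H_A Q D.
Proof.
split => //; first by eexists; exact: weak_adjoint_is_wgrad.
by eexists; exact: weak_adjoint_is_wdiv.
Qed.

Lemma weak_adjoint_opA : aef Q (opA Q D) W.
Proof.
apply: (aef_trans (opA_E oQ DL weak_adjoint_is_wgrad weak_adjoint_is_wdiv)).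
split; first exact: ae_eq_refl.
by apply: aeW => z _ /=; rewrite addrAC addNr add0r.
Qed.

(** In [weak_adjoint_grad] the field [chi] need not vanish on the boundary, which is exactly the
    condition defining U_0. *)
Lemma weak_adjoint_U0 : space_U0 Omega Tend D.
Proof.
split; first exact: weak_adjoint_H_A.
move=> chi schi; rewrite -weak_adjoint_grad//.
have [M HM] := Q_bounded hOmega hTend.
have cL : inL2v mu Q chi by move=> j; exact: smooth_inL2 HM.
have wg := weak_adjoint_is_wgrad; have wg' := H_A_wgrad weak_adjoint_H_A.
apply: ipv_ae => //; [exact: wg'.1|exact: wg.1|exact: (is_wgrad_unique oQ wg' wg)|].
exact: ae_eq_refl.
Qed.

Lemma ip_cutoff_cvg0 (f psi : ptM -> R) : inL2 mu Q f -> measurable_fun Q psi ->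
  (exists C, forall z, Q z -> `|psi z| <= C) ->
  ip mu Q f (fun z => cutoff n z.1 * psi z) @[n --> \oo] --> (0 : R).
Proof.
move=> fL mpsi [C HC]; apply: (@ip_cvg0 _ _ _ _ _ _ _ C) => //.
- move=> n; apply: measurable_funM => //.
  have mc : measurable_fun setT (fun z : ptM => cutoff n z.1).
    by apply: smooth_measurable; exact: smooth_cutoff_fst.
  exact: (measurable_funS _ _ mc).
- move=> n z Qz; rewrite normrM; have /andP[c0 c1] := cutoff_bounded n z.1.
  by rewrite (ger0_norm c0) -[C]mul1r ler_pM// HC.
- move=> z [/= zt _]; rewrite -[X in _ --> X](mul0r (psi z)).
  apply: cvgMr_tmp; apply: cutoff_cvg0.
  by move: zt; rewrite /= in_itv/= => /andP[].
Qed.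

(** Test [weak_adjoint_div] with a time cutoff times a spatial bump. The time derivative term tends
    to [- theta 0] times the pairing of the initial value with the bump; in the other terms the
    cutoff tends to 0 at every positive time, so they vanish by dominated convergence. *)
Lemma weak_adjoint_gamma0 : ae_eq mux Omega (gamma0 D) (fun=> 0).
Proof.
have U0D := weak_adjoint_U0.
apply: (ae_eq_rv_bump hOmega (gamma0_inL2 hTend hgamma0 U0D) (inL2_0 _ _)) => m a b ab.
rewrite ip_0l; apply: (@mulfI _ (- theta (0 : R))).
  by rewrite oppr_eq0 gt_eqF// theta0_gt0.
rewrite mulr0; have [M HM] := Q_bounded hOmega hTend.
have L1 := gamma0_limit (m := m) (a := a) (b := b) hOmega hTend hgamma0 U0D.
have sb : smooth (fun z : pt => rv_bump m a b z.2) by exact: smooth_rv_bump_snd.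
have bdd (p : pt -> R) : smooth p -> exists C, forall z, Q z -> `|p z| <= C.
  move=> /smooth_continuous cp.
  have [C HC] := continuous_bounded_cbox (fun=> - M) (fun=> M) cp.
  by exists C => z /HM; exact: HC.
have mea (p : pt -> R) : smooth p -> measurable_fun (Q : set ptM) p.
  by move=> sp; apply: (measurable_funS _ _ (smooth_measurable sp)).
have L2 : ip mu Q D.1 (fun z : ptM => dcutoff n z.1 * rv_bump m a b z.2) @[n --> \oo] --> (0 : R).
  have -> : (fun n => ip mu Q D.1 (fun z : ptM => dcutoff n z.1 * rv_bump m a b z.2)) =
    (fun n => - ip mu Q W.1 (fun z => cutoff n z.1 * rv_bump m a b z.2) -
      \sum_i ip mu Q (fun z => D.2 z ord0 i)
        (fun z => cutoff n z.1 * grad_x (fun y : pt => rv_bump m a b y.2) z ord0 i)).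
    apply/funext => n; have scb := smooth_cutoff_bump n m a b.
    rewrite -(weak_adjoint_div scb) ipv_sumE//; last first.
    - by move=> i; apply: (smooth_inL2 (M := M)) => //; exact: smooth_grad.
    - exact: DL.2.
    rewrite (_ : d_t (cutoff_bump n m a b) = (fun z : ptM => dcutoff n z.1 * rv_bump m a b z.2)); last first.
      by apply/funext => z; exact: d_t_cutoff_bump.
    under [X in _ = _ + X - _]eq_bigr do under [X in ip _ _ _ X]eq_fun do rewrite grad_x_cutoff_bump.
    by rewrite addrK.
  have C1 : - ip mu Q W.1 (fun z => cutoff n z.1 * rv_bump m a b z.2) @[n --> \oo] --> (0 : R).
    rewrite -oppr0; apply: cvgN.
    by apply: ip_cutoff_cvg0; [exact: WL.1|exact: mea|exact: bdd].
  suff C2 : \sum_i ip mu Q (fun z => D.2 z ord0 i)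
      (fun z => cutoff n z.1 * grad_x (fun y : pt => rv_bump m a b y.2) z ord0 i)
      @[n --> \oo] --> (0 : R).
    have H := cvgB C1 C2; rewrite subr0 in H; exact: H.
  apply: cvg_sum0 => i; apply: ip_cutoff_cvg0; first exact: DL.2.
    by apply: mea; exact: smooth_grad.
  by apply: bdd; exact: smooth_grad.
by apply: (cvg_unique _ L1 L2).
Qed.

End weak_adjoint.

End graph_trial_to_test.

Lemma smooth_fld_opAadj (R : realType) (d : nat) (p : fld R d) :
  smooth_fld p -> smooth_fld (smooth_opAadj p).
Proof.
move=> sp; split=> [|i] /=.
- have -> : (fun z => - smooth_div p z) = (fun z => -1 * smooth_div p z).
    by apply/funext => z; rewrite mulN1r.
  by apply: smoothM; [exact: smooth_cst|exact: smooth_smooth_div].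
- have -> : (fun z => (- grad_x p.1 z + p.2 z) ord0 i) =
      (fun z => -1 * grad_x p.1 z ord0 i + p.2 z ord0 i).
    by apply/funext => z; rewrite !mxE mulN1r.
  apply: smoothD; last exact: sp.2.
  by apply: smoothM; [exact: smooth_cst|exact: smooth_grad sp.1].
Qed.

Lemma add4_lin (R : realType) (a x1 x2 x3 x4 y1 y2 y3 y4 : R) :
  a * x1 + y1 + (a * x2 + y2) + (a * x3 + y3) + (a * x4 + y4) =
  a * (x1 + x2 + x3 + x4) + (y1 + y2 + y3 + y4).
Proof. by ring. Qed.

Section trial_to_test_graph.
Context (R : realType) (d : nat) (Omega : set 'rV[R]_d) (Tend : R) (N : nat).
Context (K : 'I_N -> cell R d) (kappa : R).
Context (gamma0 : fld R d -> 'rV[R]_d -> R).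
Hypotheses (hd : (0 < d)%N) (hOmega : polyhedral_lipschitz_domain Omega).
Hypothesis hTend : 0 < Tend.
Hypothesis hK : space_time_partition Omega Tend K kappa.
Hypothesis hgamma0 : is_gamma0 Omega Tend gamma0.
Notation pt := (R * 'rV[R]_d)%type.
Notation ptM := (measurableTypeR R * 'rV[R]_d)%type.
Notation mu := (mu_tx R d).
Notation mux := (mu_x R d).
Notation fld := (fld R d).
Notation ysp := (ysp R d).
Notation xsp := (xsp R d).
Notation Q := (Qdom Omega Tend).

Let oO : open Omega := open_Omega hOmega.
Let mO : measurable Omega := open_measurable_rv oO.
Let oQ : open Q := open_Q hOmega.
Let mQ : measurable (Q : set ptM) := open_measurable_pt oQ.
Let Ooo := mu_x_Omega_lty hOmega.
Let Qoo : (mu Q < +oo)%E := mu_Q_lty oO Ooo hTend.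
Context (T : xsp -> ysp).
Hypothesis hT : trial_to_test Omega Tend K gamma0 T.
Notation SX := (space_X Omega Tend K gamma0).
Notation SY := (space_Y Omega Tend K).
Notation U0 := (space_U0 Omega Tend).
Notation gA := (gammaA Omega Tend K gamma0).
Notation E x := (opE K T x).

Let sQ := ipf_semi_ip mQ.

Lemma TY x : SX x -> SY (T x).
Proof. by move=> /hT[]. Qed.

Lemma opE_inL2 x : SX x -> inL2f Q (E x).
Proof.
move=> Sx; have [xL _] := Sx; apply: (subspaceB (let: And4 h _ _ _ := sQ in h)) => //.
by apply: (opAadj_h_inL2 hOmega); exact: (TY Sx).1.
Qed.

(** Test functions [(0, xi)] leave only the two inner products over Omega in the definition of
    [T]. *)
Lemma trial_to_test_initial x u : SX x -> U0 u -> (forall y, SY y -> x.2 y = gA u y) ->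
  ae_eq mux Omega (T x).2 (gamma0 u).
Proof.
move=> Sx Uu xu; have [[_ T2] TE] := hT Sx; have g2 := gamma0_inL2 hTend hgamma0 Uu.
have Y0 := (space_Y_linear hOmega hTend hK).1.
apply: (ae_eq_rv_bump hOmega T2 g2) => n a b ab.
have bL : inL2 mux Omega (rv_bump n a b) by exact: inL2_rv_bump.
have Yb : SY ((0, rv_bump n a b) : ysp) by split; [exact: Y0.1|].
have A0 : aef Q (opAadj_h K (0 : fld)) (0 : fld).
  have := opAadj_h_lin hd hK (-1) Y0.1 Y0.1.
  by rewrite scaleN1r addNr scaleN1r addNr.
have A0L : inL2f Q (opAadj_h K (0 : fld)) by exact: (opAadj_h_inL2 hOmega Y0.1).
have ip0 (v : fld) : inL2f Q v -> ipf Q v (opAadj_h K (0 : fld)) = 0.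
  move=> vL; rewrite (sip_sym sQ)// -(sip_0l sQ vL); apply: ipf_ae => //.
    exact: inL2f_0.
  exact: aef_refl.
have ip0' (v : fld) : inL2f Q v -> ipf Q v (0 : fld) = 0.
  by move=> vL; rewrite (sip_sym sQ)//; [exact: (sip_0l sQ vL)|exact: inL2f_0].
have := TE _ Yb; rewrite /ipY /bform xu//= /gammaA /=.
have [xL _] := Sx; have [T1 _] := TY Sx.
have uL := H_A_inL2 (U0_H_A Uu).
rewrite !ip0 ?ip0'//; [|exact: opA_inL2 (U0_H_A Uu)|exact: T1.1|exact: (opAadj_h_inL2 hOmega T1)].
by rewrite !add0r oppr0 add0r.
Qed.

(** Test the definition of [T] with [(p, 0)]: for smooth [p] the cell-wise adjoint is the classical
    one. The terms paired with it collect to [E x - u], the others to [(T x).1 - opA Q u]. *)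
Lemma trial_to_test_weak x u p : SX x -> U0 u -> (forall y, SY y -> x.2 y = gA u y) ->
  smooth_fld p -> ipf Q (E x - u) (smooth_opAadj p) = ipf Q ((T x).1 - opA Q u) p.
Proof.
move=> Sx Uu xu sp; have [[T1 _] TE] := hT Sx; have [xL _] := Sx.
have [M HM] := Q_bounded hOmega hTend.
have Yp : SY ((p, 0) : ysp).
  by split; [exact: (smooth_H_Aadj_T hOmega hTend hK)|exact: inL2_0].
have pL : inL2f Q p by exact: (smooth_fld_inL2 oQ HM).
have sL : inL2f Q (smooth_opAadj p).
  by apply: (smooth_fld_inL2 oQ HM); exact: smooth_fld_opAadj.
have AL := opAadj_h_inL2 hOmega Yp.1; have BL := opAadj_h_inL2 hOmega T1.
have uL := H_A_inL2 (U0_H_A Uu); have AuL := opA_inL2 (U0_H_A Uu).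
have sw (v : fld) : inL2f Q v -> ipf Q v (opAadj_h K p) = ipf Q v (smooth_opAadj p).
  move=> vL; apply: ipf_ae => //; first exact: aef_refl.
  exact: (smooth_opAadj_h hd hOmega hTend hK).
have := TE _ Yp; rewrite /ipY /bform xu//= /gammaA /=.
rewrite ![ip _ _ _ 0]ip_sym !ip_0l !addr0 !sw// => H.
have EL := opE_inL2 Sx.
rewrite (sip_Bl sQ EL uL sL) (sip_Bl sQ T1.1 AuL pL) (sip_Bl sQ xL BL sL).
by move: H; lra.
Qed.

Lemma opE_split x u : E x = 1 *: (E x - u) + u.
Proof. by rewrite scale1r subrK. Qed.

(** Split [E x] into [u], whose trace is [x.2], and [E x - u], to which the weak adjoint results
    apply with [W] equal to [(T x).1 - opA Q u]. Adding up, A maps [E x] to [(T x).1], and the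
    initial value is that of [u]. *)
Lemma trial_to_test_graph x : SX x ->
  [/\ U0 (E x), aef Q (opA Q (E x)) (T x).1 & ae_eq mux Omega (gamma0 (E x)) (T x).2].
Proof.
move=> Sx; have [_ [u Uu xu]] := Sx; have [T1 T2] := TY Sx.
have uL := H_A_inL2 (U0_H_A Uu); have AuL := opA_inL2 (U0_H_A Uu).
have EL := opE_inL2 Sx.
have ssf := let: And4 h _ _ _ := sQ in h.
have DL : inL2f Q (E x - u) by exact: subspaceB.
have WL : inL2f Q ((T x).1 - opA Q u) by apply: subspaceB => //; exact: T1.1.
have DW p (sp : smooth_fld p) := trial_to_test_weak Sx Uu xu sp.
have UD := weak_adjoint_U0 hOmega hTend DL WL DW.
have opD := weak_adjoint_opA hOmega hTend DL WL DW.
have g0 := weak_adjoint_gamma0 hOmega hTend hgamma0 DL WL DW.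
split.
- by rewrite (opE_split x u); exact: (U0_lin hOmega hTend).
- rewrite (opE_split x u); apply: (aef_trans (opA_lin oQ 1 (U0_H_A UD) (U0_H_A Uu))).
  apply: (aef_trans (aef_lin 1 opD (aef_refl _ _))).
  by rewrite scale1r subrK; exact: aef_refl.
- rewrite (opE_split x u).
  have gl := gamma0_lin hOmega hTend hgamma0 1 UD Uu.
  have gi := trial_to_test_initial Sx Uu xu.
  apply: filterS3 gl g0 gi => z H1 H2 H3 Oz.
  by rewrite H1// H2// H3// mul1r add0r.
Qed.

(** The polarized X-norm, with A E and gamma0 E replaced by the components of [T], which agree with
    them almost everywhere by [trial_to_test_graph]. *)
Definition sX (x x' : xsp) : R := ipf Q x.1 x'.1 + ipf Q (E x) (E x') +
  ipf Q (T x).1 (T x').1 + ip mux Omega (T x).2 (T x').2.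

Lemma normX_sX x : SX x -> normX Omega Tend K gamma0 T x = Num.sqrt (sX x x).
Proof.
move=> Sx; have [UE AE gE] := trial_to_test_graph Sx; have [T1 T2] := TY Sx.
rewrite /normX /sX; congr (Num.sqrt (_ + _ + _ + _)).
- by apply: ipf_ae => //; [exact: opA_inL2 (U0_H_A UE)|exact: T1.1|exact: opA_inL2 (U0_H_A UE)|exact: T1.1].
- have g := inL2_measurable mO (gamma0_inL2 hTend hgamma0 UE).
  by apply: ip_ae => //; exact: (inL2_measurable mO T2).
Qed.

(** The defect of linearity has zero Y-product with itself, because [T] represents the bilinear
    form. The three nonnegative terms of that product vanish separately, which settles both
    components of [T] and the adjoint inside [E]. *)
Lemma trial_to_test_lin a x x' : SX x -> SX x' ->
  aef Q (T (a *: x + x')).1 (a *: (T x).1 + (T x').1) /\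
  aef Q (E (a *: x + x')) (a *: E x + E x') /\
  ae_eq mux Omega (T (a *: x + x')).2 (fun z => a * (T x).2 z + (T x').2 z).
Proof.
move=> Sx Sx'; have SXl := space_X_linear K hOmega hTend hgamma0.
have hY := ipY_semi_ip hd hOmega hTend hK.
have Sl : SX (a *: x + x') by exact: SXl.2.
have [Y1 Y2 Y3] := And3 (TY Sx) (TY Sx') (TY Sl).
have SYl := space_Y_linear hOmega hTend hK.
have Y4 : SY (a *: T x + T x') by exact: SYl.2.
pose z := -1 *: (a *: T x + T x') + T (a *: x + x').
have Yz : SY z by exact: SYl.2.
have z0 : ipY Omega Tend K z z = 0.
  have [[_ B1] [_ B2] [_ B3]] := And3 (hT Sx) (hT Sx') (hT Sl).
  rewrite {1}/z (sip_lin hY _ Y4 Y3 Yz) (sip_lin hY _ Y1 Y2 Yz) B1// B2// B3//.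
  by rewrite (bform_lin hOmega a Sx Sx' Yz); ring.
have z3 := ip_ge0 mux Omega z.2.
have azL := opAadj_h_inL2 hOmega Yz.1.
have z1 := sip_ge0 sQ Yz.1.1; have z2 := sip_ge0 sQ azL.
have zL := Yz.1.1.
have [e1 e2 e3] : [/\ ipf Q z.1 z.1 = 0, ipf Q (opAadj_h K z.1) (opAadj_h K z.1) = 0 &
    ip mux Omega z.2 z.2 = 0].
  by move: z0; rewrite /ipY => z0; split; lra.
have f1 := ipf_eq0 mQ zL e1; have f2 := ipf_eq0 mQ azL e2; have f3 := ip_eq0 mO Yz.2 e3.
have T1L : aef Q (T (a *: x + x')).1 (a *: (T x).1 + (T x').1).
  have := aef_lin 1 f1 (aef_refl Q (a *: (T x).1 + (T x').1)).
  rewrite scale1r scaler0 add0r /z.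
  by rewrite (_ : (_ + _).1 + _ = (T (a *: x + x')).1)//= scaleN1r addrAC addNr add0r.
have A1L : aef Q (opAadj_h K (T (a *: x + x')).1) (a *: opAadj_h K (T x).1 + opAadj_h K (T x').1).
  have H1 := opAadj_h_lin hd hK a Y1.1 Y2.1.
  have H2 := opAadj_h_lin hd hK (-1) Y4.1 Y3.1.
  apply: aef_trans H1.
  have H3 := aef_trans (aef_sym H2) f2.
  have := aef_lin 1 H3 (aef_refl Q (opAadj_h K (a *: (T x).1 + (T x').1))).
  rewrite scale1r scaler0 add0r.
  by rewrite scaleN1r addrAC addNr add0r.
split => //; split.
- rewrite /opE.
  have -> : a *: (x.1 - opAadj_h K (T x).1) + (x'.1 - opAadj_h K (T x').1) =
     -1 *: (a *: opAadj_h K (T x).1 + opAadj_h K (T x').1) + (a *: x.1 + x'.1).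
    by rewrite scaleN1r scalerBr opprD addrACA [RHS]addrC.
  by rewrite addrC -scaleN1r; apply: aef_lin => //; exact: aef_refl.
- apply: filterS f3 => w f3 Ow; have := f3 Ow.
  change (-1 * (a * (T x).2 w + (T x').2 w) + (T (a *: x + x')).2 w = 0 ->
    (T (a *: x + x')).2 w = a * (T x).2 w + (T x').2 w).
  lra.
Qed.

Lemma sX_semi_ip : semi_ip SX sX.
Proof.
have SXl := space_X_linear K hOmega hTend hgamma0.
split => //.
- move=> a x x' v Sx Sx' Sv; rewrite /sX.
  have [H1 [H2 H3]] := trial_to_test_lin a Sx Sx'.
  have Sl : SX (a *: x + x') by exact: SXl.2.
  have [Y1 Y2 Y3 Y4] := And4 (TY Sx) (TY Sx') (TY Sl) (TY Sv).
  have [E1 E2 E3 E4] := And4 (opE_inL2 Sx) (opE_inL2 Sx') (opE_inL2 Sl) (opE_inL2 Sv).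
  have [V1 _] := Sx; have [V2 _] := Sx'; have [V4 _] := Sv.
  rewrite (sip_lin sQ a V1 V2 V4).
  have -> : ipf Q (E (a *: x + x')) (E v) = a * ipf Q (E x) (E v) + ipf Q (E x') (E v).
    rewrite -(sip_lin sQ a E1 E2 E4); apply: ipf_ae => //; first exact: inL2f_lin.
    exact: aef_refl.
  have -> : ipf Q (T (a *: x + x')).1 (T v).1 = a * ipf Q (T x).1 (T v).1 + ipf Q (T x').1 (T v).1.
    rewrite -(sip_lin sQ a Y1.1.1 Y2.1.1 Y4.1.1); apply: ipf_ae => //.
    - exact: Y3.1.1.
    - exact: inL2f_lin Y1.1.1 Y2.1.1.
    - exact: Y4.1.1.
    - exact: Y4.1.1.
    - exact: aef_refl.
  have -> : ip mux Omega (T (a *: x + x')).2 (T v).2 =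
      a * ip mux Omega (T x).2 (T v).2 + ip mux Omega (T x').2 (T v).2.
    rewrite -(ip_lin a mO Y1.2 Y2.2 Y4.2); apply: ip_ae => //.
    - exact: (inL2_measurable mO Y3.2).
    - exact: (inL2_measurable mO (inL2_lin a Y1.2 Y2.2)).
    - exact: (inL2_measurable mO Y4.2).
    - exact: (inL2_measurable mO Y4.2).
    - exact: ae_eq_refl.
  exact: add4_lin.
- move=> x y _ _; have sym (u v : fld) : ipf Q u v = ipf Q v u by rewrite /ipf ip_sym ipv_sym.
  by rewrite /sX (sym x.1) (sym (E x)) (sym (T x).1) (ip_sym _ _ (T x).2).
- by move=> x Sx; rewrite /sX !addr_ge0 ?ip_ge0 ?ipv_ge0.
Qed.

End trial_to_test_graph.

(** * The constants of the norm equivalence *)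

Section dpg_constants.
Context (R : realType) (c : R).
Hypothesis c0 : 0 < c.
Let s : R := Num.sqrt (1 + c).

Let s1 : 1 < s.
Proof. by rewrite -sqrtr1 ltr_sqrt ?ltrDl// addr_gt0. Qed.

Let s2 : s ^+ 2 = 1 + c.
Proof. by rewrite sqr_sqrtr// ltW// addr_gt0. Qed.

Let s0 : 0 < s. Proof. exact: lt_trans s1. Qed.

Lemma lower_constant_gt0 : 0 < 1 - s^-1.
Proof. by rewrite subr_gt0 invf_lt1. Qed.

(** With r = sqrt (1 + 4c), the numbers 1 + 2c + r and 1 + 2c - r are (r+1)^2 / 2 and (r-1)^2 / 2,
    so the quotient of the two constants is ((r+1) / (r-1))^2. The claim is then that (s+1) / (s-1)
    is at most the fourth power of (r+1) / (r-1). *)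
Lemma constant_ratio : 0 <= norm_b c * (beta c)^-1 /\
  1 + s^-1 <= (1 - s^-1) * (norm_b c * (beta c)^-1) ^+ 2.
Proof.
rewrite /norm_b /beta (_ : (1 + 2 * c) ^+ 2 - 4 * c ^+ 2 = 1 + 4 * c); last by ring.
have [s10 s00] := (s1, s0); have c40 := c0; have c4 : 0 < 4 * c by lra.
set r := Num.sqrt _; have r2 : r ^+ 2 = 1 + 4 * c by rewrite /r sqr_sqrtr//; lra.
have r1 : 1 < r by rewrite -sqrtr1 ltr_sqrt; lra.
have r0 : 0 < r - 1 by lra.
have cE : c = (r ^+ 2 - 1) / 4 by rewrite r2; field.
have srr : s <= (r + 1) / 2.
  rewrite -(@ler_pXn2r _ 2) ?nnegrE ?s2//; [|exact: ltW|lra].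
  by rewrite cE; nra.
have qE : (1 + 2 * c + r) / (2 * c) * ((1 + 2 * c - r) / (2 * c))^-1 = ((r + 1) / (r - 1)) ^+ 2.
  have E1 : (1 + 2 * c + r) = (r + 1) ^+ 2 / 2 by rewrite cE; field.
  have E2 : (1 + 2 * c - r) = (r - 1) ^+ 2 / 2 by rewrite cE; field.
  by rewrite E1 E2; field; rewrite !gt_eqF.
rewrite qE; split; first exact: sqr_ge0.
have -> : 1 - s^-1 = (s - 1) / s by field; rewrite gt_eqF.
have -> : 1 + s^-1 = (s + 1) / s by field; rewrite gt_eqF.
rewrite mulrAC ler_pM2r ?invr_gt0// -exprM exprMn exprVn mulrA.
rewrite ler_pdivlMr ?exprn_gt0//.
(* Multiplying by [s + 1] turns [s - 1] into [s ^+ 2 - 1], which is [c], a polynomial in [r]; the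
   remaining [s] is bounded through [srr]. *)
rewrite -(ler_pM2r (_ : 0 < s + 1)); last by lra.
have -> : (s - 1) * (r + 1) ^+ (2 * 2) * (s + 1) = (r - 1) * (r + 1) ^+ 5 / 4.
  have -> : (s - 1) * (r + 1) ^+ (2 * 2) * (s + 1) = (s ^+ 2 - 1) * (r + 1) ^+ 4 by ring.
  by rewrite s2 cE; field.
have -> : (s + 1) * (r - 1) ^+ (2 * 2) * (s + 1) = (s + 1) ^+ 2 * (r - 1) ^+ 4 by ring.
have sq : (s + 1) ^+ 2 <= (r + 3) ^+ 2 / 4.
  have : (s + 1) ^+ 2 <= ((r + 3) / 2) ^+ 2 by rewrite ler_pXn2r ?nnegrE//; lra.
  by rewrite (_ : ((r + 3) / 2) ^+ 2 = (r + 3) ^+ 2 / 4)//; field.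
have r14 : 0 <= (r - 1) ^+ 4 by rewrite exprn_ge0// ltW.
apply: (le_trans (ler_wpM2r r14 sq)).
have -> : (r + 3) ^+ 2 / 4 * (r - 1) ^+ 4 = (r - 1) / 4 * ((r - 1) * ((r + 3) * (r - 1)) ^+ 2) by field.
have -> : (r - 1) * (r + 1) ^+ 5 / 4 = (r - 1) / 4 * ((r + 1) * ((r + 1) ^+ 2) ^+ 2) by field.
apply: ler_wpM2l; first by lra.
have P0 : 0 <= (r + 3) * (r - 1) by apply: mulr_ge0; lra.
apply: ler_pM; [lra|exact: sqr_ge0|lra|].
rewrite ler_pXn2r ?nnegrE//; last exact: sqr_ge0.
by rewrite (_ : (r + 1) ^+ 2 = (r + 3) * (r - 1) + 4); [lra|ring].
Qed.

Context (V : lmodType R) (S : set V) (f : V -> V -> R) (hS : semi_ip S f).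

(** Nonnegativity of the squared lengths of [v + s e] and [v - s e], divided by [s], bounds twice
    the absolute value of [f v e] by (f v v + (1 + c) f e e) / s. The choice of [s] lets [c * f e e]
    be absorbed into [a]. *)
Lemma graph_norm_equiv v e a : S v -> S e -> c * f e e <= a ->
  (1 - s^-1) * (f v v + f e e + a) <= a + f (v - e) (v - e) /\
  a + f (v - e) (v - e) <= (1 + s^-1) * (f v v + f e e + a).
Proof.
move=> Sv Se cea; have sS : linear_subspace S := let: And4 h _ _ _ := hS in h.
have H t : 0 <= f v v + 2 * t * f v e + t ^+ 2 * f e e.
  have := sip_sqrD hS 1 t Sv Se; rewrite scale1r expr1n !mul1r mulr1 => <-.
  by apply: (sip_ge0 hS); apply: subspaceD => //; exact: subspaceZ.
have -> : f (v - e) (v - e) = f v v - 2 * f v e + f e e.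
  by have := sip_sqrD hS 1 (-1) Sv Se; rewrite scale1r scaleN1r => ->; ring.
have [Hm Hp] := (H (- s), H s); rewrite sqrrN s2 in Hm; rewrite s2 in Hp.
have s00 := s0; have sm : s^-1 * s = 1 by rewrite mulVf// gt_eqF.
have i0 : 0 < s^-1 by rewrite invr_gt0.
set i := s^-1 in sm i0 *.
set x := f v v in Hm Hp *; set y := f v e in Hm Hp *; set z := f e e in cea Hm Hp *.
have Im : 0 <= i * x - 2 * y + i * (1 + c) * z.
  have := mulr_ge0 (ltW i0) Hm.
  have -> : i * (x + 2 * - s * y + (1 + c) * z) = i * x - 2 * (i * s) * y + i * (1 + c) * z by ring.
  by rewrite sm mulr1.
have Ip : 0 <= i * x + 2 * y + i * (1 + c) * z.
  have := mulr_ge0 (ltW i0) Hp.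
  have -> : i * (x + 2 * s * y + (1 + c) * z) = i * x + 2 * (i * s) * y + i * (1 + c) * z by ring.
  by rewrite sm mulr1.
have Ic : 0 <= i * a - i * c * z by rewrite -mulrA -mulrBr mulr_ge0// ?subr_ge0// ltW.
split; lra.
Qed.

End dpg_constants.

(** * Piecewise polynomials and their coefficients *)

Section polynomials.
Context (R : realType) (d : nat).
Notation pt := (R * 'rV[R]_d)%type.

(** Exposes the coefficients hidden in [is_poly], so that combinations of polynomials become
    combinations of coefficients. *)
Definition poly_of (k : nat) (c : {ffun 'I_d -> 'I_k.+1} -> R) (x : 'rV[R]_d) : R :=
  \sum_(a : {ffun 'I_d -> 'I_k.+1} | (\sum_i a i <= k)%N) c a * \prod_i x ord0 i ^+ a i.

Definition tensor_poly_of (k : nat) (c : 'I_k.+1 -> {ffun 'I_d -> 'I_k.+1} -> R) (z : pt) : R :=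
  \sum_(j < k.+1) z.1 ^+ j * poly_of (c j) z.2.

Lemma is_polyP k (p : 'rV[R]_d -> R) : is_poly k p <-> exists c, p = @poly_of k c.
Proof.
split=> [[c cE]|[c ->]]; last by exists c.
by exists c; apply/funext.
Qed.

Lemma is_tensor_polyP k (p : pt -> R) :
  is_tensor_poly k p <-> exists c, p = @tensor_poly_of k c.
Proof.
split=> [[q qP pE]|[c ->]]; last first.
  by exists (fun j => poly_of (c j)) => // j; apply/is_polyP; exists (c j).
have /choice[c cE] : forall j, exists c, q j = @poly_of k c by move=> j; exact/is_polyP.
by exists c; apply/funext => z; rewrite pE; apply: eq_bigr => j _; rewrite cE.
Qed.

Lemma poly_of_suml k (I : finType) (a : I -> R) (c : I -> {ffun 'I_d -> 'I_k.+1} -> R) x :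
  poly_of (fun e => \sum_i a i * c i e) x = \sum_i a i * poly_of (c i) x.
Proof.
rewrite /poly_of; under eq_bigr do rewrite mulr_suml.
rewrite exchange_big; apply: eq_bigr => i _; rewrite mulr_sumr.
by apply: eq_bigr => e _; rewrite mulrA.
Qed.

Lemma tensor_poly_of_suml k (I : finType) (a : I -> R)
  (c : I -> 'I_k.+1 -> {ffun 'I_d -> 'I_k.+1} -> R) z :
  tensor_poly_of (fun j e => \sum_i a i * c i j e) z = \sum_i a i * tensor_poly_of (c i) z.
Proof.
rewrite /tensor_poly_of; under eq_bigr do rewrite poly_of_suml mulr_sumr.
rewrite exchange_big; apply: eq_bigr => i _; rewrite mulr_sumr.
by apply: eq_bigr => j _; rewrite mulrCA.
Qed.

Lemma poly_of_lin k a (c c' : {ffun 'I_d -> 'I_k.+1} -> R) x :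
  poly_of (fun e => a * c e + c' e) x = a * poly_of c x + poly_of c' x.
Proof.
rewrite /poly_of mulr_sumr -big_split; apply: eq_bigr => e _ /=.
by rewrite mulrDl mulrA.
Qed.

Lemma tensor_poly_of_lin k a (c c' : 'I_k.+1 -> {ffun 'I_d -> 'I_k.+1} -> R) z :
  tensor_poly_of (fun j e => a * c j e + c' j e) z = a * tensor_poly_of c z + tensor_poly_of c' z.
Proof.
rewrite /tensor_poly_of mulr_sumr -big_split; apply: eq_bigr => j _ /=.
by rewrite poly_of_lin mulrDr mulrCA.
Qed.

Lemma poly_of_eq0 k (c : {ffun 'I_d -> 'I_k.+1} -> R) x :
  (forall e, c e = 0) -> poly_of c x = 0.
Proof. by move=> c0; rewrite /poly_of big1// => e _; rewrite c0 mul0r. Qed.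

Lemma tensor_poly_of_eq0 k (c : 'I_k.+1 -> {ffun 'I_d -> 'I_k.+1} -> R) z :
  (forall j e, c j e = 0) -> tensor_poly_of c z = 0.
Proof. by move=> c0; rewrite /tensor_poly_of big1// => j _; rewrite poly_of_eq0 ?mulr0. Qed.

Lemma smooth_tensor_poly_of k (c : 'I_k.+1 -> {ffun 'I_d -> 'I_k.+1} -> R) :
  smooth (tensor_poly_of c).
Proof.
apply: smooth_sum => j _; apply: smoothM.
  apply: smoothX; have := @smooth_coord R d ord0; congr smooth.
  by apply/funext => z; exact: coord0.
apply: smooth_sum => e _; apply: smoothM; first exact: smooth_cst.
apply: smooth_prod => i _; apply: smoothX.
have := @smooth_coord R d (lift ord0 i); congr smooth.
by apply/funext => z; exact: coord_lift.
Qed.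

Lemma tensor_poly_cst k (r : R) : is_tensor_poly k (fun _ : pt => r).
Proof.
apply/is_tensor_polyP.
exists (fun j e => if (j == ord0) && (e == [ffun=> ord0]) then r else 0).
apply/funext => z; rewrite /tensor_poly_of (bigD1 ord0)//= expr0 mul1r [X in _ + X]big1 ?addr0.
  rewrite /poly_of (bigD1 [ffun=> ord0])/=; last by rewrite big1// => i _; rewrite ffunE.
  rewrite eqxx big1 ?mulr1.
    by rewrite big1 ?addr0// => e /andP[_ /negbTE ->]; rewrite mul0r.
  by move=> i _; rewrite ffunE expr0.
move=> j j0; rewrite [X in _ * X](_ : _ = 0) ?mulr0//.
by rewrite /poly_of big1// => e _; rewrite (negbTE j0) mul0r.
Qed.

End polynomials.

Lemma filterS2_pt (R : realType) (d : nat) (P1 P2 P : R * 'rV[R]_d -> Prop) :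
  (forall z, P1 z -> P2 z -> P z) -> {ae mu_tx R d, forall z, P1 z} ->
  {ae mu_tx R d, forall z, P2 z} -> {ae mu_tx R d, forall z, P z}.
Proof.
exact: (@filterS2 (measurableTypeR R * 'rV[R]_d)%type (almost_everywhere (mu_tx R d))
  _ P1 P2 P).
Qed.

Section broken_polynomials.
Context (R : realType) (d : nat) (Omega : set 'rV[R]_d) (Tend : R) (N : nat).
Context (K : 'I_N -> cell R d).
Notation pt := (R * 'rV[R]_d)%type.
Notation ptM := (measurableTypeR R * 'rV[R]_d)%type.
Notation mu := (mu_tx R d).
Notation mux := (mu_x R d).

Lemma broken_T_lin k a v v' : broken_T Omega Tend K k v -> broken_T Omega Tend K k v' ->
  broken_T Omega Tend K k (fun z => a * v z + v' z).
Proof.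
move=> [vL Hv] [vL' Hv']; split; first exact: inL2_lin.
move=> i; have [p /is_tensor_polyP[c ->] vp] := Hv i.
have [p' /is_tensor_polyP[c' ->] vp'] := Hv' i.
exists (fun z => a * tensor_poly_of c z + tensor_poly_of c' z).
  apply/is_tensor_polyP; eexists; apply/funext => z.
  by symmetry; exact: tensor_poly_of_lin.
by apply: filterS2_pt vp vp' => z H H' zi; rewrite H// H'.
Qed.

Lemma broken_T0 k : broken_T Omega Tend K k (fun=> 0).
Proof.
split=> [|i]; first exact: inL2_0.
by exists (fun=> 0); [exact: tensor_poly_cst|exact: aeW].
Qed.

Lemma broken_Tv_lin k a tau tau' : broken_Tv Omega Tend K k tau ->
  broken_Tv Omega Tend K k tau' -> broken_Tv Omega Tend K k (fun z => a *: tau z + tau' z).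
Proof.
move=> H H' i; under eq_fun do rewrite !mxE.
exact: broken_T_lin.
Qed.

Lemma broken_Tv0 k : broken_Tv Omega Tend K k (fun=> 0).
Proof. by move=> i; under eq_fun do rewrite mxE; exact: broken_T0. Qed.

Lemma initial_P_lin k a v v' : initial_P Omega K k v -> initial_P Omega K k v' ->
  initial_P Omega K k (fun z => a * v z + v' z).
Proof.
move=> [vL Hv] [vL' Hv']; split; first exact: inL2_lin.
move=> i Hi; have [p /is_polyP[c ->] vp] := Hv i Hi.
have [p' /is_polyP[c' ->] vp'] := Hv' i Hi.
exists (fun z => a * poly_of c z + poly_of c' z).
  apply/is_polyP; eexists; apply/funext => z.
  by symmetry; exact: poly_of_lin.
by apply: filterS2 vp vp' => z H H' zi; rewrite H// H'.
Qed.

Lemma initial_P0 k : initial_P Omega K k (fun=> 0).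
Proof.
split=> [|i _]; first exact: inL2_0.
exists (fun=> 0); last exact: aeW.
by apply/is_polyP; exists (fun=> 0); apply/funext => x; rewrite poly_of_eq0.
Qed.

Lemma space_Yh_linear : linear_subspace (V := ysp R d) (space_Yh Omega Tend K).
Proof.
split=> [|a y y' [H1 H2 H3] [H1' H2' H3']].
- by split; [exact: broken_T0|exact: broken_Tv0|exact: initial_P0].
- by split; [exact: broken_T_lin|exact: broken_Tv_lin|exact: initial_P_lin].
Qed.

End broken_polynomials.

(** * Integration by parts in space and the space of normal traces *)

Section integral_ae_subset.
Import HBNNSimple.
Local Open Scope ereal_scope.
Context d (T : measurableType d) (R : realType) (mu : {measure set T -> \bar R}).

(** The integral is a supremum over simple functions below [f], and such a function agrees almost
    everywhere with its restriction to [E]. Working with simple functions admits fields known to be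
    measurable only inside Q, on closed cells that touch its boundary. *)
Lemma ge0_integral_ae_subset (D E : set T) (f : T -> \bar R) : measurable E -> E `<=` D ->
  {ae mu, forall x, D x -> E x} -> (forall x, 0 <= f x) ->
  \int[mu]_(x in D) f x = \int[mu]_(x in E) f x.
Proof.
move=> mE ED aeDE f0; rewrite !ge0_integralE//.
apply/eqP; rewrite eq_le; apply/andP; split; last first.
  apply: le_ereal_sup => _ [h /= hf <-]; exists h => // x; apply: (le_trans (hf x)); rewrite !patchE.
  case: ifPn => xE; first by rewrite mem_set//; apply: ED; exact: set_mem.
  by case: ifPn.
apply: ge_ereal_sup => _ [h /= hf <-].
apply: ereal_sup_ubound; exists (proj_nnsfun h mE).
  move=> x; rewrite -(mrestrict h mE) !patchE; case: ifPn => // xE.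
  by have := hf x; rewrite patchE mem_set//; apply: ED; exact: set_mem.
rewrite -!integralT_nnsfun; apply: ge0_ae_eq_integral => //.
- by apply/measurable_EFinP; exact: measurable_funP.
- by apply/measurable_EFinP; exact: measurable_funP.
- by move=> x _; rewrite lee_fin.
- by move=> x _; rewrite lee_fin.
- apply: filterS aeDE => x DE _; rewrite -(mrestrict h mE) patchE; case: ifPn => // xE.
  have := hf x; rewrite patchE; case: ifPn => [xD|_ hx].
    by move: xE; rewrite notin_setE => /(_ (DE (set_mem xD))).
  have {}hx : (h x)%:E <= 0 by exact: hx.
  by congr EFin; apply/eqP; rewrite eq_le -2!lee_fin hx andbT lee_fin fun_ge0.
Qed.

(* No measurability of f is assumed. *)
Lemma Rintegral_ae_subset (D E : set T) (f : T -> R) : measurable E -> E `<=` D ->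
  {ae mu, forall x, D x -> E x} -> (\int[mu]_(x in D) f x = \int[mu]_(x in E) f x)%R.
Proof.
move=> mE ED aeDE; rewrite /Rintegral integralE [in RHS]integralE.
by congr (fine (_ - _)); apply: ge0_integral_ae_subset.
Qed.

End integral_ae_subset.

Section smooth_space.
Context (R : realType) (d : nat).
Notation rv := 'rV[R]_d.
Notation mux := (mu_x R d).

Lemma test_fun_derive (V : normedModType R) (D : set V) (phi : V -> R) v :
  test_fun D phi -> test_fun D (fun x => 'D_v phi x).
Proof.
move=> [sphi cphi phiD].
have sub : csupp (fun x => 'D_v phi x) `<=` csupp phi.
  have cl : closed (csupp phi) by exact: closed_closure.
  rewrite [X in _ `<=` X](closure_id _).1//; apply: closureS => x /= /eqP dx.
  have [|nx] := pselect (csupp phi x); first by [].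
  have T : test_fun (csupp phi) phi by split.
  by case: dx; exact: (test_fun_out T).2.
split; first exact: smooth_derive.
- by apply: (subclosed_compact _ cphi) => //; exact: closed_closure.
- exact: subset_trans phiD.
Qed.

Definition rv_box (M : R) : set rv := [set x | forall j, - M <= x ord0 j <= M].

Lemma continuous_bounded_rv_box (f : rv -> R) M : continuous f ->
  exists C, forall x, rv_box M x -> `|f x| <= C.
Proof.
move=> cf; pose a : 'I_d.+1 -> R := fun=> - `|M|; pose b : 'I_d.+1 -> R := fun=> `|M|.
have cf2 : continuous (fun z : R * rv => f z.2).
  by move=> z; apply: continuous_comp; [exact: cvg_snd|exact: cf].
have [C HC] := continuous_bounded_cbox a b cf2.
exists C => x xM; apply: (HC (0, x)) => k; rewrite /a /b.
case: (unliftP ord0 k) => [j ->|->].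
  rewrite coord_lift /=; have /andP[h1 h2] := xM j; have := ler_norm M.
  by move=> h; apply/andP; split; lra.
by rewrite coord0 /= oppr_le0 normr_ge0.
Qed.

Let B (M : R) : set rv := rv_obox (fun=> - (M + 1)) (fun=> M + 1).

Let Boo M : (mux (B M) < +oo)%E.
Proof.
by have [r [-> _ _]] := mu_x_rv_obox (fun _ : 'I_d => - (M + 1)) (fun=> M + 1); rewrite ltry.
Qed.

Let Bbox M : rv_box M `<=` B M.
Proof. by move=> x xM j; have := xM j; lra. Qed.

Lemma continuous_support_integrable_rv (f : rv -> R) M : continuous f ->
  (forall x, ~ rv_box M x -> f x = 0) -> mux.-integrable setT (fun x => (f x)%:E).
Proof.
move=> cf f0; have [C HC] := continuous_bounded_rv_box (M + 1) cf.
apply: (@integrable_bounded_support _ _ _ mux (B M) f C) => //.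
- exact: measurable_rv_obox.
- exact: continuous_measurable_rv.
- by move=> x xB; apply: HC => j; have := xB j; lra.
- by move=> x xB; apply: f0 => /Bbox.
Qed.

Lemma continuous_support_inL2_rv (f : rv -> R) M D : measurable D -> continuous f ->
  (forall x, ~ rv_box M x -> f x = 0) -> inL2 mux D f.
Proof.
move=> mD cf f0; have [C HC] := continuous_bounded_rv_box (M + 1) cf.
apply: (@inL2_bounded_support _ _ _ mux (B M) D f C) => //.
- exact: measurable_rv_obox.
- exact: continuous_measurable_rv.
- by move=> x xB; apply: HC => j; have := xB j; lra.
- by move=> x xB; apply: f0 => /Bbox.
Qed.

Lemma continuous_inL2_rv (f : rv -> R) M D : measurable D -> D `<=` rv_box M ->
  continuous f -> inL2 mux D f.
Proof.
move=> mD DM cf; have [C HC] := continuous_bounded_rv_box (M + 1) cf.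
have mB : measurable (B M) by exact: measurable_rv_obox.
have DB : D `<=` B M by exact: subset_trans (@Bbox M).
apply: (inL2_subset mB mD DB); apply: (inL2_bounded (C := C)) => //.
- by apply: measurable_funTS; exact: continuous_measurable_rv.
- by move=> x xB; apply: HC => j; have := xB j; lra.
Qed.

Lemma test_inL2_rv (phi : rv -> R) D E : measurable E -> test_fun D phi -> inL2 mux E phi.
Proof.
move=> mE tphi; have [M HM] := test_fun_bounded_support_rv tphi.
by apply: continuous_support_inL2_rv HM => //; apply: smooth_continuous; have [] := tphi.
Qed.

Lemma test_grad_inL2_rv (phi : rv -> R) D E : measurable E -> test_fun D phi ->
  inL2v mux E (grad phi).
Proof.
move=> mE tphi i; under eq_fun do rewrite mxE.
exact: test_inL2_rv mE (test_fun_derive (e_x R i) tphi).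
Qed.

Lemma smooth_by_parts_rv (i : 'I_d) (f phi : rv -> R) (D : set rv) : smooth f ->
  measurable D -> test_fun D phi ->
  ip mux D f (fun x => 'D_(e_x R i) phi x) = - ip mux D (fun x => 'D_(e_x R i) f x) phi.
Proof.
move=> sf mD tphi; have [sphi _ _] := tphi; have [phi0 dphi0D] := test_fun_out tphi.
have [M HM] := test_fun_bounded_support_rv tphi.
have [M' HM'] := test_fun_bounded_support_rv (test_fun_derive (e_x R i) tphi).
apply: ip_opp_by_parts => //.
- apply: (continuous_support_integrable_rv (M := M')).
    by apply: smooth_continuous; apply: smoothM => //; exact: smooth_derive.
  by move=> x xM; rewrite HM' ?mulr0.
- apply: (continuous_support_integrable_rv (M := M)).
    by apply: smooth_continuous; apply: smoothM => //; exact: smooth_derive.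
  by move=> x xM; rewrite HM ?mulr0.
- by move=> x; exact: dphi0D.
- apply: (integral_derive_rv (i := i) (f := fun x => f x * phi x) (M := M)) => //.
  + by move=> x; exact: smooth_product_is_derive.
  + exact: smooth_product_continuous.
  + by move=> x xM; rewrite HM ?mulr0.
Qed.

End smooth_space.

Lemma filterS2_line (R : realType) (P1 P2 P : R -> Prop) :
  (forall t, P1 t -> P2 t -> P t) -> {ae @lebesgue_measure R, forall t, P1 t} ->
  {ae @lebesgue_measure R, forall t, P2 t} -> {ae @lebesgue_measure R, forall t, P t}.
Proof.
exact: (@filterS2 (measurableTypeR R) (almost_everywhere (@lebesgue_measure R)) _ P1 P2 P).
Qed.

Section normal_traces.
Context (R : realType) (d : nat) (Omega : set 'rV[R]_d) (Tend : R) (N : nat).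
Context (K : 'I_N -> cell R d) (kappa : R).
Hypotheses (hd : (0 < d)%N) (hOmega : polyhedral_lipschitz_domain Omega).
Hypothesis hTend : 0 < Tend.
Hypothesis hK : space_time_partition Omega Tend K kappa.
Notation pt := (R * 'rV[R]_d)%type.
Notation ptM := (measurableTypeR R * 'rV[R]_d)%type.
Notation mu := (mu_tx R d).
Notation mux := (mu_x R d).
Notation fld := (fld R d).
Notation Q := (Qdom Omega Tend).

Let mQ : measurable (Q : set ptM) := open_measurable_pt (open_Q hOmega).
Let oK i : open (Kint K i). Proof. exact: open_Kint. Qed.
Arguments oK : clear implicits.
Let mK i : measurable (Kint K i : set ptM) := open_measurable_pt (oK i).
Let KQ i : Kint K i `<=` Q. Proof. by move=> z; exact: (Kint_subset_Q hOmega hK). Qed.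
Arguments KQ : clear implicits.

(** A closed cell exceeds its interior by a null set. On the interior, which lies in Q, the fields
    are square-integrable and the flux is linear. *)
Lemma lateral_fluxE i (tau : pt -> 'rV[R]_d) (h w : pt -> R) :
  lateral_flux K i tau h w =
  ip mu (Kint K i) h w + ipv mu (Kint K i) tau (grad_x w).
Proof.
have H := cell_ae_Kint hd hK i.
congr (_ + _); apply: Rintegral_ae_subset => //; exact: Kint_cell.
Qed.

Lemma lateral_flux_lin i a (tau tau' : pt -> 'rV[R]_d) (h h' w : pt -> R) :
  inL2v mu Q tau -> inL2v mu Q tau' -> inL2 mu Q h -> inL2 mu Q h' -> smooth w ->
  lateral_flux K i (fun z => a *: tau z + tau' z) (fun z => a * h z + h' z) w =
  a * lateral_flux K i tau h w + lateral_flux K i tau' h' w.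
Proof.
move=> tL tL' hL hL' sw; rewrite !lateral_fluxE.
have [M HM] := cell_bounded hOmega hTend hK.
have KM : Kint K i `<=` cbox (fun=> - M) (fun=> M).
  by apply: subset_trans (HM i); exact: Kint_cell.
have wL : inL2 mu (Kint K i) w by exact: smooth_inL2 KM.
have gL : inL2v mu (Kint K i) (grad_x w).
  by move=> j; apply: (smooth_inL2 (M := M)) => //; exact: smooth_grad.
have sub f : inL2 mu Q f -> inL2 mu (Kint K i) f by apply: inL2_subset => //; exact: KQ.
have subv (f : ptM -> 'rV[R]_d) : inL2v mu Q f -> inL2v mu (Kint K i) f by move=> H j; exact: sub (H j).
rewrite (ip_lin a (mK i) (sub _ hL) (sub _ hL') wL).
rewrite (ipv_lin a (mK i) (subv _ tL) (subv _ tL') gL); ring.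
Qed.

Lemma is_divx_lin a tau tau' h h' : is_divx Omega Tend tau h -> is_divx Omega Tend tau' h' ->
  is_divx Omega Tend (fun z => a *: tau z + tau' z) (fun z => a * h z + h' z).
Proof.
move=> [tL hL H] [tL' hL' H']; split; [exact: inL2v_lin|exact: inL2_lin|].
have mO := open_measurable_rv (open_Omega hOmega).
apply: filterS2_line H H' => t H H' It.
have [tt ht Ht] := H It; have [tt' ht' Ht'] := H' It.
split; [exact: inL2v_lin|exact: inL2_lin|] => phi tphi.
have gL := test_grad_inL2_rv mO tphi; have pL := test_inL2_rv mO tphi.
rewrite (ipv_lin a mO tt tt' gL) (ip_lin a mO ht ht' pL) Ht// Ht'//; ring.
Qed.

Lemma space_Wh_lin a tau tau' : space_Wh Omega Tend K tau -> space_Wh Omega Tend K tau' ->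
  space_Wh Omega Tend K (fun z => a *: tau z + tau' z).
Proof.
move=> [h Dh Ch] [h' Dh' Ch']; exists (fun z => a * h z + h' z); first exact: is_divx_lin.
have [tL hL _] := Dh; have [tL' hL' _] := Dh'.
move=> i j Cij nu Hnu; have [c cP] := Ch i j Cij nu Hnu; have [c' cP'] := Ch' i j Cij nu Hnu.
exists (a * c + c') => w sw Hw; rewrite lateral_flux_lin// cP// cP'//; ring.
Qed.

Lemma space_Wh0 : space_Wh Omega Tend K (fun=> 0).
Proof.
have z2 d' (T : measurableType d') (m : {measure set T -> \bar R}) (D : set T) :
    inL2v m D (fun=> 0 : 'rV[R]_d).
  by move=> i; under eq_fun do rewrite mxE; exact: inL2_0.
exists (fun=> 0).
  split; [exact: z2|exact: inL2_0|apply: aeW => t _].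
  by split; [exact: z2|exact: inL2_0|move=> phi _; rewrite ipv_0l ip_0l oppr0].
move=> i j _ nu _; exists 0 => w _ _.
by rewrite mul0r /lateral_flux ipv_0l ip_0l addr0.
Qed.

End normal_traces.

(** * Limits in semi-inner products, time slices and functions with zero boundary values *)

Section semi_ip_limits.
Context (R : realType) (V : lmodType R) (S : set V) (s : V -> V -> R).
Hypothesis hs : semi_ip S s.
Let sS : linear_subspace S := let: And4 h _ _ _ := hs in h.

Lemma sip_triangle a u v : S u -> S v ->
  Num.sqrt (s (a *: u + v) (a *: u + v)) <=
  `|a| * Num.sqrt (s u u) + Num.sqrt (s v v).
Proof.
move=> Su Sv; have := sip_sqrD hs a 1 Su Sv; rewrite scale1r => ->.
rewrite expr1n mul1r mulr1.
have CS := sip_CS_sqrt hs Su Sv; have [u0 v0] := (sip_ge0 hs Su, sip_ge0 hs Sv).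
set x := Num.sqrt (s u u) in CS *; set y := Num.sqrt (s v v) in CS *.
have xE : s u u = x ^+ 2 by rewrite sqr_sqrtr.
have yE : s v v = y ^+ 2 by rewrite sqr_sqrtr.
have [x0 y0] : 0 <= x /\ 0 <= y by split; exact: sqrtr_ge0.
rewrite -[leRHS]ger0_norm ?addr_ge0 ?mulr_ge0// -sqrtr_sqr ler_sqrt ?sqr_ge0//.
rewrite xE yE sqrrD exprMn real_normK ?num_real// lerD2r lerD2l.
have -> : `|a| * x * y *+ 2 = 2 * (`|a| * (x * y)) by rewrite -mulr_natl; ring.
rewrite -mulrA ler_pM2l//; apply: (le_trans (ler_norm _)); rewrite normrM.
by apply: ler_wpM2l.
Qed.

Lemma sip_cvg_triangle a (u v : nat -> V) : (forall n, S (u n)) -> (forall n, S (v n)) ->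
  Num.sqrt (s (u n) (u n)) @[n --> \oo] --> (0 : R) ->
  Num.sqrt (s (v n) (v n)) @[n --> \oo] --> (0 : R) ->
  Num.sqrt (s (a *: u n + v n) (a *: u n + v n)) @[n --> \oo] --> (0 : R).
Proof.
move=> Su Sv u0 v0.
have H : `|a| * Num.sqrt (s (u n) (u n)) + Num.sqrt (s (v n) (v n)) @[n --> \oo] --> (0 : R).
  have H1 : `|a| * Num.sqrt (s (u n) (u n)) @[n --> \oo] --> `|a| * (0 : R) by exact: cvgMl_tmp.
  have H := cvgD H1 v0; rewrite mulr0 addr0 in H; exact: H.
apply: (squeeze_cvgr (f := fun=> 0) (h := fun n => `|a| * Num.sqrt (s (u n) (u n)) + Num.sqrt (s (v n) (v n)))).
- by near=> n; rewrite sqrtr_ge0 sip_triangle.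
- exact: cvg_cst.
- exact: H.
Unshelve. all: by end_near. Qed.

Lemma sip_cvgl (u : nat -> V) v w : (forall n, S (u n)) -> S v -> S w ->
  Num.sqrt (s (u n - v) (u n - v)) @[n --> \oo] --> (0 : R) ->
  s (u n) w @[n --> \oo] --> s v w.
Proof.
move=> Su Sv Sw uv.
have Suv n : S (u n - v) by exact: subspaceB.
have H : Num.sqrt (s (u n - v) (u n - v)) * Num.sqrt (s w w) @[n --> \oo] --> (0 : R).
  have H : Num.sqrt (s (u n - v) (u n - v)) * Num.sqrt (s w w) @[n --> \oo] --> (0 : R) * Num.sqrt (s w w).
    exact: cvgMr_tmp.
  rewrite mul0r in H; exact: H.
apply/cvgrPdist_le => e e0.
have := H => /cvgrPdist_le /(_ e e0); apply: filterS => n.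
rewrite sub0r normrN => Hn; rewrite distrC -(sip_Bl hs)//.
apply: (le_trans (sip_CS_sqrt hs (Suv n) Sw)).
by rewrite -[leLHS]ger0_norm// mulr_ge0// sqrtr_ge0.
Qed.

End semi_ip_limits.

Section L2_semi_ip.
Context d (T : measurableType d) (R : realType) (mu : {measure set T -> \bar R}).
Context (D : set T).
Hypothesis mD : measurable D.

Lemma ip_semi_ip : semi_ip (V := T -> R) (inL2 mu D) (ip mu D).
Proof.
split.
- by split=> [|a u v Hu Hv]; [exact: inL2_0|exact: inL2_lin].
- by move=> a u v w Hu Hv Hw; exact: ip_lin.
- by move=> u v _ _; exact: ip_sym.
- by move=> u _; exact: ip_ge0.
Qed.

Lemma ipv_semi_ip n : semi_ip (V := T -> 'rV[R]_n) (inL2v mu D) (ipv mu D).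
Proof.
split.
- split=> [|a u v Hu Hv]; last exact: inL2v_lin.
  move=> i; rewrite (_ : (fun x => (0 : T -> 'rV[R]_n) x ord0 i) = (fun=> 0)); first exact: inL2_0.
  by apply/funext => x; rewrite mxE.
- by move=> a u v w Hu Hv Hw; exact: ipv_lin.
- by move=> u v _ _; exact: ipv_sym.
- by move=> u _; exact: ipv_ge0.
Qed.

End L2_semi_ip.

Section slices.
Context (R : realType) (d : nat).
Notation pt := (R * 'rV[R]_d)%type.
Notation rv := 'rV[R]_d.

Lemma derive_slice (p : pt -> R) t e x :
  'D_e (fun y : rv => p (t, y)) x = 'D_((0, e) : pt) p (t, x).
Proof.
have E (h : R) : (t, h *: e + x) = h *: ((0, e) : pt) + (t, x).
  by rewrite [RHS]surjective_pairing /= scaler0 add0r.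
by rewrite /derive; under eq_fun do rewrite /= E.
Qed.

Lemma smooth_slice (p : pt -> R) t : smooth p -> smooth (fun x : rv => p (t, x)).
Proof.
move=> sp k; elim: k p sp => [|k IH] p sp.
  split => // x; apply: continuous_comp; first exact: continuous_pairr.
  exact: (smooth_continuous sp).
split.
  move=> x; apply: continuous_comp; first exact: continuous_pairr.
  exact: (smooth_continuous sp).
split=> [x v|v].
  have D : is_derive ((t, x) : pt) ((0, v) : pt) p ('D_((0, v) : pt) p (t, x)).
    by constructor => //; exact: smooth_derivable.
  have /is_derive_line L := D.
  suff : is_derive x v (fun y : rv => p (t, y)) ('D_((0, v) : pt) p (t, x)) by case.
  apply/is_derive_line; move: L.
  have -> // : (fun h : R => p (h *: ((0, v) : pt) + (t, x))) = (fun h : R => p (t, h *: v + x)).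
  by apply/funext => h; congr p; rewrite [LHS]surjective_pairing /= scaler0 add0r.
have -> : (fun x : rv => 'D_v (fun y : rv => p (t, y)) x : R) =
    (fun x : rv => 'D_((0, v) : pt) p (t, x)).
  by apply/funext => x; exact: derive_slice.
exact: (IH (fun z : pt => 'D_((0, v) : pt) p z) (smooth_derive ((0, v) : pt) sp)).
Qed.

Lemma test_fun_slice (I : set R) (Om : set rv) (p : pt -> R) t : test_fun (I `*` Om) p ->
  test_fun Om (fun x : rv => p (t, x)).
Proof.
move=> [sp cp pD]; pose C := snd @` (csupp p `&` [set z : pt | z.1 = t]).
have cC : compact C.
  apply: continuous_compact; first by apply: continuous_subspaceT => z; exact: cvg_snd.
  apply: compact_closedI => //.
  have -> : [set z : pt | z.1 = t] = fst @^-1` [set t] by [].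
  by apply: closed_comp => [z _|]; [exact: cvg_fst|exact: closed_eq].
have sub : csupp (fun x : rv => p (t, x)) `<=` [set x | csupp p (t, x)].
  have cl : closed [set x : rv | csupp p (t, x)].
    apply: (@closed_comp _ _ (fun x : rv => ((t, x) : pt)) (csupp p)) => [x _|].
      exact: continuous_pairr.
    exact: closed_closure.
  rewrite [X in _ `<=` X](closure_id _).1//; apply: closureS => x /= px.
  exact: subset_closure.
split; first exact: smooth_slice.
- apply: (subclosed_compact _ cC); first exact: closed_closure.
  by move=> x /sub xC; exists (t, x).
- by move=> x /sub /pD[].
Qed.

End slices.

Section H10_fields.
Context (R : realType) (d : nat).
Notation rv := 'rV[R]_d.
Notation mux := (mu_x R d).
Context (Om : set rv).
Hypothesis mO : measurable Om.

Lemma test_fun_lin (V : normedModType R) (D : set V) a (f g : V -> R) :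
  test_fun D f -> test_fun D g -> test_fun D (fun x => a * f x + g x).
Proof.
move=> [sf cf fD] [sg cg gD].
have sub : csupp (fun x => a * f x + g x) `<=` csupp f `|` csupp g.
  have cl : closed (csupp f `|` csupp g) by apply: closedU; exact: closed_closure.
  rewrite [X in _ `<=` X](closure_id _).1//; apply: closureS => x /= fg.
  have [f0|f0] := eqVneq (f x) 0; last by left; exact: subset_closure.
  right; apply: subset_closure; move: fg; rewrite f0 mulr0 add0r; exact.
split; first by apply: smoothD => //; apply: smoothM => //; exact: smooth_cst.
- apply: (subclosed_compact _ (compactU cf cg)) => //; exact: closed_closure.
- by apply: (subset_trans sub) => x [/fD|/gD].
Qed.

Lemma grad_lin a (f g : rv -> R) : smooth f -> smooth g ->
  grad (fun x => a * f x + g x) = (fun x => a *: grad f x + grad g x).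
Proof.
move=> sf sg; apply/funext => x; apply/rowP => i; rewrite !mxE.
have saf : smooth (fun x : rv => a * f x) by apply: smoothM => //; exact: smooth_cst.
rewrite deriveD; [|exact: smooth_derivable|exact: smooth_derivable].
congr (_ + _); have H := smooth_product_is_derive x (e_x R i) (smooth_cst _ a) sf.
by rewrite (derive_val (is_derive := H)) derive_cst mul0r addr0.
Qed.

Lemma H10_lin a v v' g g' : H10_with_grad Om v g -> H10_with_grad Om v' g' ->
  H10_with_grad Om (fun x => a * v x + v' x) (fun x => a *: g x + g' x).
Proof.
move=> [vL gL [p [tp pv pg]]] [vL' gL' [p' [tp' pv' pg']]].
split; [exact: inL2_lin|exact: inL2v_lin|].
exists (fun n x => a * p n x + p' n x); split; first by move=> n; exact: test_fun_lin.
- have H := sip_cvg_triangle (ip_semi_ip mux mO) a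
    (u := fun n (x : rv) => p n x - v x) (v := fun n (x : rv) => p' n x - v' x) _ _ pv pv'.
  apply: cvg_trans (H _ _).
  + apply: near_eq_cvg; near=> n; congr Num.sqrt.
    by congr ip; apply/funext => x; rewrite /=;
      change (a * (p n x - v x) + (p' n x - v' x) = a * p n x + p' n x - (a * v x + v' x)); ring.
  + by move=> n; apply: inL2_B => //; exact: test_inL2_rv mO (tp n).
  + by move=> n; apply: inL2_B => //; exact: test_inL2_rv mO (tp' n).
- have sV := ipv_semi_ip mux mO d.
  have H := sip_cvg_triangle sV a
    (u := fun n (x : rv) => grad (p n) x - g x) (v := fun n (x : rv) => grad (p' n) x - g' x) _ _ pg pg'.
  apply: cvg_trans (H _ _).
  + apply: near_eq_cvg; near=> n; congr Num.sqrt.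
    have [sp _ _] := tp n; have [sp' _ _] := tp' n.
    congr ipv; apply/funext => x; rewrite grad_lin//;
    change (a *: (grad (p n) x - g x) + (grad (p' n) x - g' x) =
      a *: grad (p n) x + grad (p' n) x - (a *: g x + g' x));
    by rewrite scalerBr opprD addrACA.
  + move=> n; apply: (subspaceB (let: And4 h _ _ _ := sV in h)) => //.
    exact: test_grad_inL2_rv mO (tp n).
  + move=> n; apply: (subspaceB (let: And4 h _ _ _ := sV in h)) => //.
    exact: test_grad_inL2_rv mO (tp' n).
Unshelve. all: by end_near. Qed.

(** The formula is classical for the approximating test functions, and both sides are continuous for
    convergence of values and gradients in L^2. The boundary values of [f] are free. *)
Lemma H10_by_parts v g (i : 'I_d) (f : rv -> R) M : Om `<=` rv_box M -> smooth f ->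
  H10_with_grad Om v g ->
  ip mux Om v (fun x => 'D_(e_x R i) f x) = - ip mux Om (fun x => g x ord0 i) f.
Proof.
move=> OM sf [vL gL [p [tp pv pg]]].
have fL : inL2 mux Om f by apply: (continuous_inL2_rv mO OM); exact: smooth_continuous.
have dfL : inL2 mux Om (fun x => 'D_(e_x R i) f x).
  by apply: (continuous_inL2_rv mO OM); apply: smooth_continuous; exact: smooth_derive.
have pL n : inL2 mux Om (p n) by exact: test_inL2_rv mO (tp n).
have gpL n : inL2v mux Om (grad (p n)) by exact: test_grad_inL2_rv mO (tp n).
pose F (x : rv) : rv := f x *: e_x R i.
have FE j : (fun x => F x ord0 j) = (fun x => f x * (j == i)%:R).
  by apply/funext => x; rewrite !mxE eqxx.
have FL : inL2v mux Om F.
  by move=> j; rewrite FE; under eq_fun do rewrite mulrC; exact: inL2_Z.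
have ipF (w : rv -> rv) : inL2v mux Om w -> ipv mux Om w F = ip mux Om (fun x => w x ord0 i) f.
  move=> wL; rewrite ipv_sumE// (bigD1 i)//= big1 ?addr0.
    by congr ip; rewrite FE; apply/funext => x; rewrite eqxx mulr1.
  move=> j ji; rewrite FE ip_sym -[RHS](ip_0l mux Om (fun x => w x ord0 j)); congr ip.
  by apply/funext => x; rewrite (negbTE ji) mulr0.
have L1 := sip_cvgl (ip_semi_ip mux mO) pL vL dfL pv.
have L2 := sip_cvgl (ipv_semi_ip mux mO d) gpL gL FL pg.
rewrite -(ipF _ gL).
have L3 : - ipv mux Om (grad (p n)) F @[n --> \oo] --> - ipv mux Om g F by exact: cvgN.
have E : (fun n => ip mux Om (p n) (fun x => 'D_(e_x R i) f x)) = (fun n => - ipv mux Om (grad (p n)) F).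
  apply/funext => n; have H := smooth_by_parts_rv i sf mO (tp n).
  rewrite ipF// ip_sym -[LHS]opprK -H ip_sym; congr (- _).
  by congr ip; apply/funext => x; rewrite mxE.
by rewrite E in L1; exact: (cvg_unique _ L1 L3).
Qed.

End H10_fields.

Lemma filterS_line (R : realType) (P1 P : R -> Prop) :
  (forall t, P1 t -> P t) -> {ae @lebesgue_measure R, forall t, P1 t} ->
  {ae @lebesgue_measure R, forall t, P t}.
Proof.
exact: (@filterS (measurableTypeR R) (almost_everywhere (@lebesgue_measure R)) _ P1 P).
Qed.

Lemma ip_suml d (T : measurableType d) (R : realType) (mu : {measure set T -> \bar R})
  (D : set T) (I : Type) (r : seq I) (F : I -> T -> R) (h : T -> R) : measurable D ->
  (forall i, inL2 mu D (F i)) -> inL2 mu D h ->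
  ip mu D (fun x => \sum_(i <- r) F i x) h = \sum_(i <- r) ip mu D (F i) h.
Proof.
move=> mD FL hL; elim: r => [|i r IH].
  by rewrite big_nil -[RHS](ip_0l mu D h); congr ip; apply/funext => x; rewrite big_nil.
rewrite big_cons -IH -[X in _ = X + _]mul1r -ip_lin//; last exact: inL2_sum.
by congr ip; apply/funext => x; rewrite big_cons mul1r.
Qed.

Lemma inL2v_0 d (T : measurableType d) (R : realType) (mu : {measure set T -> \bar R})
  n (D : set T) : inL2v mu D (fun=> 0 : 'rV[R]_n).
Proof. by move=> i; under eq_fun do rewrite mxE; exact: inL2_0. Qed.

Lemma inL2v_dotv_integrable d (T : measurableType d) (R : realType)
  (mu : {measure set T -> \bar R}) n (D : set T) (f g : T -> 'rV[R]_n) : measurable D ->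
  inL2v mu D f -> inL2v mu D g -> mu.-integrable D (fun x => (dotv (f x) (g x))%:E).
Proof.
move=> mD fL gL.
rewrite (_ : (fun _ => _) = (fun x => \sum_i (f x ord0 i * g x ord0 i)%:E)%E); last first.
  by apply/funext => x; rewrite sumEFin.
by apply: integrable_sum => // i _; exact: inL2_mul_integrable.
Qed.

Lemma is_wdiv0 (R : realType) (d : nat) (D : set (R * 'rV[R]_d)) :
  is_wdiv D (0 : fld R d) (fun=> 0).
Proof.
split=> [|phi _]; first exact: inL2_0.
by rewrite [ip _ _ _ _]ip_0l [ipv _ _ _ _]ipv_0l ip_0l addr0 oppr0.
Qed.

(** * The discrete trial space inside X *)

Section trial_space.
Context (R : realType) (d : nat) (Omega : set 'rV[R]_d) (Tend : R) (N : nat).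
Context (K : 'I_N -> cell R d) (kappa : R).
Context (gamma0 : fld R d -> 'rV[R]_d -> R).
Hypotheses (hd : (0 < d)%N) (hOmega : polyhedral_lipschitz_domain Omega).
Hypothesis hTend : 0 < Tend.
Hypothesis hK : space_time_partition Omega Tend K kappa.
Hypothesis hgamma0 : is_gamma0 Omega Tend gamma0.
Notation pt := (R * 'rV[R]_d)%type.
Notation ptM := (measurableTypeR R * 'rV[R]_d)%type.
Notation mu := (mu_tx R d).
Notation mux := (mu_x R d).
Notation fld := (fld R d).
Notation ysp := (ysp R d).
Notation xsp := (xsp R d).
Notation Q := (Qdom Omega Tend).

Let oO : open Omega := open_Omega hOmega.
Let mO : measurable Omega := open_measurable_rv oO.
Let oQ : open Q := open_Q hOmega.
Let mQ : measurable (Q : set ptM) := open_measurable_pt oQ.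
Let Ooo := mu_x_Omega_lty hOmega.
Let Qoo : (mu Q < +oo)%E := mu_Q_lty oO Ooo hTend.
Notation gA := (gammaA Omega Tend K gamma0).
Notation SY := (space_Y Omega Tend K).
Notation U0 := (space_U0 Omega Tend).

Let mI : measurable (`]0, Tend[%classic : set (measurableTypeR R)) := measurable_itv _.

(** Holds on almost every time slice by [H10_by_parts], then by Fubini. Compactly supported [p] give
    the weak gradient, general [p] the condition of U_0. *)
Lemma L2_H10_by_parts v g (p : pt -> R) i : inL2 mu Q v -> inL2v mu Q g ->
  {ae (@lebesgue_measure R), forall t : R, 0 < t < Tend ->
      H10_with_grad Omega (fun x => v (t, x)) (fun x => g (t, x))} -> smooth p ->
  ip mu Q v (fun z => 'D_((0, e_x R i) : pt) p z) = - ip mu Q (fun z => g z ord0 i) p.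
Proof.
move=> vL gL H sp; have [M HM] := Omega_bounded hOmega.
have [M' HM'] := Q_bounded hOmega hTend.
have pL : inL2 mu Q p by exact: smooth_inL2 HM'.
have npL : inL2 mu Q (fun z => - p z) by exact: inL2_N.
have dpL : inL2 mu Q (fun z => 'D_((0, e_x R i) : pt) p z).
  by apply: (smooth_inL2 (M := M')) => //; exact: smooth_derive.
rewrite -(ip_Nr mQ (gL i) pL); apply: (cylinder_integral_eq mI mO).
- exact: (inL2_mul_integrable mQ vL dpL).
- exact: (inL2_mul_integrable mQ (gL i) npL).
- apply: filterS_line H => t H; rewrite /= in_itv/= => /H Ht.
  have ss := smooth_slice t sp.
  have sL : inL2 mux Omega (fun x => p (t, x)).
    by apply: (continuous_inL2_rv (M := M)) => //; exact: smooth_continuous.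
  have [_ gtL _] := Ht.
  have := H10_by_parts mO i HM ss Ht; rewrite -(ip_Nr mO (gtL i) sL).
  have -> // : (fun x : 'rV[R]_d => 'D_(e_x R i) (fun y : 'rV[R]_d => p (t, y)) x : R) =
      (fun x => 'D_((0, e_x R i) : pt) p (t, x)).
  by apply/funext => x; exact: derive_slice.
Qed.

Lemma L2_H10_is_wgrad v g : inL2 mu Q v -> inL2v mu Q g ->
  {ae (@lebesgue_measure R), forall t : R, 0 < t < Tend ->
      H10_with_grad Omega (fun x => v (t, x)) (fun x => g (t, x))} -> is_wgrad Q v g.
Proof.
move=> vL gL H; split => // i phi [sp _ _]; rewrite -(L2_H10_by_parts i vL gL H sp).
by congr ip; apply/funext => z; rewrite mxE.
Qed.

Lemma space_Vh_U0 v : space_Vh Omega Tend K v -> U0 ((v, fun=> 0) : fld).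
Proof.
move=> [_ [[vL [g gL Hg]] [_ wg wd]]].
split; first by split => //; split => //; exact: inL2v_0.
move=> chi schi; have [M HM] := Q_bounded hOmega hTend.
have cL : inL2v mu Q chi by move=> i; exact: smooth_inL2 HM.
have dL i : inL2 mu Q (fun z => 'D_((0, e_x R i) : pt) (fun y => chi y ord0 i) z).
  by apply: (smooth_inL2 (M := M)) => //; exact: smooth_derive.
have W := L2_H10_is_wgrad vL gL Hg; have W' := wgradP wg.
rewrite /= (ipv_ae mQ W'.1 gL cL cL (is_wgrad_unique oQ W' W) (ae_eq_refl _ _ _)).
rewrite ipv_sumE// ip_sym ip_suml// -sumrN; apply: eq_bigr => i _.
rewrite -[LHS]opprK -(L2_H10_by_parts i vL gL Hg (schi i)); congr (- _); exact: ip_sym.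
Qed.

Lemma is_divx_is_wdiv tau h : is_divx Omega Tend tau h -> is_wdiv Q ((fun=> 0, tau) : fld) h.
Proof.
move=> [tL hL H]; split => // phi tphi; have [sp _ _] := tphi.
rewrite /= ip_0l add0r; have [M HM] := Q_bounded hOmega hTend.
have pL : inL2 mu Q phi by exact: smooth_inL2 HM.
have gL : inL2v mu Q (grad_x phi).
  by move=> i; apply: (smooth_inL2 (M := M)) => //; exact: smooth_grad.
rewrite -(ip_Nr mQ hL pL); apply: (cylinder_integral_eq mI mO).
- exact: (inL2v_dotv_integrable mQ tL gL).
- exact: (inL2_mul_integrable mQ hL (inL2_N pL)).
- apply: filterS_line H => t H; rewrite /= in_itv/= => /H[_ htL Ht].
  have tp : test_fun Omega (fun x => phi (t, x)) by exact: test_fun_slice tphi.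
  have E := Ht _ tp; rewrite -(ip_Nr mO htL (test_inL2_rv mO tp)) in E; apply: etrans E.
  rewrite /ipv; congr Rintegral; apply/funext => x; congr dotv.
  by apply/rowP => i; rewrite !mxE derive_slice.
Qed.

Lemma space_Wh_U0 tau : space_Wh Omega Tend K tau -> U0 ((fun=> 0, tau) : fld).
Proof.
move=> [h Dh _]; have [tL hL _] := Dh.
have w0 := is_wgrad0 Q.
split.
  split; [by split => //; exact: inL2_0|by exists (fun=> 0)|].
  by exists h; exact: is_divx_is_wdiv.
move=> chi schi; have [M HM] := Q_bounded hOmega hTend.
have cL : inL2v mu Q chi by move=> i; exact: smooth_inL2 HM.
have W' := wgradP (ex_intro _ _ w0).
rewrite /= (ipv_ae mQ W'.1 w0.1 cL cL (is_wgrad_unique oQ W' w0) (ae_eq_refl _ _ _)).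
by rewrite ip_0l ipv_0l oppr0.
Qed.

Lemma pair0_lin a (v v' : pt -> R) :
  ((fun z => a * v z + v' z, fun=> 0) : fld) = a *: ((v, fun=> 0) : fld) + ((v', fun=> 0) : fld).
Proof.
by congr pair; apply/funext => z; change (0 = a *: 0 + 0 :> 'rV[R]_d); rewrite scaler0 addr0.
Qed.

Lemma pair0_lin2 a (t t' : pt -> 'rV[R]_d) :
  ((fun=> 0, fun z => a *: t z + t' z) : fld) = a *: ((fun=> 0, t) : fld) + ((fun=> 0, t') : fld).
Proof.
by congr pair; apply/funext => z; change (0 = a * 0 + 0 :> R); rewrite mulr0 addr0.
Qed.

Lemma space_Vh_lin a v v' : space_Vh Omega Tend K v -> space_Vh Omega Tend K v' ->
  space_Vh Omega Tend K (fun z => a * v z + v' z).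
Proof.
move=> [Bv [[vL [g gL Hg]] [_ [wg Wg] [wh Wh]]]] [Bv' [[vL' [g' gL' Hg']] [_ [wg' Wg'] [wh' Wh']]]].
split; first exact: broken_T_lin.
split.
- split; first exact: inL2_lin.
  exists (fun z => a *: g z + g' z); first exact: inL2v_lin.
  by apply: filterS2_line Hg Hg' => t H H' It; apply: H10_lin => //; [exact: H|exact: H'].
- split; first exact: inL2_lin.
  + by exists (fun z => a *: wg z + wg' z); exact: is_wgrad_lin.
  + exists (fun z => a * wh z + wh' z); rewrite pair0_lin.
    by apply: is_wdiv_lin => //; split => //; exact: inL2v_0.
Qed.

Lemma test_fun0 (D : set 'rV[R]_d) : test_fun D (fun=> 0).
Proof.
have E : csupp (fun _ : 'rV[R]_d => (0 : R)) = set0.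
  rewrite /csupp (_ : [set x | _] = set0) ?closure0//.
  by apply/seteqP; split => // x /=; rewrite eqxx.
by split; [exact: smooth_cst|rewrite E; exact: compact0|rewrite E].
Qed.

Lemma H10_0 : H10_with_grad Omega (fun=> 0) (fun=> 0).
Proof.
split; [exact: inL2_0|exact: inL2v_0|exists (fun _ => fun=> 0); split].
- by move=> n; exact: test_fun0.
- rewrite /norm2; under eq_fun do rewrite subr0 ip_0l sqrtr0.
  exact: cvg_cst.
- rewrite /norm2v (_ : (fun x => grad _ x - 0) = (fun=> 0)).
    by under eq_fun do rewrite ipv_0l sqrtr0; exact: cvg_cst.
  by apply/funext => x; rewrite subr0; apply/rowP => i; rewrite !mxE derive_cst.
Qed.

Lemma space_Vh0 : space_Vh Omega Tend K (fun=> 0).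
Proof.
split; first exact: broken_T0.
split.
- split; first exact: inL2_0.
  exists (fun=> 0); first exact: inL2v_0.
  by apply: aeW => t _; exact: H10_0.
- split; [exact: inL2_0|by exists (fun=> 0); exact: is_wgrad0|].
  by exists (fun=> 0); exact: is_wdiv0.
Qed.

Lemma gammaA0 y : SY y -> gA (0 : fld) y = 0.
Proof.
move=> Yy; have H0 := U0_0 hOmega hTend.
have := gammaA_lin hOmega hTend hgamma0 (-1) H0 H0 Yy.
by rewrite scaler0 addr0 mulN1r addNr.
Qed.

Lemma Gamma_h0 : Gamma_h Omega Tend K gamma0 (fun=> 0).
Proof.
exists (fun=> 0), (fun=> 0); split; [exact: space_Vh0|exact: space_Wh0|] => y Yy.
by rewrite [X in _ = X + _](gammaA0 Yy) [X in _ = _ + X](gammaA0 Yy) addr0.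
Qed.

Lemma space_Xh_X : space_Xh Omega Tend K gamma0 `<=` space_X Omega Tend K gamma0.
Proof.
move=> x [Bv Bt [v [tau [Vv Wt xE]]]]; split.
  by split; [exact: Bv.1|move=> i; exact: (Bt i).1].
have [Uv Ut] := (space_Vh_U0 Vv, space_Wh_U0 Wt).
exists (1 *: (v, fun=> 0) + (fun=> 0, tau)); first exact: U0_lin.
move=> y Yy; rewrite xE//.
by rewrite (gammaA_lin hOmega hTend hgamma0 1 Uv Ut Yy) mul1r.
Qed.

Lemma space_Xh_linear : linear_subspace (V := xsp) (space_Xh Omega Tend K gamma0).
Proof.
split=> [|a x x' [Bv Bt [v [tau [Vv Wt xE]]]] [Bv' Bt' [v' [tau' [Vv' Wt' xE']]]]].
- by split; [exact: broken_T0|exact: broken_Tv0|exact: Gamma_h0].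
- split; [exact: broken_T_lin|exact: broken_Tv_lin|].
  exists (fun z => a * v z + v' z), (fun z => a *: tau z + tau' z).
  split; [exact: space_Vh_lin|exact: (space_Wh_lin hd hOmega hTend hK)|] => y Yy.
  change (a * x.2 y + x'.2 y = gA (fun z => a * v z + v' z, fun=> 0) y +
    gA (fun=> 0, fun z => a *: tau z + tau' z) y).
  rewrite pair0_lin pair0_lin2 xE// xE'//.
  rewrite (gammaA_lin hOmega hTend hgamma0 a (space_Vh_U0 Vv) (space_Vh_U0 Vv') Yy).
  rewrite (gammaA_lin hOmega hTend hgamma0 a (space_Wh_U0 Wt) (space_Wh_U0 Wt') Yy).
  ring.
Qed.

(** A trial vector of positive length, as required for the lower bound 1 on the norm of the Fortin
    operator. *)
Definition unit_trial : xsp := ((fun=> 1, fun=> 0), fun=> 0).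

Lemma unit_trial_Xh : space_Xh Omega Tend K gamma0 unit_trial.
Proof.
split; [|exact: broken_Tv0|exact: Gamma_h0].
split.
  apply: (inL2_bounded (C := 1)) => //; first exact: measurable_cst.
  by move=> z _; rewrite normr1.
by move=> i; exists (fun=> 1); [exact: tensor_poly_cst|exact: aeW].
Qed.

Lemma unit_trial_gt0 : 0 < ipf Q unit_trial.1 unit_trial.1.
Proof.
rewrite /ipf /= ipv_0l addr0 /ip mulr1.
have [x Ox] : Omega !=set0 by have [[]] := hOmega.
have Qz : Q (Tend / 2, x).
  by split => //=; rewrite in_itv/= divr_gt0//= gtr_pMr// invf_lt1// ltr1n.
have [i [zi iQ]] := open_rat_box oQ Qz.
have [r [rE _ rp]] := mu_tx_obox (fun k : 'I_d.+1 => ratr (i.1 ord0 k) - i.2.+1%:R^-1 : R)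
  (fun k => ratr (i.1 ord0 k) + i.2.+1%:R^-1).
have r0 : 0 < r.
  apply: rp => k; have : 0 < i.2.+1%:R^-1 :> R by rewrite invr_gt0.
  by move: (i.2.+1%:R^-1) => e e0; lra.
rewrite Rintegral_cst// mul1r fine_gt0//; apply/andP; split => //.
apply: (@lt_le_trans _ _ r%:E); first by rewrite lte_fin.
rewrite -rE; apply: le_measure; rewrite ?inE//; first exact: measurable_obox.
by apply: subset_trans iQ; exact: obox_cbox.
Qed.

End trial_space.

(** * The discrete test space and its coefficients *)

Section test_space.
Context (R : realType) (d : nat) (Omega : set 'rV[R]_d) (Tend : R) (N : nat).
Context (K : 'I_N -> cell R d) (kappa : R).
Context (gamma0 : fld R d -> 'rV[R]_d -> R).
Hypotheses (hd : (0 < d)%N) (hOmega : polyhedral_lipschitz_domain Omega).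
Hypothesis hTend : 0 < Tend.
Hypothesis hK : space_time_partition Omega Tend K kappa.
Hypothesis hgamma0 : is_gamma0 Omega Tend gamma0.
Notation pt := (R * 'rV[R]_d)%type.
Notation ptM := (measurableTypeR R * 'rV[R]_d)%type.
Notation mu := (mu_tx R d).
Notation mux := (mu_x R d).
Notation fld := (fld R d).
Notation ysp := (ysp R d).
Notation xsp := (xsp R d).
Notation Q := (Qdom Omega Tend).

Let oO : open Omega := open_Omega hOmega.
Let mO : measurable Omega := open_measurable_rv oO.
Let oQ : open Q := open_Q hOmega.
Let mQ : measurable (Q : set ptM) := open_measurable_pt oQ.
Let Ooo := mu_x_Omega_lty hOmega.
Let Qoo : (mu Q < +oo)%E := mu_Q_lty oO Ooo hTend.
Notation SY := (space_Y Omega Tend K).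
Notation SYh := (space_Yh Omega Tend K).
Let oK i : open (Kint K i). Proof. exact: open_Kint. Qed.
Arguments oK : clear implicits.
Let mK i : measurable (Kint K i : set ptM) := open_measurable_pt (oK i).
Let KQ i : Kint K i `<=` Q. Proof. by move=> z; exact: (Kint_subset_Q hOmega hK). Qed.
Arguments KQ : clear implicits.

Lemma broken_T_Kint k v i : broken_T Omega Tend K k v ->
  exists2 p, is_tensor_poly k p & ae_eq mu (Kint K i) v p.
Proof.
move=> [_ /(_ i)[p pP vp]]; exists p => //; apply: (filterS2_pt _ vp vp).
move=> z H _ zi; exact: (H (Kint_cell zi)).
Qed.

(** On each cell interior a discrete field agrees almost everywhere with a polynomial one, which is
    smooth on a bounded set and so has weak derivatives in L^2. *)
Lemma space_Yh_Y : SYh `<=` SY.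
Proof.
move=> y [y1 y2 [y3 _]]; split => //.
have yL : inL2f Q y.1 by split; [exact: y1.1|move=> j; exact: (y2 j).1].
split => // i.
have [p /is_tensor_polyP[c pE] yp] := broken_T_Kint i y1.
have /choice[q qP] : forall j, exists q, is_tensor_poly 1 q /\
    ae_eq mu (Kint K i) (fun z => y.1.2 z ord0 j) q.
  by move=> j; have [q qP yq] := broken_T_Kint i (y2 j); exists q.
pose u : fld := (p, fun z => \row_j q j z).
have su : smooth_fld u.
  split=> [|j] /=; first by rewrite pE; exact: smooth_tensor_poly_of.
  have [/is_tensor_polyP[c' qE] _] := qP j.
  rewrite (_ : (fun z => _) = q j) ?qE; first exact: smooth_tensor_poly_of.
  by apply/funext => z; rewrite mxE qE.
have [M HM] := cell_bounded hOmega hTend hK.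
have KM : Kint K i `<=` cbox (fun=> - M) (fun=> M).
  by apply: subset_trans (HM i); exact: Kint_cell.
apply: (H_A_ae (oK i) (u := u)).
- exact: (inL2f_subset mQ (mK i) (KQ i) yL).
- split; first by apply: ae_eq_sym.
  apply/ae_eq_coord => j; apply: ae_eq_sym; have [_ H] := qP j.
  by under [X in ae_eq _ _ _ X]eq_fun do rewrite mxE.
- exact: (smooth_H_A (oK i) KM).
Qed.

(** A field that is null on Q has weak derivatives 0 on every cell, so its cell-wise adjoint is null
    as well. *)
Lemma ipY_ae0 y : SY y -> aef Q y.1 0 -> ae_eq mux Omega y.2 (fun=> 0) ->
  ipY Omega Tend K y y = 0.
Proof.
move=> Yy y1 y2; have [[yL HA] y2L] := Yy; have sQ := ipf_semi_ip mQ.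
have AL := opAadj_h_inL2 hOmega Yy.1.
have z0 : inL2f Q (0 : fld) by exact: inL2f_0.
have A0 : aef Q (opAadj_h K y.1) 0.
  apply: (aef_glue hd hK) => i; apply: (aef_trans (opAadj_h_ae hK _ i)).
  have yi : aef (Kint K i) y.1 0.
    by split; [move: y1.1|move: y1.2]; apply: filterS => z H /(KQ i)/H.
  have yLi := inL2f_subset mQ (mK i) (KQ i) yL.
  have z0i : inL2f (Kint K i) (0 : fld) by exact: inL2f_0.
  have wg : is_wgrad (Kint K i) y.1.1 (fun=> 0).
    apply: (is_wgrad_ae (oK i) _ _ _ _ (ae_eq_refl _ _ _) (is_wgrad0 (Kint K i))) => //.
    - exact: (inL2_0 mu (Kint K i)).
    - exact: yLi.1.
    - exact: inL2v_0.
    - by apply: ae_eq_sym; exact: yi.1.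
  have wd : is_wdiv (Kint K i) y.1 (fun=> 0).
    apply: (is_wdiv_ae (oK i) _ _ _ _ (ae_eq_refl _ _ _) (is_wdiv0 (Kint K i))) => //.
    - exact: inL2_0.
    - by apply: aef_sym.
  apply: (aef_trans (opAadj_E (oK i) yLi wg wd)); split.
  - by apply: aeW => z _ /=; rewrite oppr0.
  - by move: yi.2; apply: filterS => z H /H /= ->; rewrite oppr0 addr0.
rewrite /ipY (ipf_ae mQ yL z0 yL z0 y1 y1) (ipf_ae mQ AL z0 AL z0 A0 A0) (sip_0l sQ z0).
have m0 : measurable_fun Omega (fun _ : 'rV[R]_d => 0 : R) by exact: measurable_cst.
have my := inL2_measurable mO y2L.
by rewrite (ip_ae mO my m0 my m0 y2 y2) ip_0l !addr0.
Qed.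

Notation exps k := ({ffun 'I_d -> 'I_k.+1}).

(** Slots per cell: the scalar component, the vector component and the initial component.
    [has_coefs] constrains the last kind on cells starting at time 0. *)
Definition coef_index : finType :=
  ('I_N * (('I_(mdeg d).+1 * exps (mdeg d)) + 'I_d * ('I_2 * exps 1) + exps 1))%type.
Definition coef_dim : nat := #|{: coef_index}|.
Definition coef_at (c : 'rV[R]_coef_dim) (j : coef_index) : R := c ord0 (enum_rank j).

Definition has_coefs (y : ysp) (c : 'rV[R]_coef_dim) : Prop := forall i,
  [/\ {ae mu, forall z : ptM, Kint K i z ->
        y.1.1 z = tensor_poly_of (fun j e => coef_at c (i, inl (inl (j, e)))) z},
    forall l, {ae mu, forall z : ptM, Kint K i z ->
        y.1.2 z ord0 l = tensor_poly_of (fun j e => coef_at c (i, inl (inr (l, (j, e))))) z} &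
    t_lo (K i) = 0 -> {ae mux, forall x, cell_x (K i) x ->
        y.2 x = poly_of (fun e => coef_at c (i, inr e)) x}].

Lemma has_coefs_ex y : SYh y -> exists c, has_coefs y c.
Proof.
move=> [y1 y2 y3].
have /choice[c1 c1P] : forall i, exists c, ae_eq mu (Kint K i) y.1.1 (@tensor_poly_of R d (mdeg d) c).
  by move=> i; have [p /is_tensor_polyP[c ->] H] := broken_T_Kint i y1; exists c.
have /choice[c2 c2P] : forall il : 'I_N * 'I_d, exists c,
    ae_eq mu (Kint K il.1) (fun z => y.1.2 z ord0 il.2) (@tensor_poly_of R d 1 c).
  by move=> il; have [p /is_tensor_polyP[c ->] H] := broken_T_Kint il.1 (y2 il.2); exists c.
have /choice[c3 c3P] : forall i, exists c, t_lo (K i) = 0 ->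
    {ae mux, forall x, cell_x (K i) x -> y.2 x = @poly_of R d 1 c x}.
  move=> i; have [i0|i0] := pselect (t_lo (K i) = 0); last by exists (fun=> 0).
  by have [p /is_polyP[c ->] H] := y3.2 i i0; exists c.
pose r (j : coef_index) : R := match j with
  | (i, inl (inl (j, e))) => c1 i j e
  | (i, inl (inr (l, (j, e)))) => c2 (i, l) j e
  | (i, inr e) => c3 i e end.
exists (\row_k r (enum_val k)) => i.
have E j : coef_at (\row_k r (enum_val k)) j = r j by rewrite /coef_at mxE enum_rankK.
split.
- have := c1P i; congr (almost_everywhere _ _); apply/funext => z; congr (_ -> _ = _).
  by congr tensor_poly_of; apply/funext => j; apply/funext => e; rewrite E.
- move=> l; have := c2P (i, l); congr (almost_everywhere _ _); apply/funext => z; congr (_ -> _ = _).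
  by congr tensor_poly_of; apply/funext => j; apply/funext => e; rewrite E.
- move=> i0; have := c3P i i0; congr (almost_everywhere _ _); apply/funext => z; congr (_ -> _ = _).
  by congr poly_of; apply/funext => e; rewrite E.
Qed.

Lemma fld_sum1 (I : finType) (a : I -> R) (y : I -> ysp) z :
  (\sum_i a i *: y i).1.1 z = \sum_i a i * (y i).1.1 z.
Proof.
by elim/big_rec2: _ => // i u v _ <-.
Qed.

Lemma fld_sum2 (I : finType) (a : I -> R) (y : I -> ysp) z l :
  (\sum_i a i *: y i).1.2 z ord0 l = \sum_i a i * (y i).1.2 z ord0 l.
Proof.
elim/big_rec2: _ => [|i u v _ <-]; first by rewrite mxE.
change ((a i *: (y i).1.2 z + v.1.2 z) ord0 l = a i * (y i).1.2 z ord0 l + v.1.2 z ord0 l).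
by rewrite !mxE.
Qed.

Lemma fld_sum3 (I : finType) (a : I -> R) (y : I -> ysp) x :
  (\sum_i a i *: y i).2 x = \sum_i a i * (y i).2 x.
Proof. by elim/big_rec2: _ => // i u v _ <-. Qed.

(** Evaluation is linear in the coefficients, so the combination vanishes almost everywhere on each
    cell and on each initial simplex; these cover Q and Omega up to null sets. *)
Lemma has_coefs_null (I : finType) (a : I -> R) (y : I -> ysp) (c : I -> 'rV[R]_coef_dim) :
  (forall i, SYh (y i)) -> (forall i, has_coefs (y i) (c i)) ->
  \sum_i a i *: c i = 0 ->
  ipY Omega Tend K (\sum_i a i *: y i) (\sum_i a i *: y i) = 0.
Proof.
move=> Yy yc ac0.
have c0 j : \sum_i a i * coef_at (c i) j = 0.
  have := congr1 (fun r : 'rV[R]_coef_dim => r ord0 (enum_rank j)) ac0.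
  rewrite summxE mxE => H; apply: etrans H.
  by apply: eq_bigr => i _; rewrite mxE.
have YS : SY (\sum_i a i *: y i).
  apply: (subspace_sum _ a (space_Y_linear hOmega hTend hK)) => i; exact: space_Yh_Y.
apply: ipY_ae0 => //.
- split.
  + apply: (ae_glue hd hK) => k.
    have : {ae mu, forall z : ptM, forall i, Kint K k z -> (y i).1.1 z =
        tensor_poly_of (fun j e => coef_at (c i) (k, inl (inl (j, e)))) z}.
      by apply: filter_forall => i; have [] := yc i k.
    apply: filterS => z H zk; rewrite fld_sum1.
    under eq_bigr do rewrite H//.
    rewrite -tensor_poly_of_suml; by apply: tensor_poly_of_eq0 => j e; exact: c0.
  + apply/ae_eq_coord => l; apply: (ae_glue hd hK) => k.
    have : {ae mu, forall z : ptM, forall i, Kint K k z -> (y i).1.2 z ord0 l =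
        tensor_poly_of (fun j e => coef_at (c i) (k, inl (inr (l, (j, e))))) z}.
      by apply: filter_forall => i; have [] := yc i k.
    apply: filterS => z H zk; rewrite fld_sum2 mxE.
    under eq_bigr do rewrite H//.
    rewrite -tensor_poly_of_suml; by apply: tensor_poly_of_eq0 => j e; exact: c0.
- have : {ae mux, forall x, forall k, t_lo (K k) = 0 -> cell_x (K k) x ->
      (\sum_i a i *: y i).2 x = 0}.
    apply: filter_forall => k.
    have [k0|k0] := pselect (t_lo (K k) = 0); last by apply: aeW => x /k0.
    have : {ae mux, forall x, forall i, cell_x (K k) x -> (y i).2 x =
        poly_of (fun e => coef_at (c i) (k, inr e)) x}.
      by apply: filter_forall => i; have [_ _] := yc i k; exact.
    apply: filterS => x H _ xk; rewrite fld_sum3; under eq_bigr do rewrite H//.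
    rewrite -poly_of_suml; by apply: poly_of_eq0 => e; exact: c0.
  apply: filterS => x H Ox.
  have : closure Omega x by exact: subset_closure.
  by rewrite (mesh_initial_cover hK) => -[k k0 xk]; exact: (H k).
Qed.

End test_space.

Lemma sip_add_null (R : realType) (V : lmodType R) (S : set V) (s : V -> V -> R) u v :
  semi_ip S s -> S u -> S v -> s v v = 0 -> s (u + v) (u + v) = s u u.
Proof.
move=> hs Su Sv v0; have := sip_sqrD hs 1 1 Su Sv; rewrite !scale1r => ->.
by rewrite v0 (sip_sym hs Su Sv) (sip_null hs Sv Su v0); ring.
Qed.

(** * The operator norm of the Fortin operator *)

Section fortin_norm.
Context (R : realType) (d : nat) (Omega : set 'rV[R]_d) (Tend : R) (N : nat).
Context (K : 'I_N -> cell R d) (kappa : R).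
Context (gamma0 : fld R d -> 'rV[R]_d -> R).
Hypotheses (hd : (0 < d)%N) (hOmega : polyhedral_lipschitz_domain Omega).
Hypothesis hTend : 0 < Tend.
Hypothesis hK : space_time_partition Omega Tend K kappa.
Hypothesis hgamma0 : is_gamma0 Omega Tend gamma0.
Notation pt := (R * 'rV[R]_d)%type.
Notation ptM := (measurableTypeR R * 'rV[R]_d)%type.
Notation mu := (mu_tx R d).
Notation mux := (mu_x R d).
Notation fld := (fld R d).
Notation ysp := (ysp R d).
Notation xsp := (xsp R d).
Notation Q := (Qdom Omega Tend).

Let oO : open Omega := open_Omega hOmega.
Let mO : measurable Omega := open_measurable_rv oO.
Let oQ : open Q := open_Q hOmega.
Let mQ : measurable (Q : set ptM) := open_measurable_pt oQ.
Let Ooo := mu_x_Omega_lty hOmega.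
Let Qoo : (mu Q < +oo)%E := mu_Q_lty oO Ooo hTend.
Context (P : ysp -> ysp).
Hypothesis hP : fortin_operator Omega Tend K gamma0 P.
Notation SY := (space_Y Omega Tend K).
Notation nY := (normY Omega Tend K).
Notation iY := (ipY Omega Tend K).
Notation p := (operator_norm Omega Tend K P).

Let hY := ipY_semi_ip hd hOmega hTend hK.
Let sY := space_Y_linear hOmega hTend hK.

Lemma fortin_Y y : SY y -> SY (P y).
Proof. by case: hP => H _ _ _ /H; exact: (space_Yh_Y hOmega hTend hK). Qed.

Lemma fortin_null y : SY y -> iY y y = 0 -> iY (P y) (P y) = 0.
Proof.
move=> Yy y0; have [_ _ [C HC] _] := hP; have := HC _ Yy.
rewrite /normY y0 sqrtr0 mulr0 => H.
have i0 := sip_ge0 hY (fortin_Y Yy).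
have n0 : Num.sqrt (iY (P y) (P y)) = 0 by apply/eqP; rewrite eq_le H sqrtr_ge0.
by rewrite -[LHS](sqr_sqrtr i0) n0 expr0n.
Qed.

(** [P] is linear up to null vectors, and [P 0] is null by boundedness; adding null vectors does not
    change lengths. *)
Lemma fortin_scale a y : SY y -> iY (P (a *: y)) (P (a *: y)) = a ^+ 2 * iY (P y) (P y).
Proof.
move=> Yy; have [_ Plin _ _] := hP; have Y0 := sY.1.
have := Plin a y 0 Yy Y0; rewrite addr0; set z := _ - _ => z0.
have Yay : SY (a *: y) by exact: subspaceZ.
have [Y1 Y2 Y3] := And3 (fortin_Y Yay) (fortin_Y Yy) (fortin_Y Y0).
have Y4 : SY (a *: P y) by exact: subspaceZ.
have Y5 : SY (a *: P y + P 0) by exact: sY.2.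
have Yz : SY z by exact: subspaceB.
have iz : iY z z = 0.
  have : nY z ^+ 2 = 0 by rewrite z0 expr0n.
  by rewrite sqr_sqrtr// (sip_ge0 hY Yz).
have i0 : iY (P 0) (P 0) = 0 by apply: fortin_null => //; exact: (sip_0l hY).
rewrite -[P (a *: y)](subrK (a *: P y + P 0)) -/z [z + _]addrC.
rewrite (sip_add_null hY Y5 Yz iz) (sip_add_null hY Y4 Y3 i0).
by rewrite (sip_Zl hY a Y2 Y4) (sip_Zr hY a Y2 Y2) mulrA -expr2.
Qed.

Let A := [set nY (P y) | y in [set y | SY y /\ nY y <= 1]].

Let A_ub : has_ubound A.
Proof.
have [_ _ [C HC] _] := hP; exists `|C| => _ [y [Yy y1] <-].
apply: (le_trans (HC _ Yy)); apply: (le_trans (ler_norm _)); rewrite normrM.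
by rewrite ler_piMr// ger0_norm// sqrtr_ge0.
Qed.

Lemma operator_norm_ge0 : 0 <= p.
Proof.
apply: (@le_trans _ _ (nY (P 0))); first exact: sqrtr_ge0.
apply: ub_le_sup => //; exists 0 => //; split; first exact: sY.1.
by rewrite /normY (sip_0l hY sY.1) sqrtr0.
Qed.

Lemma operator_norm_le y : SY y -> iY (P y) (P y) <= p ^+ 2 * iY y y.
Proof.
move=> Yy; have y0 := sip_ge0 hY Yy.
have [yz|yz] := eqVneq (iY y y) 0; first by rewrite fortin_null// yz mulr0.
have yp : 0 < iY y y by rewrite lt_neqAle eq_sym yz.
have np : 0 < nY y by rewrite sqrtr_gt0.
have n2 : nY y ^+ 2 = iY y y by rewrite sqr_sqrtr.
have Yz : SY ((nY y)^-1 *: y) by exact: subspaceZ.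
have nz : nY ((nY y)^-1 *: y) <= 1.
  by rewrite /normY (sip_Zl hY _ Yy Yz) (sip_Zr hY _ Yy Yy) mulrA -expr2 exprVn n2 mulVf// sqrtr1.
have : nY (P ((nY y)^-1 *: y)) <= p by apply: ub_le_sup => //; exists ((nY y)^-1 *: y).
rewrite -(@ler_pXn2r _ 2) ?nnegrE ?sqrtr_ge0 ?operator_norm_ge0//.
rewrite sqr_sqrtr; last exact: (sip_ge0 hY (fortin_Y Yz)).
by rewrite fortin_scale// exprVn n2 mulrC ler_pdivrMr.
Qed.

End fortin_norm.

(** * Equivalence of the energy norm and the X-norm, and the final estimate *)

Section energy_norm_equivalence.
Context (R : realType) (d : nat) (Omega : set 'rV[R]_d) (Tend : R) (N : nat).
Context (K : 'I_N -> cell R d) (kappa : R).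
Context (gamma0 : fld R d -> 'rV[R]_d -> R).
Hypotheses (hd : (0 < d)%N) (hOmega : polyhedral_lipschitz_domain Omega).
Hypothesis hTend : 0 < Tend.
Hypothesis hK : space_time_partition Omega Tend K kappa.
Hypothesis hgamma0 : is_gamma0 Omega Tend gamma0.
Notation pt := (R * 'rV[R]_d)%type.
Notation ptM := (measurableTypeR R * 'rV[R]_d)%type.
Notation mu := (mu_tx R d).
Notation mux := (mu_x R d).
Notation fld := (fld R d).
Notation ysp := (ysp R d).
Notation xsp := (xsp R d).
Notation Q := (Qdom Omega Tend).

Let oO : open Omega := open_Omega hOmega.
Let mO : measurable Omega := open_measurable_rv oO.
Let oQ : open Q := open_Q hOmega.
Let mQ : measurable (Q : set ptM) := open_measurable_pt oQ.
Let Ooo := mu_x_Omega_lty hOmega.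
Let Qoo : (mu Q < +oo)%E := mu_Q_lty oO Ooo hTend.
Context (T : xsp -> ysp) (cL : R).
Hypothesis hT : trial_to_test Omega Tend K gamma0 T.
Hypothesis hcL : stability_constant Omega Tend gamma0 cL.
Notation SX := (space_X Omega Tend K gamma0).
Notation iY := (ipY Omega Tend K).
Notation iX := (sX Omega Tend K T).
Notation s := (Num.sqrt (1 + cL)).

(** [graph_norm_equiv] with [v] the field component of x, [e] its image under E, and [a] the sum of
    the squared norms of A e and gamma0 e, which are the components of [T x]. The stability constant
    provides the hypothesis on [a]. *)
Lemma energy_norm_equiv x : SX x ->
  (1 - s^-1) * iX x x <= iY (T x) (T x) /\ iY (T x) (T x) <= (1 + s^-1) * iX x x.
Proof.
move=> Sx; have [UE AE gE] := trial_to_test_graph hd hOmega hTend hK hgamma0 hT Sx.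
have [cL0 st] := hcL; have [T1 T2] := TY hT Sx.
have EL := opE_inL2 hOmega hT Sx; have [xL _] := Sx.
have sQ := ipf_semi_ip mQ; have AEL := opA_inL2 (U0_H_A UE).
have stE : cL * ipf Q (opE K T x) (opE K T x) <=
    ipf Q (T x).1 (T x).1 + ip mux Omega (T x).2 (T x).2.
  apply: (le_trans (st _ UE)); rewrite le_eqVlt; apply/orP; left; apply/eqP; congr (_ + _).
    exact: (ipf_ae mQ AEL T1.1 AEL T1.1 AE AE).
  have g := inL2_measurable mO (gamma0_inL2 hTend hgamma0 UE).
  have m2 := inL2_measurable mO T2.
  exact: (ip_ae mO g m2 g m2 gE gE).
have := graph_norm_equiv cL0 sQ xL EL stE.
(* By the definition of E, the difference v - e is the cell-wise adjoint of [(T x).1], the middle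
   term of the Y-product. *)
rewrite {3 6}/opE subKr /sX /ipY.
set v2 := ipf Q x.1 x.1; set e2 := ipf Q (opE K T x) _; set w2 := ipf Q (T x).1 _.
set b2 := ipf Q (opAadj_h _ _) _; set g2 := ip _ _ _ _.
by rewrite (addrA (v2 + e2)) [w2 + g2 + b2]addrAC.
Qed.

End energy_norm_equivalence.

Theorem mainTheorem4 (R : realType) (d : nat) (Omega : set 'rV[R]_d) (Tend : R)
    (N : nat) (K : 'I_N -> cell R d) (kappa : R)
    (gamma0 : fld R d -> 'rV[R]_d -> R) (T : xsp R d -> ysp R d) (cL : R)
    (Pi : ysp R d -> ysp R d) (F : ysp R d -> R) (us us_h : xsp R d)
    (hd : (0 < d)%N)
    (hOmega : polyhedral_lipschitz_domain Omega)
    (hTend : 0 < Tend)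
    (hK : space_time_partition Omega Tend K kappa)
    (hgamma0 : is_gamma0 Omega Tend gamma0)
    (hT : trial_to_test Omega Tend K gamma0 T)
    (hcL : stability_constant Omega Tend gamma0 cL)
    (hPi : fortin_operator Omega Tend K gamma0 Pi)
    (hF : bounded_functional Omega Tend K F)
    (hus : space_X Omega Tend K gamma0 us)
    (hsol : forall y, space_Y Omega Tend K y -> bform Omega Tend K us y = F y)
    (hus_h : dpg_solution Omega Tend K gamma0 F us_h) :
  exists2 m : R,
    is_minimum [set normX Omega Tend K gamma0 T (us - vt) |
                vt in space_Xh Omega Tend K gamma0] m &
    normX Omega Tend K gamma0 T (us - us_h) <=
      norm_b cL * operator_norm Omega Tend K Pi * (beta cL)^-1 * m.
Proof.
have [cL0 _] := hcL.
pose s := Num.sqrt (1 + cL); pose p := operator_norm Omega Tend K Pi.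
have hX := sX_semi_ip hd hOmega hTend hK hgamma0 hT.
have hY := ipY_semi_ip hd hOmega hTend hK.
have TSY := TY hT.
have SX := space_X_linear K hOmega hTend hgamma0.
have SXh := space_Xh_linear hd hOmega hTend hK hgamma0.
have XhX := @space_Xh_X R d Omega Tend N K gamma0 hOmega hTend hgamma0.
have SYh := space_Yh_linear Omega Tend K.
have YhY := space_Yh_Y hOmega hTend hK.
have p0 : 0 <= p := operator_norm_ge0 hd hOmega hTend hK hPi.
have Pp y : space_Y Omega Tend K y -> ipY Omega Tend K (Pi y) (Pi y) <= p ^+ 2 * ipY Omega Tend K y y.
  exact: (operator_norm_le hd hOmega hTend hK hPi).
have bT x y : space_X Omega Tend K gamma0 x -> space_Y Omega Tend K y ->
    bform Omega Tend K x y = ipY Omega Tend K (T x) y.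
  by move=> Sx Yy; have [_ ->] := hT x Sx.
have PYh y : space_Y Omega Tend K y -> space_Yh Omega Tend K (Pi y) by have [H _ _ _] := hPi; exact: H.
have bP x y : space_Xh Omega Tend K gamma0 x -> space_Y Omega Tend K y ->
    bform Omega Tend K x (Pi y) = bform Omega Tend K x y.
  move=> Xx Yy; have Sx := XhX _ Xx; have YP := YhY _ (PYh _ Yy); have [_ _ _ H] := hPi.
  have := H _ _ Xx Yy; rewrite (bT _ _ Sx (subspaceB (space_Y_linear hOmega hTend hK) Yy YP)).
  by rewrite (sip_Br hY Yy YP (TSY _ Sx)) -!bT// => /eqP; rewrite subr_eq0 => /eqP.
have lam0 : 0 < 1 - s^-1 := lower_constant_gt0 cL0.
have equiv x (Sx : space_X Omega Tend K gamma0 x) :=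
  energy_norm_equiv hd hOmega hTend hK hgamma0 hT hcL Sx.
have lam_le x (Sx : space_X Omega Tend K gamma0 x) := (equiv x Sx).1.
have mu_ge x (Sx : space_X Omega Tend K gamma0 x) := (equiv x Sx).2.
have b_lin a x x' y (Sx : space_X Omega Tend K gamma0 x) (Sx' : space_X Omega Tend K gamma0 x')
  (Yy : space_Y Omega Tend K y) := bform_lin hOmega a Sx Sx' Yy.
(* The number of polynomial coefficients bounds orthonormal families in the test space and, through
   the Fortin operator, in the trial space. *)
have [finY finX] := trial_space_finite hX hY TSY bT b_lin XhX YhY PYh bP lam0 lam_le
  (@has_coefs_ex R d Omega Tend N K) (has_coefs_null hd hOmega hTend hK).
have u0 : 0 < sX Omega Tend K T (unit_trial R d) (unit_trial R d).
  apply: (lt_le_trans (unit_trial_gt0 hOmega hTend)).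
  by do 3![apply: ler_wpDr; first by rewrite ?addr_ge0 ?ip_ge0 ?ipv_ge0].
have p1 : 1 <= p := fortin_norm_ge1 hY TSY bT XhX YhY PYh p0 Pp bP lam0 lam_le
    (unit_trial_Xh K hOmega hTend hgamma0) u0.
(* The projection of the exact solution in the X-product attains the minimum. *)
have [v0 Xv0 orth] := sip_projection hX SXh XhX finX hus.
have vmin := sip_orth_minimizer hX SXh XhX hus Xv0 orth.
have [Xuh umin] := hus_h.
have SB v : space_Xh Omega Tend K gamma0 v -> space_X Omega Tend K gamma0 (us - v).
  by move=> /XhX Sv; exact: subspaceB.
have nX v : space_Xh Omega Tend K gamma0 v -> normX Omega Tend K gamma0 T (us - v) =
    Num.sqrt (sX Omega Tend K T (us - v) (us - v)).
  by move=> Xv; apply: (normX_sX hd hOmega hTend hK hgamma0 hT); exact: SB.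
exists (normX Omega Tend K gamma0 T (us - v0)).
  split; first by exists v0.
  move=> _ [v Xv <-]; rewrite !nX// ler_sqrt; first exact: vmin.
  by apply: (sip_ge0 hX); exact: SB.
have Q := dpg_quasi_optimal hX hY TSY bT b_lin SXh XhX SYh YhY finY PYh p0 Pp bP lam_le mu_ge
  p1 hus hsol Xuh umin Xv0.
have [q0 ratio] := constant_ratio cL0.
rewrite !nX//; set A := sX _ _ _ _ _ _ in Q *; set B := sX _ _ _ _ _ _ in Q *.
set q := norm_b cL * (beta cL)^-1 in q0 ratio.
have A0 : 0 <= A by apply: (sip_ge0 hX); exact: SB.
have B0 : 0 <= B by apply: (sip_ge0 hX); exact: SB.
have qp0 : 0 <= q * p by rewrite mulr_ge0.
rewrite [norm_b cL * _ * _]mulrAC -/q.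
rewrite -[leRHS]ger0_norm; last by rewrite mulr_ge0// sqrtr_ge0.
(* After squaring and multiplying by the lower equivalence constant, the left side is bounded by
   [Q], and [ratio] absorbs the upper constant. *)
rewrite -sqrtr_sqr ler_sqrt ?sqr_ge0// exprMn sqr_sqrtr// -(ler_pM2l lam0).
apply: (le_trans Q).
have -> : (1 - s^-1) * ((q * p) ^+ 2 * B) = p ^+ 2 * ((1 - s^-1) * q ^+ 2) * B by ring.
by rewrite ler_wpM2r// ler_wpM2l// sqr_ge0.
Qed.
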